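(* Let $F_X$ be a free group with finite basis $X$, let $\mathbb{A}$ be a finitely generated abelian group, and let $\preccurlyeq$ be a total order on $X^{\pm}=X\sqcup X^{-1}$. Then the map $\Gamma\mapsto\langle\Gamma\rangle$, sending an enriched automaton to the subgroup it recognizes, induces a bijection from the set of isomorphism classes of $\preccurlyeq$-normalized $\mathbb{A}$-enriched $X$-automata modulo the basepoint subgroup to the set of subgroups of $F_X\times\mathbb{A}$. (Its inverse is denoted $\mathcal{H}\mapsto \mathrm{St}_{\preccurlyeq}(\mathcal{H},X)$.) Furthermore, under this bijection finitely generated subgroups correspond precisely to finite automata, and in this case the bijection is algorithmic: from a finite generating set of $\mathcal{H}$ one can compute $\mathrm{St}_{\preccurlyeq}(\mathcal{H},X)$, and from a finite $\preccurlyeq$-normalized enriched automaton $\Gamma$ one can compute a finite generating set of $\langle\Gamma\rangle$.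
   Context: Elements of $F_X\times\mathbb{A}$ are written $w\,t^{\mathbf a}$ with $w\in F_X$, $\mathbf a\in\mathbb{A}$ ($\mathbb{A}$ additive), so $(u\,t^{\mathbf a})(v\,t^{\mathbf b})=uv\,t^{\mathbf a+\mathbf b}$. **$X$-automata.** An (involutive, pointed) $X$-automaton is a directed multigraph with arcs labeled in $X^{\pm}=X\sqcup X^{-1}$, with a distinguished vertex (the basepoint), such that each arc $e$ from $p$ to $q$ with label $x\in X^{\pm}$ has a unique associated inverse arc $e^{-1}$ from $q$ to $p$ with label $x^{-1}$. Positive arcs are those with label in $X$. A walk is a finite sequence of successively adjacent arcs (length $0$ allowed); it is reduced if it contains no two consecutive mutually inverse arcs. A basepoint-walk is a walk from the basepoint to itself. The automaton is deterministic if no two arcs with the same label depart from (or arrive at) the same vertex; core if every vertex appears in some reduced basepoint-walk; reduced if it is deterministic and core. **Enriched automata.** An $\mathbb{A}$-enriched $X$-automaton $\Gamma$ is an involutive pointed digraph together with a labeling of each arc $e$ by a triple $(\lambda_1(e),\lambda_X(e),\lambda_2(e))\in\mathbb{A}\times X^{\pm}\times\mathbb{A}$ such that each arc labeled $(\mathbf a,x,\mathbf b)$ has a unique inverse arc, labeled $(\mathbf b,x^{-1},\mathbf a)$, and together with a subgroup $L_\Gamma\leqslant\mathbb{A}$ attached to the basepoint (the basepoint subgroup). An arc labeled $(\mathbf a,x,\mathbf b)$ reads $t^{-\mathbf a}\,x\,t^{\mathbf b}=x\,t^{\mathbf b-\mathbf a}\in F_X\times\mathbb{A}$; a nontrivial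 walk reads the product of the readings of its arcs. At the basepoint one may freely read any element $t^{\mathbf l}$, $\mathbf l\in L_\Gamma$. The subgroup recognized by $\Gamma$, denoted $\langle\Gamma\rangle\leqslant F_X\times\mathbb{A}$, is the set of all elements read by basepoint-walks (thus all $g\,t^{\mathbf l}$ with $g$ the product read along a basepoint-walk and $\mathbf l\in L_\Gamma$). The skeleton $\mathrm{sk}(\Gamma)$ is the $X$-automaton obtained by forgetting $L_\Gamma$ and all abelian labels; $\Gamma$ is called deterministic, core, reduced if $\mathrm{sk}(\Gamma)$ is so. **Normalization.** Given a spanning tree $T$ of $\Gamma$, $\Gamma$ is $T$-normalized if it is reduced, $\lambda_1(e)=\mathbf 0$ for every positive arc $e$, and $\lambda_2(e)=\mathbf 0$ for every positive arc $e$ in $T$. Given the total order $\preccurlyeq$ on $X^{\pm}$, the spanning tree $T_{\preccurlyeq}(\Gamma)$ of a reduced $\Gamma$ is built recursively: start with the basepoint; then at each step take the oldest vertex already in the tree from which some arc departs to a vertex not in the tree, and add, among such arcs departing from it, the one with smallest label (with its inverse and its other endpoint). $\Gamma$ is $\preccurlyeq$-normalized if it is $T_{\preccurlyeq}(\Gamma)$-normalized. **Isomorphism modulo the basepoint subgroup.** Two enriched automata $\Gamma,\Gamma'$ are identified if $L_\Gamma=L_{\Gamma'}$ and there is an isomorphism of their skeletons (preserving basepoint, labels in $X^{\pm}$ and inversion) under which corresponding abelian labels are congruent modulo $L_\Gamma$. *)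

(* Defs.v *)
From HB Require Import structures.
From Stdlib Require List.
From mathcomp Require Import all_boot all_algebra.
From mathcomp Require Import boolp classical_sets functions cardinality.

Set Implicit Arguments.
Unset Strict Implicit.
Unset Printing Implicit Defensive.

Import GRing.Theory.

Local Open Scope classical_set_scope.

(* X^{+-} is X + X: [inl x] is the letter x and [inr x] the letter x^{-1}. *)
Definition linv (X : Type) (a : X + X) : X + X :=
  match a with inl x => inr x | inr x => inl x end.

Definition positive (X : Type) (a : X + X) : bool :=
  if a is inl _ then true else false.

Definition total_order (T : Type) (le : rel T) : Prop :=
  [/\ reflexive le, antisymmetric le, transitive le & total le].

Lemma linvK (X : Type) : involutive (@linv X).
Proof. by case. Qed.

(* The free group on X is realized by the freely reduced words over X^{+-},   *)
(* multiplied by concatenation followed by free reduction.                    *)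

Definition freely_reduced (X : eqType) (w : seq (X + X)) : bool :=
  sorted (fun a b => b != linv a) w.

Definition cons_letter (X : eqType) (a : X + X) (w : seq (X + X)) :=
  if w is b :: w' then if b == linv a then w' else a :: w else [:: a].

Definition free_reduction (X : eqType) (w : seq (X + X)) : seq (X + X) :=
  foldr (@cons_letter X) [::] w.

Definition word_inv (X : Type) (w : seq (X + X)) : seq (X + X) :=
  rev (map (@linv X) w).

Lemma freely_reduced_behead (X : eqType) (a : X + X) w :
  freely_reduced (a :: w) -> freely_reduced w.
Proof. by case: w => //= b w /andP[]. Qed.

Lemma cons_letter_reduced (X : eqType) (a : X + X) w :
  freely_reduced w -> freely_reduced (cons_letter a w).
Proof.
case: w => //= b w; case: ifP => [_|/negbT nab] /= h; last by rewrite nab h.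
exact: (@freely_reduced_behead _ b).
Qed.

Lemma foldr_reduced (X : eqType) (u w : seq (X + X)) :
  freely_reduced w -> freely_reduced (foldr (@cons_letter X) w u).
Proof. by move=> hw; elim: u => //= a u; apply: cons_letter_reduced. Qed.

Lemma free_reduction_reduced (X : eqType) (w : seq (X + X)) :
  freely_reduced (free_reduction w).
Proof. exact: foldr_reduced. Qed.

Lemma cons_letterK (X : eqType) (a : X + X) w :
  freely_reduced w -> cons_letter (linv a) (cons_letter a w) = w.
Proof.
case: w => [_|b w hw] /=; first by rewrite linvK eqxx.
case: eqP => [Eb|_] /=; last by rewrite linvK eqxx.
by rewrite {b}Eb in hw *; case: w hw => //= c w /andP[/negPf ->].
Qed.

Lemma cons_letterVK (X : eqType) (a : X + X) w :
  freely_reduced w -> cons_letter a (cons_letter (linv a) w) = w.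
Proof. by move=> hw; rewrite -{1}[a]linvK cons_letterK. Qed.

Lemma foldr_free_reduction (X : eqType) (u w : seq (X + X)) :
  freely_reduced w ->
  foldr (@cons_letter X) w (free_reduction u) = foldr (@cons_letter X) w u.
Proof.
move=> hw; elim: u => //= a u <-; case: (free_reduction u) => //= b v.
case: eqP => //= ->; rewrite cons_letterVK //; exact: foldr_reduced.
Qed.

Lemma free_reduction_id (X : eqType) (w : seq (X + X)) :
  freely_reduced w -> free_reduction w = w.
Proof.
elim: w => //= a w IH h; rewrite IH ?(freely_reduced_behead h) //.
by case: w h {IH} => //= b w /andP[/negPf ->].
Qed.

Lemma free_reduction_cat (X : eqType) (u v : seq (X + X)) :
  free_reduction (u ++ v) = foldr (@cons_letter X) (free_reduction v) u.
Proof. by rewrite /free_reduction foldr_cat. Qed.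

Lemma free_reduction_catl (X : eqType) (u v : seq (X + X)) :
  free_reduction (free_reduction u ++ v) = free_reduction (u ++ v).
Proof.
by rewrite !free_reduction_cat foldr_free_reduction // free_reduction_reduced.
Qed.

Lemma free_reduction_catr (X : eqType) (u v : seq (X + X)) :
  free_reduction (u ++ free_reduction v) = free_reduction (u ++ v).
Proof.
by rewrite !free_reduction_cat free_reduction_id // free_reduction_reduced.
Qed.

Lemma free_reduction_catV (X : eqType) (w : seq (X + X)) :
  free_reduction (w ++ word_inv w) = [::].
Proof.
rewrite /word_inv; elim: w => //= a w IH; rewrite rev_cons -rcons_cat -cats1.
by rewrite -free_reduction_catl IH /= eqxx.
Qed.

Lemma word_invK (X : Type) : involutive (@word_inv X).
Proof. by move=> w; rewrite /word_inv map_rev revK mapK //; apply: linvK. Qed.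

Record free_group (X : choiceType) := FreeGroup {
  fg_word :> seq (X + X);
  fg_wordP : freely_reduced fg_word }.

HB.instance Definition _ (X : choiceType) := [isSub for @fg_word X].
HB.instance Definition _ (X : choiceType) := [Choice of free_group X by <:].

Definition fg_of_word (X : choiceType) (w : seq (X + X)) : free_group X :=
  FreeGroup (free_reduction_reduced w).

Definition fg_one (X : choiceType) : free_group X := fg_of_word [::].

Definition fg_mul (X : choiceType) (u v : free_group X) : free_group X :=
  fg_of_word (u ++ v).

Definition fg_inv (X : choiceType) (u : free_group X) : free_group X :=
  fg_of_word (word_inv u).

Lemma fg_mulA (X : choiceType) : associative (@fg_mul X).
Proof.
move=> u v w; apply: val_inj => /=.
by rewrite free_reduction_catl free_reduction_catr catA.
Qed.

Lemma fg_mul1 (X : choiceType) : left_id (fg_one X) (@fg_mul X).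
Proof. by move=> u; apply: val_inj; rewrite /= free_reduction_id // fg_wordP. Qed.

Lemma fg_mulr1 (X : choiceType) : right_id (fg_one X) (@fg_mul X).
Proof.
by move=> u; apply: val_inj; rewrite /= cats0 free_reduction_id // fg_wordP.
Qed.

Lemma fg_mulV (X : choiceType) : right_inverse (fg_one X) (@fg_inv X) (@fg_mul X).
Proof.
move=> u; apply: val_inj; rewrite /= free_reduction_catr.
exact: free_reduction_catV.
Qed.

Lemma fg_mulVl (X : choiceType) : left_inverse (fg_one X) (@fg_inv X) (@fg_mul X).
Proof.
move=> u; apply: val_inj; rewrite /= free_reduction_catl.
by rewrite -{2}[val u]word_invK free_reduction_catV.
Qed.

HB.instance Definition _ (X : choiceType) := isGroup.Build (free_group X)
  (@fg_mulA X) (@fg_mul1 X) (@fg_mulr1 X) (@fg_mulVl X) (@fg_mulV X).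

(* F_X x A, with A written additively; (w, a) stands for w t^a. *)

Definition free_times_ab (X : choiceType) (A : zmodType) : Type :=
  (free_group X * A)%type.

HB.instance Definition _ (X : choiceType) (A : zmodType) :=
  Choice.on (free_times_ab X A).

Definition fta_one (X : choiceType) (A : zmodType) : free_times_ab X A :=
  (1%g, 0%R).

Definition fta_mul (X : choiceType) (A : zmodType) (g h : free_times_ab X A) :
    free_times_ab X A :=
  ((g.1 * h.1)%g, (g.2 + h.2)%R).

Definition fta_inv (X : choiceType) (A : zmodType) (g : free_times_ab X A) :
    free_times_ab X A :=
  ((g.1)^-1%g, (- g.2)%R).

Lemma fta_mulA (X : choiceType) (A : zmodType) : associative (@fta_mul X A).
Proof. by move=> g h k; rewrite /fta_mul /= mulgA addrA. Qed.

Lemma fta_mul1 (X : choiceType) (A : zmodType) :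
  left_id (fta_one X A) (@fta_mul X A).
Proof. by move=> [u a]; rewrite /fta_mul /= mul1g add0r. Qed.

Lemma fta_mulr1 (X : choiceType) (A : zmodType) :
  right_id (fta_one X A) (@fta_mul X A).
Proof. by move=> [u a]; rewrite /fta_mul /= mulg1 addr0. Qed.

Lemma fta_mulVl (X : choiceType) (A : zmodType) :
  left_inverse (fta_one X A) (@fta_inv X A) (@fta_mul X A).
Proof. by move=> [u a]; rewrite /fta_mul /= mulVg addNr. Qed.

Lemma fta_mulV (X : choiceType) (A : zmodType) :
  right_inverse (fta_one X A) (@fta_inv X A) (@fta_mul X A).
Proof. by move=> [u a]; rewrite /fta_mul /= mulgV subrr. Qed.

HB.instance Definition _ (X : choiceType) (A : zmodType) :=
  isGroup.Build (free_times_ab X A) (@fta_mulA X A) (@fta_mul1 X A)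
    (@fta_mulr1 X A) (@fta_mulVl X A) (@fta_mulV X A).

Definition letter_elt (X : choiceType) (A : zmodType) (a : X + X) :
    free_times_ab X A :=
  (fg_of_word [:: a], 0%R).

Definition tpow (X : choiceType) (A : zmodType) (a : A) : free_times_ab X A :=
  (1%g, a).

(* Subgroups as sets; MathComp's [group_closed] and [zmod_closed] are about   *)
(* boolean predicates.                                                        *)

Definition is_subgroup (G : groupType) (H : set G) : Prop :=
  [/\ H 1%g, (forall g h, H g -> H h -> H (g * h)%g)
    & (forall g, H g -> H (g^-1)%g)].

Definition generated_subgroup (G : groupType) (S : set G) : set G :=
  smallest (@is_subgroup G) S.

Lemma generated_subgroupP (G : groupType) (S : set G) :
  is_subgroup (generated_subgroup S).
Proof.
split=> [H [[]] // | g h hg hh H hH | g hg H hH].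
- by have [[_ HM _] _] := hH; apply: HM; [apply: hg | apply: hh].
- by have [[_ _ HV] _] := hH; apply: HV; apply: hg.
Qed.

Definition subgroups (G : groupType) : Type := {H : set G | is_subgroup H}.

Definition generated (G : groupType) (S : set G) : subgroups G :=
  exist _ (generated_subgroup S) (generated_subgroupP S).

Definition finitely_generated (G : groupType) (H : subgroups G) : Prop :=
  exists s : seq G, H = generated [set` s].

Definition is_zsubgroup (A : zmodType) (L : set A) : Prop :=
  [/\ L 0%R, (forall a b, L a -> L b -> L (a + b)%R)
    & (forall a, L a -> L (- a)%R)].

Definition generated_zsubgroup (A : zmodType) (S : set A) : set A :=
  smallest (@is_zsubgroup A) S.

Lemma generated_zsubgroupP (A : zmodType) (S : set A) :
  is_zsubgroup (generated_zsubgroup S).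
Proof.
split=> [L [[]] // | a b ha hb L hL | a ha L hL].
- by have [[_ LD _] _] := hL; apply: LD; [apply: ha | apply: hb].
- by have [[_ _ LN] _] := hL; apply: LN; apply: ha.
Qed.

Definition generates_ab (A : zmodType) (s : seq A) : Prop :=
  generated_zsubgroup [set` s] = [set: A].

Definition fg_abelian (A : zmodType) : Prop := exists s : seq A, generates_ab s.

Record automaton (X : Type) := Automaton {
  vertex : Type;
  arcT : Type;
  src : arcT -> vertex;
  tgt : arcT -> vertex;
  lab : arcT -> X + X;
  ainv : arcT -> arcT;
  basepoint : vertex;
  ainvK : involutive ainv;
  src_ainv : forall e, src (ainv e) = tgt e;
  tgt_ainv : forall e, tgt (ainv e) = src e;
  lab_ainv : forall e, lab (ainv e) = linv (lab e) }.

Fixpoint walk (X : Type) (G : automaton X) (p : vertex G) (es : seq (arcT G))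
    (q : vertex G) : Prop :=
  if es is e :: es' then src e = p /\ walk (tgt e) es' q else p = q.

Definition reduced_walk (X : Type) (G : automaton X) (es : seq (arcT G)) : Prop :=
  ~ exists es1 e es2, es = es1 ++ [:: e, ainv e & es2].

Definition deterministic (X : Type) (G : automaton X) : Prop :=
  forall e e' : arcT G, lab e = lab e' -> (src e = src e' \/ tgt e = tgt e') ->
    e = e'.

Definition core (X : Type) (G : automaton X) : Prop :=
  forall v : vertex G, exists es1 es2,
    [/\ walk (basepoint G) es1 v, walk v es2 (basepoint G)
      & reduced_walk (es1 ++ es2)].

Definition reduced (X : Type) (G : automaton X) : Prop :=
  deterministic G /\ core G.

Definition finite_automaton (X : Type) (G : automaton X) : Prop :=
  finite_set [set: vertex G] /\ finite_set [set: arcT G].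

(* Construction of the spanning tree T_le(G). A stage consists of the list of *)
(* the vertices reached so far, oldest first, and of the set of tree arcs.    *)

Definition next_tree_arc (X : Type) (le : rel (X + X)) (G : automaton X)
    (vs : seq (vertex G)) (e : arcT G) : Prop :=
  exists vs1 vs2,
    [/\ vs = vs1 ++ src e :: vs2,
        ~ List.In (tgt e) vs,
        (forall e', List.In (src e') vs1 -> List.In (tgt e') vs)
      & (forall e', src e' = src e -> ~ List.In (tgt e') vs ->
           le (lab e) (lab e'))].

Inductive tree_stage (X : Type) (le : rel (X + X)) (G : automaton X) :
    seq (vertex G) -> set (arcT G) -> Prop :=
| tree_stage0 : tree_stage le [:: basepoint G] set0
| tree_stageS vs T e : tree_stage le vs T -> next_tree_arc le vs e ->
    tree_stage le (rcons vs (tgt e)) (T `|` [set e] `|` [set ainv e]).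

Definition ordered_tree (X : Type) (le : rel (X + X)) (G : automaton X) :
    set (arcT G) :=
  [set e | exists vs T, tree_stage le vs T /\ T e].

Record enriched (X : Type) (A : zmodType) := Enriched {
  skeleton :> automaton X;
  lab1 : arcT skeleton -> A;
  lab2 : arcT skeleton -> A;
  base_subgroup : set A;
  lab1_ainv : forall e, lab1 (ainv e) = lab2 e;
  lab2_ainv : forall e, lab2 (ainv e) = lab1 e;
  base_subgroupP : is_zsubgroup base_subgroup }.

Definition arc_reading (X : choiceType) (A : zmodType) (G : enriched X A)
    (e : arcT G) : free_times_ab X A :=
  (tpow X (- lab1 e)%R * letter_elt A (lab e) * tpow X (lab2 e))%g.

Definition walk_reading (X : choiceType) (A : zmodType) (G : enriched X A)
    (es : seq (arcT G)) : free_times_ab X A :=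
  (\prod_(e <- es) arc_reading e)%g.

Definition recognized (X : choiceType) (A : zmodType) (G : enriched X A) :
    set (free_times_ab X A) :=
  [set h | exists es l, [/\ walk (basepoint G) es (basepoint G),
     base_subgroup G l & h = (walk_reading es * tpow X l)%g]].

Definition tree_normalized (X : Type) (A : zmodType) (G : enriched X A)
    (T : set (arcT G)) : Prop :=
  [/\ reduced G,
      (forall e : arcT G, positive (lab e) -> lab1 e = 0%R)
    & (forall e : arcT G, positive (lab e) -> T e -> lab2 e = 0%R)].

Definition normalized (X : Type) (A : zmodType) (le : rel (X + X))
    (G : enriched X A) : Prop :=
  tree_normalized (ordered_tree le (G := G)).

Definition iso_mod_base (X : Type) (A : zmodType) (G G' : enriched X A) : Prop :=
  base_subgroup G = base_subgroup G' /\
  exists (fv : vertex G -> vertex G') (fe : arcT G -> arcT G'),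
    [/\ bijective fv /\ bijective fe,
        fv (basepoint G) = basepoint G',
        (forall e, src (fe e) = fv (src e) /\ tgt (fe e) = fv (tgt e)),
        (forall e, lab (fe e) = lab e /\ fe (ainv e) = ainv (fe e))
      & (forall e, base_subgroup G (lab1 (fe e) - lab1 e)%R /\
                   base_subgroup G (lab2 (fe e) - lab2 e)%R)].

(* Sets of automata are plain predicates and not MathComp [set]s: universe    *)
(* constraints in the classical library keep [set] from applying to a type    *)
(* that quantifies over types as large as the ordinals.                       *)

Definition iso_class (X : Type) (A : zmodType) (le : rel (X + X))
    (G : enriched X A) : enriched X A -> Prop :=
  fun G' => normalized le G' /\ iso_mod_base G G'.

Definition iso_classes (X : Type) (A : zmodType) (le : rel (X + X)) : Type :=
  {C : enriched X A -> Prop |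
    exists2 G : enriched X A, normalized le G & C = iso_class le G}.

Definition class_of (X : Type) (A : zmodType) (le : rel (X + X))
    (G : enriched X A) (hG : normalized le G) : iso_classes A le :=
  exist _ (iso_class le G) (ex_intro2 _ _ G hG erefl).

(* Kleene's total recursive functions: the least class containing the zero    *)
(* and successor functions and the projections, and closed under composition, *)
(* primitive recursion and minimization of regular functions.                 *)

Inductive recursive : forall k : nat, (k.-tuple nat -> nat) -> Prop :=
| recursive_zero k : recursive (fun _ : k.-tuple nat => 0)
| recursive_succ : recursive (fun v : 1.-tuple nat => (thead v).+1)
| recursive_proj k (i : 'I_k) : recursive (fun v : k.-tuple nat => tnth v i)
| recursive_comp k m (f : m.-tuple nat -> nat)
    (g : 'I_m -> k.-tuple nat -> nat) :
    recursive f -> (forall i, recursive (g i)) ->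
    recursive (fun v => f [tuple g i v | i < m])
| recursive_prim k (f : k.-tuple nat -> nat) (g : k.+2.-tuple nat -> nat) :
    recursive f -> recursive g ->
    recursive (fun v : k.+1.-tuple nat =>
      iteri (thead v) (fun i r => g [tuple of [:: i, r & behead v]])
        (f [tuple of behead v]))
| recursive_min k (f : k.+1.-tuple nat -> nat) (g : k.-tuple nat -> nat) :
    recursive f ->
    (forall v, f [tuple of g v :: v] = 0 /\
               forall m, m < g v -> f [tuple of m :: v] <> 0) ->
    recursive g.

(* Computability relative to the effective encodings [pickle]. *)
Definition computable (T U : countType) (f : T -> U) : Prop :=
  exists F : 1.-tuple nat -> nat,
    recursive F /\ forall x, F [tuple pickle x] = pickle (f x).

(* Finite data. Once generators t_0, ..., t_(r-1) of A are fixed, an element  *)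
(* of A is given by the coefficients of an integer combination of the t_i,    *)
(* and an element of F_X by any word, reduced or not, representing it.        *)

Definition zcomb (A : zmodType) (r : nat) (t : r.-tuple A) (z : r.-tuple int) : A :=
  (\sum_(i < r) tnth t i *~ tnth z i)%R.

Definition elt_code (X : finType) (r : nat) : countType :=
  (seq (X + X) * r.-tuple int)%type.

Definition elt_of_code (X : finType) (A : zmodType) (r : nat) (t : r.-tuple A)
    (c : elt_code X r) : free_times_ab X A :=
  (fg_of_word c.1, zcomb t c.2).

Definition generated_by_codes (X : finType) (A : zmodType) (r : nat)
    (t : r.-tuple A) (s : seq (elt_code X r)) : subgroups (free_times_ab X A) :=
  generated [set` [seq elt_of_code t c | c <- s]].

(* (n, es, ls) encodes the enriched automaton with vertices 0, ..., n and     *)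
(* basepoint 0; each entry (p, a, x, b, q) of es is a positive arc from p to  *)
(* q labeled (a, x, b), whose inverse is left implicit; ls lists generators   *)
(* of the basepoint subgroup. A vertex number greater than n is read as 0.    *)
Definition automaton_code (X : finType) (r : nat) : countType :=
  (nat * seq (nat * r.-tuple int * X * r.-tuple int * nat)
       * seq (r.-tuple int))%type.

Section Decode.
Context (X : finType) (A : zmodType) (r : nat) (t : r.-tuple A).
Context (c : automaton_code X r).

Let n : nat := c.1.1.
Let es := c.1.2.

(* (i, true) is the i-th positive arc and (i, false) is its inverse.          *)
Let darc : Type := ('I_(size es) * bool)%type.
Let entry (e : darc) := tnth (in_tuple es) e.1.
Let dinit (e : darc) : 'I_n.+1 := inord (entry e).1.1.1.1.
Let dterm (e : darc) : 'I_n.+1 := inord (entry e).2.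
Let dlab1 (e : darc) : A := zcomb t (entry e).1.1.1.2.
Let dlab2 (e : darc) : A := zcomb t (entry e).1.2.

Definition decode_skeleton : automaton X.
Proof.
refine (@Automaton X 'I_n.+1 darc
  (fun e => if e.2 then dinit e else dterm e)
  (fun e => if e.2 then dterm e else dinit e)
  (fun e => if e.2 then inl (entry e).1.1.2 else inr (entry e).1.1.2)
  (fun e => (e.1, ~~ e.2)) ord0 _ _ _ _); by case=> i [].
Defined.

Definition decode : enriched X A.
Proof.
refine (@Enriched X A decode_skeleton
  (fun e => if e.2 then dlab1 e else dlab2 e)
  (fun e => if e.2 then dlab2 e else dlab1 e)
  (generated_zsubgroup [set` [seq zcomb t l | l <- c.2]]) _ _
  (generated_zsubgroupP _)); by case=> i [].
Defined.

End Decode.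

(* Main.v *)
Require Import Defs.
From mathcomp Require Import all_boot all_algebra.
From mathcomp Require Import boolp classical_sets functions cardinality.

Set Implicit Arguments.
Unset Strict Implicit.
Unset Printing Implicit Defensive.

(** A reduced automaton reads each element of the free group along at most one
    reduced walk from the basepoint: free reduction of a label can be performed on the walk
    itself, and it changes neither the end of the walk nor the sum of the abelian
    shifts of its arcs ([walk_determined]). So the free part K of the recognized
    subgroup H, that is, its projection to the free group, determines the skeleton
    as the core of the Schreier graph of K, and H determines the abelian labels
    modulo the basepoint subgroup L, which consists of the elements of H with
    trivial free part. Indeed, in a normalized automaton the walks inside of the
    ordered tree have shift zero, and each positive arc, closed up by tree walks,
    shows its label as the abelian part of an element of H whose free part is known
    ([recognized_iso]). This needs that the ordered tree reaches every vertex
    ([ordered_tree_spans]): as X is finite, a vertex of the tree cannot be passed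
    over for ever while arcs out of it still lead to new vertices.

    Conversely, let H be given. The cosets of K represented by prefixes of reduced
    words of K are the vertices of a reduced automaton that spells K; for each
    positive arc one completes the free element of its closed-up tree walk to an
    element of H, choosing zero on tree arcs, and takes the abelian part as the
    label ([subgroup_automaton]). Both facts together give the bijection.

    A finite automaton recognizes a finitely generated subgroup because the loops
    through its arcs and generators of L suffice, subgroups of A being finitely
    generated ([zsubgroup_of_span]). Walks that read a finite set of generators of H
    involve finitely many arcs, and every reduced basepoint-walk is the reduction of
    a product of them and of their inverses, so that there are no other arcs
    ([fg_finite_automaton]).

    For the algorithms, computable functions are shown to be closed under
    composition, list recursion and unbounded search ([computable_search]). The
    loops of a coded automaton are found by listing its short walks
    ([code_generators_correct]). The automaton of a coded subgroup is found by
    search: a boolean check ([stallings_check]) verifies that a code is normalized,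
    by means of a list of the tree arcs, and that the given generators and the loops
    of the code are products of one another, both compared as reduced words with
    integer vectors. The check is sound over every A ([stallings_check_sound]). It
    succeeds on some code ([stallings_check_complete]), because the bijection can be
    applied to the subgroup generated in the product of the free group with the
    group of integer vectors, where equality of elements is equality of vectors and
    of reduced words. *)

(** * Recursive functions on numbers *)

Lemma recursive_comp1 k (f : 1.-tuple nat -> nat) (g : k.-tuple nat -> nat) :
  recursive f -> recursive g -> recursive (fun v => f [tuple g v]).
Proof.
move=> rf rg.
have -> : (fun v => f [tuple g v]) =
    (fun v : k.-tuple nat => f [tuple (fun=> g) i v | i < 1]).
  by apply/funext => v; congr f; apply: eq_from_tnth => i;
    rewrite tnth_mktuple (ord1 i).
exact: recursive_comp.
Qed.

Definition recursive1 (f : nat -> nat) : Prop :=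
  recursive (fun v : 1.-tuple nat => f (thead v)).

Definition recursive2 (f : nat -> nat -> nat) : Prop :=
  recursive (fun v : 2.-tuple nat => f (thead v) (tnth v ord_max)).

Lemma recursive1_app k f (g : k.-tuple nat -> nat) :
  recursive1 f -> recursive g -> recursive (fun v => f (g v)).
Proof. by move=> rf rg; have := recursive_comp1 rf rg. Qed.

Lemma recursive2_app k f (g h : k.-tuple nat -> nat) :
  recursive2 f -> recursive g -> recursive h ->
  recursive (fun v => f (g v) (h v)).
Proof.
move=> rf rg rh.
have -> : (fun v => f (g v) (h v)) = (fun v : k.-tuple nat =>
    (fun v : 2.-tuple nat => f (thead v) (tnth v ord_max))
      [tuple (if i == ord0 then g else h) v | i < 2]).
  by apply/funext => v; rewrite /thead !tnth_mktuple.
by apply: (recursive_comp rf) => i; case: ifP.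
Qed.

Lemma recursive_const k n : recursive (fun _ : k.-tuple nat => n).
Proof.
elim: n => [|n IH]; first exact: recursive_zero.
by have := recursive_comp1 recursive_succ IH.
Qed.

Lemma recursive_iteri k (n b : k.-tuple nat -> nat) (h : k.+2.-tuple nat -> nat) :
  recursive n -> recursive b -> recursive h ->
  recursive (fun v => iteri (n v) (fun i r => h [tuple of [:: i, r & v]]) (b v)).
Proof.
move=> rn rb rh; have rp := recursive_prim rb rh.
pose g (i : 'I_k.+1) : k.-tuple nat -> nat :=
  if unlift ord0 i is Some j then fun v => tnth v j else n.
have rg i : recursive (g i).
  by rewrite /g; case: unlift => [j|] //; apply: recursive_proj.
have Eg v : [tuple g i v | i < k.+1] = [tuple of n v :: v].
  apply: eq_from_tnth => i; rewrite tnth_mktuple /g.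
  by case: unliftP => [j ->|->]; rewrite ?tnthS ?tnth0.
have := recursive_comp rp rg; congr recursive; apply/funext => v.
rewrite Eg theadE; have -> : [tuple of behead [tuple of n v :: v]] = v.
  exact: val_inj.
congr iteri; apply/funext => i; apply/funext => r; congr h; exact: val_inj.
Qed.

Lemma recursive_iteri2 k (n b : k.-tuple nat -> nat) (h : nat -> nat -> nat) :
  recursive n -> recursive b -> recursive2 h ->
  recursive (fun v => iteri (n v) h (b v)).
Proof.
move=> rn rb rh.
have rh' : recursive (fun w : k.+2.-tuple nat => h (thead w) (tnth w (lift ord0 ord0))).
  by apply: recursive2_app => //; apply: recursive_proj.
by have := recursive_iteri rn rb rh'.
Qed.

Lemma recursive2_fst f : recursive1 f -> recursive2 (fun a _ => f a).
Proof. move=> rf; apply: recursive1_app rf _; exact: recursive_proj. Qed.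

Lemma recursive2_snd f : recursive1 f -> recursive2 (fun _ b => f b).
Proof. move=> rf; apply: recursive1_app rf _; exact: recursive_proj. Qed.

Lemma recursive1_id : recursive1 id. Proof. exact: recursive_proj. Qed.

Lemma recursive1_succ : recursive1 succn. Proof. exact: recursive_succ. Qed.

Lemma recursive1_comp f g : recursive1 f -> recursive1 g -> recursive1 (f \o g).
Proof. by move=> rf rg; apply: recursive1_app rf rg. Qed.

Lemma recursive1_app2 f g h : recursive2 f -> recursive1 g -> recursive1 h ->
  recursive1 (fun n => f (g n) (h n)).
Proof. by move=> rf rg rh; apply: recursive2_app rf rg rh. Qed.

Lemma recursive2_app2 f g h : recursive2 f -> recursive2 g -> recursive2 h ->
  recursive2 (fun m n => f (g m n) (h m n)).
Proof. by move=> rf rg rh; apply: recursive2_app rf rg rh. Qed.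

Lemma recursive2_iter f : recursive1 f -> recursive2 (fun n b => iter n f b).
Proof.
move=> rf.
have := recursive_iteri2 (recursive_proj (ord0 : 'I_2)) (recursive_proj ord_max)
  (recursive2_snd rf).
exact.
Qed.

Lemma recursive1_const n : recursive1 (fun=> n).
Proof. exact: recursive_const. Qed.

Lemma recursive1_iteri n b h : recursive1 n -> recursive1 b -> recursive2 h ->
  recursive1 (fun m => iteri (n m) h (b m)).
Proof. by move=> rn rb rh; apply: recursive_iteri2. Qed.

Lemma recursive2_add : recursive2 addn.
Proof.
have := recursive2_iter recursive1_succ; congr recursive; apply/funext => v.
by elim: (thead v) => //= n ->.
Qed.

Lemma recursive1_pred : recursive1 predn.
Proof.
have := recursive1_iteri recursive1_id (recursive1_const 0)
  (recursive2_fst recursive1_id).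
by congr recursive; apply/funext => v /=; case: (thead v).
Qed.

Lemma recursive2_sub : recursive2 subn.
Proof.
have := recursive2_app2 (recursive2_iter recursive1_pred)
  (recursive2_snd recursive1_id) (recursive2_fst recursive1_id).
congr recursive; apply/funext => v.
by elim: (tnth v _) => [|n IH]; rewrite ?subn0 // subnS /= -IH.
Qed.

(** The branch is taken by iterating a constant step [c v] times. *)
Lemma recursive_if k (c a b : k.-tuple nat -> nat) :
  recursive c -> recursive a -> recursive b ->
  recursive (fun v => if c v is 0 then a v else b v).
Proof.
move=> rc ra rb.
have := recursive_iteri (h := fun w : k.+2.-tuple nat =>
  b [tuple tnth w (lift ord0 (lift ord0 i)) | i < k]) rc ra.
have -> : (fun v : k.-tuple nat => if c v is 0 then a v else b v) =
  (fun v => iteri (c v) (fun i r => b [tuple tnth [tuple of [:: i, r & v]]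
    (lift ord0 (lift ord0 j)) | j < k]) (a v)).
  apply/funext => v; case: (c v) => //= n; congr b.
  by apply: eq_from_tnth => i; rewrite tnth_mktuple !tnthS.
by apply; apply: (recursive_comp rb) => i; apply: recursive_proj.
Qed.

Lemma recursive1_if c a b : recursive1 c -> recursive1 a -> recursive1 b ->
  recursive1 (fun n => if c n is 0 then a n else b n).
Proof. exact: recursive_if. Qed.

Lemma recursive1_odd : recursive1 (fun n => odd n).
Proof.
have := recursive1_iteri recursive1_id (recursive1_const 0) (recursive2_snd
  (recursive1_app2 recursive2_sub (recursive1_const 1) recursive1_id)).
congr recursive; apply/funext => v /=.
by elim: (thead v) => //= n ->; case: odd.
Qed.

Lemma recursive1_half : recursive1 half.
Proof.
have := recursive1_iteri recursive1_id (recursive1_const 0) (recursive2_app2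
  recursive2_add (recursive2_fst recursive1_odd) (recursive2_snd recursive1_id)).
congr recursive; apply/funext => v /=.
by elim: (thead v) => //= n ->; rewrite uphalf_half.
Qed.

(** [CodeSeq.code] is the iteration of this bijection from pairs of numbers to
    positive numbers. *)
Definition code_cons (a b : nat) := 2 ^ a * b.*2.+1.

Definition code_head (n : nat) := logn 2 n.

Definition code_tail (n : nat) := (iter (code_head n) half n)./2.

Lemma code_consS a b : code_cons a.+1 b = (code_cons a b).*2.
Proof. by rewrite /code_cons expnS -mulnA mul2n. Qed.

Lemma iter_half_code a b : iter a half (code_cons a b) = b.*2.+1.
Proof.
by elim: a => [|a IH]; rewrite ?iterSr ?code_consS ?doubleK // /code_cons mul1n.
Qed.

Lemma code_headK a b : code_head (code_cons a b) = a.
Proof.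
rewrite /code_head /code_cons lognM ?expn_gt0 // pfactorK // lognE /=.
by rewrite dvdn2 /= odd_double addn0.
Qed.

Lemma code_tailK a b : code_tail (code_cons a b) = b.
Proof. by rewrite /code_tail code_headK iter_half_code /= uphalf_double. Qed.

Lemma code_head0 : code_head 0 = 0. Proof. by []. Qed.

Lemma code_cons_gt0 a b : 0 < code_cons a b.
Proof. by rewrite /code_cons muln_gt0 expn_gt0. Qed.

Lemma code_consP n : 0 < n -> exists a b, n = code_cons a b.
Proof.
move=> n_gt0; have := CodeSeq.decodeK n.
case: (CodeSeq.decode n) => [|a s] /= E; first by rewrite -E in n_gt0.
by exists a, (CodeSeq.code s).
Qed.

Lemma recursive2_code_cons : recursive2 code_cons.
Proof.
have := recursive2_app2 (recursive2_iter (recursive1_app2 recursive2_add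
   recursive1_id recursive1_id)) (recursive2_fst recursive1_id)
  (recursive2_snd (recursive1_comp recursive1_succ (recursive1_app2 recursive2_add
   recursive1_id recursive1_id))).
congr recursive; apply/funext => v; elim: (thead v) => /= [|n IH].
  by rewrite /code_cons mul1n addnn.
by rewrite code_consS -addnn -IH.
Qed.

Lemma recursive1_code_head : recursive1 code_head.
Proof.
pose c a n := 1 - odd (iter a half n).
(* The head of n > 0 is the number of halvings after which n becomes odd. *)
have rf : recursive2 (fun a n => if n is 0 then 0 else c a n).
  apply: recursive_if; [exact: recursive_proj | exact: recursive_const |].
  apply: (recursive2_app recursive2_sub); first exact: recursive_const.
  apply: (recursive1_app recursive1_odd).
  apply: (recursive2_app (recursive2_iter recursive1_half));
   exact: recursive_proj.
apply: (recursive_min rf) => v.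
have -> : tnth [tuple of code_head (thead v) :: v] ord_max = thead v.
  by rewrite (_ : ord_max = lift ord0 ord0) ?tnthS //; apply: val_inj.
case: (posnP (thead v)) => [->|/code_consP[a [b Ev]]].
  by rewrite code_head0; split.
split.
  rewrite theadE Ev code_headK /c iter_half_code /= odd_double.
  by case: (code_cons a b).
move=> m; have -> : tnth [tuple of m :: v] ord_max = thead v.
  by rewrite (_ : ord_max = lift ord0 ord0) ?tnthS //; apply: val_inj.
rewrite theadE Ev code_headK => ltma.
have: 0 < code_cons a b by exact: code_cons_gt0.
case E: (code_cons a b) => [//|k] _; rewrite -E /c.
have -> : iter m half (code_cons a b) = code_cons (a - m) b.
  elim: m ltma {v Ev E k} => [|m IH] ltma; first by rewrite subn0.
  rewrite iterS IH 1?ltnW //.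
  by rewrite -(@prednK (a - m)) ?subn_gt0 1?ltnW // code_consS doubleK subnS.
by rewrite -(@prednK (a - m)) ?subn_gt0 // code_consS odd_double.
Qed.

Lemma recursive1_code_tail : recursive1 code_tail.
Proof.
apply: (recursive1_comp recursive1_half).
apply: (recursive1_app2 (recursive2_iter recursive1_half)).
  exact: recursive1_code_head.
exact: recursive1_id.
Qed.

(** Recursions on coded data have a parameter; packing it with the counter and the
    accumulator keeps the step function unary. *)
Lemma recursive1_rec n b h : recursive1 n -> recursive1 b -> recursive1 h ->
  recursive1 (fun m =>
    iteri (n m) (fun i r => h (code_cons m (code_cons i r))) (b m)).
Proof.
move=> rn rb rh.
have rh' : recursive (fun w : 3.-tuple nat => h (code_cons
    (tnth w (lift ord0 (lift ord0 ord0)))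
    (code_cons (thead w) (tnth w (lift ord0 ord0))))).
  apply: (recursive1_app rh).
  apply: recursive2_app; first exact: recursive2_code_cons.
    exact: recursive_proj.
  by apply: recursive2_app; first exact: recursive2_code_cons; exact: recursive_proj.
have := recursive_iteri rn rb rh'; congr recursive; apply/funext => v.
by congr iteri; apply/funext => i; apply/funext => r; rewrite theadE !tnthS tnth0.
Qed.

Lemma recursive1_min f g : recursive1 f ->
  (forall n, f (code_cons n (g n)) = 0 /\
     forall m, m < g n -> f (code_cons n m) <> 0) ->
  recursive1 g.
Proof.
move=> rf fg; apply: (@recursive_min 1 (fun w => f (code_cons (tnth w ord_max) (thead w)))).
  apply: (recursive1_app rf); apply: recursive2_app; first exact: recursive2_code_cons.
    exact: recursive_proj.
  exact: recursive_proj.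
move=> v; have E m : tnth [tuple of m :: v] ord_max = thead v.
  by rewrite (_ : ord_max = lift ord0 ord0) ?tnthS //; apply: val_inj.
have [f0 fn0] := fg (thead v); split; first by rewrite E theadE.
by move=> m ltm; rewrite E theadE; apply: fn0.
Qed.

(** * A calculus of computable functions *)

Lemma computableE (T U : countType) (f : T -> U) :
  computable f <-> exists2 F, recursive1 F & forall x, F (pickle x) = pickle (f x).
Proof.
split=> [[F [rF EF]]|[F rF EF]].
  exists (fun n => F [tuple n]) => //.
  have := recursive_comp1 rF recursive1_id; exact.
by exists (fun v => F (thead v)); split.
Qed.

Lemma computable_ext (T U : countType) (f g : T -> U) :
  f =1 g -> computable f -> computable g.
Proof. by move=> /funext ->. Qed.

Lemma computable_same_code (T U : countType) (f : T -> U) :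
  (forall x, pickle (f x) = pickle x) -> computable f.
Proof.
by move=> fE; apply/computableE; exists id => //; exact: recursive1_id.
Qed.

Lemma computable_id (T : countType) : computable (@id T).
Proof. exact: computable_same_code. Qed.

Lemma computable_comp (S T U : countType) (f : T -> U) (g : S -> T) :
  computable f -> computable g -> computable (fun x => f (g x)).
Proof.
move=> /computableE[F rF EF] /computableE[G rG EG]; apply/computableE.
by exists (F \o G) => [|x /=]; [exact: recursive1_comp | rewrite EG EF].
Qed.

Lemma computable_const (T U : countType) (u : U) : computable (fun _ : T => u).
Proof.
by apply/computableE; exists (fun=> pickle u) => //; exact: recursive1_const.
Qed.

Lemma pickle_pair (T U : countType) (x : T * U) :
  pickle x = code_cons (pickle x.1) (code_cons (pickle x.2) 0).
Proof. by case: x. Qed.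

Lemma pickle_cons (T : countType) (a : T) s :
  pickle (a :: s) = code_cons (pickle a) (pickle s).
Proof. by []. Qed.

Lemma computable_pair (S T U : countType) (f : S -> T) (g : S -> U) :
  computable f -> computable g -> computable (fun x => (f x, g x)).
Proof.
move=> /computableE[F rF EF] /computableE[G rG EG]; apply/computableE.
exists (fun n => code_cons (F n) (code_cons (G n) 0)) => [|x].
  apply: recursive1_app2 rF _; first exact: recursive2_code_cons.
  by apply: recursive1_app2 rG (recursive1_const 0); exact: recursive2_code_cons.
by rewrite pickle_pair EF EG.
Qed.

Lemma computable_fst (T U : countType) : computable (@fst T U).
Proof.
apply/computableE; exists code_head => [|x]; first exact: recursive1_code_head.
by rewrite pickle_pair code_headK.
Qed.

Lemma computable_snd (T U : countType) : computable (@snd T U).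
Proof.
apply/computableE; exists (code_head \o code_tail) => [|x].
  exact: recursive1_comp recursive1_code_head recursive1_code_tail.
by rewrite pickle_pair /= code_tailK code_headK.
Qed.

(** Functions of several arguments are handled by pairing; [computable2] is the
    form in which they get composed. *)
Definition computable2 (S T U : countType) (f : S -> T -> U) : Prop :=
  computable (fun p : S * T => f p.1 p.2).

Lemma computable_app2 (R S T U : countType) (f : S -> T -> U) (g : R -> S)
    (h : R -> T) :
  computable2 f -> computable g -> computable h -> computable (fun x => f (g x) (h x)).
Proof.
by move=> cf cg ch; have := computable_comp cf (computable_pair cg ch).
Qed.

Definition computable3 (S T U V : countType) (f : S -> T -> U -> V) : Prop :=
  computable (fun p : S * (T * U) => f p.1 p.2.1 p.2.2).

Lemma computable_app3 (R S T U V : countType) (f : S -> T -> U -> V)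
    (g : R -> S) (h : R -> T) (k : R -> U) :
  computable3 f -> computable g -> computable h -> computable k ->
  computable (fun x => f (g x) (h x) (k x)).
Proof.
move=> cf cg ch ck.
by have := computable_comp cf (computable_pair cg (computable_pair ch ck)).
Qed.

Lemma computable_fst_of (S T U : countType) (f : S -> T * U) :
  computable f -> computable (fun x => (f x).1).
Proof. exact: (computable_comp (@computable_fst T U)). Qed.

Lemma computable_snd_of (S T U : countType) (f : S -> T * U) :
  computable f -> computable (fun x => (f x).2).
Proof. exact: (computable_comp (@computable_snd T U)). Qed.

Lemma computable_iteri (S T : countType) (n : S -> nat) (b : S -> T)
    (h : S -> nat -> T -> T) :
  computable n -> computable b ->
  computable3 h ->
  computable (fun x => iteri (n x) (h x) (b x)).
Proof.
move=> /computableE[N rN EN] /computableE[B rB EB] /computableE[H rH EH].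
apply/computableE.
exists (fun m => iteri (N m) (fun i r => H (code_cons m
   (code_cons (code_cons i (code_cons r 0)) 0))) (B m)).
  pose H' p := H (code_cons (code_head p) (code_cons
    (code_cons (code_head (code_tail p)) (code_cons (code_tail (code_tail p)) 0)) 0)).
  have rH' : recursive1 H'.
    have r0 := recursive1_code_head; have r1 := recursive1_code_tail.
    have rc := recursive2_code_cons; have rz := recursive1_const 0.
    apply: (recursive1_comp rH); apply: (recursive1_app2 rc r0).
    apply: (recursive1_app2 rc) => //; apply: (recursive1_app2 rc).
      exact: recursive1_comp r0 r1.
    by apply: (recursive1_app2 rc _ rz); exact: (recursive1_comp r1 r1).
  have := recursive1_rec rN rB rH'; congr recursive; apply/funext => v.
  congr iteri; apply/funext => i; apply/funext => r.
  by rewrite /H' !(code_headK, code_tailK).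
move=> x; rewrite EN EB; have -> : pickle (n x) = n x by [].
by elim: (n x) => //= m ->; rewrite -(EH (x, (m, iteri m (h x) (b x)))) !pickle_pair.
Qed.

Lemma computable_iter (S T : countType) (n : S -> nat) (b : S -> T) (h : S -> T -> T) :
  computable n -> computable b -> computable2 h ->
  computable (fun x => iter (n x) (h x) (b x)).
Proof.
move=> cn cb ch; have := @computable_iteri _ _ n b (fun x _ => h x) cn cb.
apply; apply: computable_app2 ch _ _; first exact: computable_fst.
by apply: computable_snd_of; exact: computable_snd.
Qed.

Lemma computable_if (S T : countType) (c : S -> bool) (f g : S -> T) :
  computable c -> computable f -> computable g ->
  computable (fun x => if c x then f x else g x).
Proof.
move=> /computableE[C rC EC] /computableE[F rF EF] /computableE[G rG EG].
apply/computableE; exists (fun n => if C n is 0 then G n else F n).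
  exact: recursive1_if.
by move=> x; rewrite EC EF EG; case: (c x).
Qed.

(** A table of the finitely many values computes the function. *)
Lemma computable_fin (T : finType) (U : countType) (f : T -> U) : computable f.
Proof.
suff [F rF EF] : exists2 F, recursive1 F &
    forall x, x \in enum T -> F (pickle x) = pickle (f x).
  by apply/computableE; exists F => // x; rewrite EF // mem_enum.
elim: (enum T) => [|a s [F rF EF]]; first by exists id => //; exact: recursive1_id.
pose d n := (n - pickle a) + (pickle a - n).
exists (fun n => if d n is 0 then pickle (f a) else F n).
  have ra := recursive1_const (pickle a).
  apply: recursive1_if => //; last exact: recursive1_const.
  by apply: (recursive1_app2 recursive2_add);
    apply: (recursive1_app2 recursive2_sub) => //; exact: recursive1_id.
have d0 x : d (pickle x) = 0 -> x = a.
  move/eqP; rewrite addn_eq0 !subn_eq0 -eqn_leq => /eqP.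
  exact: (pcan_inj pickleK).
move=> x; rewrite inE; case: (x =P a) => [-> _|nxa /EF Ex].
  by rewrite /d subnn.
by case E: (d (pickle x)) => //; have := d0 _ E.
Qed.

Lemma computable_eq (T : countType) : computable2 (@eq_op T).
Proof.
apply/computableE; pose a := code_head; pose b n := code_head (code_tail n).
exists (fun n => if a n - b n + (b n - a n) is 0 then 1 else 0).
  have ra : recursive1 a by exact: recursive1_code_head.
  have rb : recursive1 b by apply: recursive1_comp ra recursive1_code_tail.
  apply: recursive1_if; try exact: recursive1_const.
  by apply: (recursive1_app2 recursive2_add);
    apply: (recursive1_app2 recursive2_sub).
move=> [x y]; rewrite pickle_pair /a /b /= code_tailK !code_headK.
case: eqVneq => [->|nxy]; first by rewrite subnn.
case E: (_ + _) => //; case/eqP: nxy; apply: (pcan_inj pickleK).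
by move/eqP: E; rewrite addn_eq0 !subn_eq0 -eqn_leq => /eqP.
Qed.

Lemma computable_eq_of (S T : countType) (f g : S -> T) :
  computable f -> computable g -> computable (fun x => f x == g x).
Proof. by move=> cf cg; apply: computable_app2 cf cg; exact: computable_eq. Qed.

Section Booleans.
Context (S : countType) (b c : S -> bool).
Hypotheses (cb : computable b) (cc : computable c).

Lemma computable_and : computable (fun x => b x && c x).
Proof. by apply: computable_if cb cc _; exact: computable_const. Qed.

Lemma computable_not : computable (fun x => ~~ b x).
Proof. by apply: computable_comp cb; exact: computable_fin. Qed.

Lemma computable_implb : computable (fun x => b x ==> c x).
Proof. by apply: computable_if cb cc _; exact: computable_const. Qed.

End Booleans.

(** ** Numbers *)

Lemma computable_nat1 (f : nat -> nat) : recursive1 f -> computable f.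
Proof. by move=> rf; apply/computableE; exists f. Qed.

Lemma computable_nat2 (f : nat -> nat -> nat) : recursive2 f -> computable2 f.
Proof.
move=> rf; apply/computableE.
exists (fun n => f (code_head n) (code_head (code_tail n))).
  apply: (recursive1_app2 rf); first exact: recursive1_code_head.
  exact: recursive1_comp recursive1_code_head recursive1_code_tail.
by move=> x; rewrite pickle_pair code_tailK !code_headK.
Qed.

Section Numbers.
Context (S : countType) (f g : S -> nat).
Hypotheses (cf : computable f) (cg : computable g).

Lemma computable_succ : computable (fun x => (f x).+1).
Proof. exact: (computable_comp (computable_nat1 recursive1_succ)). Qed.

Lemma computable_add : computable (fun x => f x + g x).
Proof. exact: (computable_app2 (computable_nat2 recursive2_add)). Qed.

Lemma computable_sub : computable (fun x => f x - g x).
Proof. exact: (computable_app2 (computable_nat2 recursive2_sub)). Qed.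

Lemma computable_leq : computable (fun x => f x <= g x).
Proof.
by apply: computable_eq_of; [exact: computable_sub | exact: computable_const].
Qed.

End Numbers.

(** ** Lists *)

Lemma computable_cons (S T : countType) (f : S -> T) (g : S -> seq T) :
  computable f -> computable g -> computable (fun x => f x :: g x).
Proof.
move=> /computableE[F rF EF] /computableE[G rG EG]; apply/computableE.
exists (fun n => code_cons (F n) (G n)) => [|x].
  exact: (recursive1_app2 recursive2_code_cons).
by rewrite EF EG.
Qed.

Lemma computable_seq_case (S T U : countType) (l : S -> seq T) (b : S -> U)
    (h : S -> T -> seq T -> U) :
  computable l -> computable b ->
  computable3 h ->
  computable (fun x => if l x is a :: s then h x a s else b x).
Proof.
move=> /computableE[L rL EL] /computableE[B rB EB] /computableE[H rH EH].
apply/computableE.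
exists (fun n => if L n is 0 then B n else
  H (code_cons n (code_cons (code_cons (code_head (L n))
      (code_cons (code_tail (L n)) 0)) 0))).
  have r0 := recursive1_code_head; have r1 := recursive1_code_tail.
  have rc := recursive2_code_cons; have rz := recursive1_const 0.
  apply: recursive1_if => //; apply: (recursive1_comp rH).
  apply: (recursive1_app2 rc recursive1_id); apply: (recursive1_app2 rc) => //.
  apply: (recursive1_app2 rc); first exact: recursive1_comp r0 rL.
  by apply: (recursive1_app2 rc) => //; exact: recursive1_comp r1 rL.
move=> x; rewrite EL EB; case: (l x) => [|a s] //; rewrite pickle_cons.
case E: (code_cons _ _) (code_cons_gt0 (pickle a) (pickle s)) => [//|k] _.
by rewrite -E code_headK code_tailK -(EH (x, (a, s))) !pickle_pair.
Qed.

Lemma size_pickle (T : countType) (s : seq T) : size s <= pickle s.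
Proof.
elim: s => //= a s; rewrite pickle_cons /code_cons => /leq_ltn_trans; apply.
apply: (@leq_trans (pickle s).*2.+1); first by rewrite ltnS -addnn leq_addr.
by rewrite leq_pmull ?expn_gt0.
Qed.

Lemma computable_foldl (S T U : countType) (l : S -> seq T) (b : S -> U)
    (h : S -> U -> T -> U) :
  computable l -> computable b ->
  computable3 h ->
  computable (fun x => foldl (h x) (b x) (l x)).
Proof.
move=> cl cb ch.
(* Consume one element per iteration; the code of a list bounds its length. *)
pose step x (p : seq T * U) :=
  if p.1 is a :: s then (s, h x p.2 a) else p.
have E x n s r : size s <= n -> (iter n (step x) (s, r)).2 = foldl (h x) r s.
  elim: n s r => [|n IH] [|a s] r //=; rewrite -/(iter n.+1 _ _) iterSr.
    by rewrite IH.
  exact: IH.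
apply: (@computable_ext _ _ (fun x => (iter (pickle (l x)) (step x) (l x, b x)).2)).
  by move=> x; apply: E; exact: size_pickle.
apply: computable_snd_of; apply: computable_iter.
- by apply: computable_comp cl; apply: computable_same_code.
- exact: computable_pair.
apply: computable_seq_case.
- by apply: computable_fst_of; exact: computable_snd.
- exact: computable_snd.
apply: computable_pair; first by do 2!apply: computable_snd_of; exact: computable_id.
apply: (computable_app3 ch).
- by do 2!apply: computable_fst_of; exact: computable_id.
- by apply: computable_snd_of; apply: computable_snd_of; exact: computable_fst.
by apply: computable_fst_of; exact: computable_snd.
Qed.

Lemma computable_rev (T : countType) : computable (@rev T).
Proof.
have E (s : seq T) : foldl (fun u a => a :: u) [::] s = rev s.
  by rewrite /rev; elim: s [::] => //=.
apply: computable_ext E _.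
apply: (computable_foldl (h := fun _ u a => a :: u) (computable_id _)
  (computable_const _ _)).
apply: computable_cons; first by do 2!apply: computable_snd_of; exact: computable_id.
by apply: computable_fst_of; exact: computable_snd.
Qed.

Lemma computable_foldr (S T U : countType) (l : S -> seq T) (b : S -> U)
    (h : S -> T -> U -> U) :
  computable l -> computable b ->
  computable3 h ->
  computable (fun x => foldr (h x) (b x) (l x)).
Proof.
move=> cl cb ch.
apply: (@computable_ext _ _ (fun x => foldl (fun u a => h x a u) (b x) (rev (l x)))).
  by move=> x; rewrite foldl_rev.
apply: (computable_foldl (h := fun x u a => h x a u)) => //.
  by apply: computable_comp cl; exact: computable_rev.
apply: (computable_app3 ch); first exact: computable_fst.
  by apply: computable_snd_of; exact: computable_snd.
by apply: computable_fst_of; exact: computable_snd.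
Qed.

Lemma computable_12 (S T U : countType) :
  computable (fun p : S * (T * U) => p.2.1).
Proof. by apply: computable_fst_of; exact: computable_snd. Qed.

Lemma computable_22 (S T U : countType) :
  computable (fun p : S * (T * U) => p.2.2).
Proof. by apply: computable_snd_of; exact: computable_snd. Qed.

Lemma computable_drop_last (S T U V : countType) (h : S -> T -> V) :
  computable2 h -> computable (fun p : S * (T * U) => h p.1 p.2.1).
Proof.
by move=> ch; apply: (computable_app2 ch); [exact: computable_fst | exact: computable_12].
Qed.

Lemma computable_map (S T U : countType) (l : S -> seq T) (h : S -> T -> U) :
  computable l -> computable2 h -> computable (fun x => map (h x) (l x)).
Proof.
move=> cl ch.
apply: (@computable_ext _ _ (fun x => foldr (fun a r => h x a :: r) [::] (l x))).
  by move=> x; elim: (l x) => //= a s ->.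
apply: computable_foldr => //; first exact: computable_const.
by apply: computable_cons; [exact: computable_drop_last | exact: computable_22].
Qed.

Lemma computable_cat (S T : countType) (l l' : S -> seq T) :
  computable l -> computable l' -> computable (fun x => l x ++ l' x).
Proof.
move=> cl cl'.
apply: (@computable_ext _ _ (fun x => foldr (fun a r => a :: r) (l' x) (l x))).
  by move=> x; elim: (l x) => //= a s ->.
apply: computable_foldr => //.
by apply: computable_cons; [exact: computable_12 | exact: computable_22].
Qed.

Lemma computable_flatten (S T : countType) (l : S -> seq (seq T)) :
  computable l -> computable (fun x => flatten (l x)).
Proof.
move=> cl; apply: computable_foldr => //; first exact: computable_const.
by apply: computable_cat; [exact: computable_12 | exact: computable_22].
Qed.

Lemma computable_filter (S T : countType) (l : S -> seq T) (h : S -> T -> bool) :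
  computable l -> computable2 h -> computable (fun x => [seq a <- l x | h x a]).
Proof.
move=> cl ch.
apply: (@computable_ext _ _ (fun x =>
   foldr (fun a r => if h x a then a :: r else r) [::] (l x))).
  by move=> x; elim: (l x) => //= a s ->.
apply: computable_foldr => //; first exact: computable_const.
apply: computable_if; first exact: computable_drop_last.
  by apply: computable_cons; [exact: computable_12 | exact: computable_22].
exact: computable_22.
Qed.

Lemma computable_all (S T : countType) (l : S -> seq T) (h : S -> T -> bool) :
  computable l -> computable2 h -> computable (fun x => all (h x) (l x)).
Proof.
move=> cl ch.
apply: (@computable_ext _ _ (fun x => foldr (fun a r => h x a && r) true (l x))).
  by move=> x; elim: (l x) => //= a s ->.
apply: computable_foldr => //; first exact: computable_const.
by apply: computable_and; [exact: computable_drop_last | exact: computable_22].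
Qed.

Lemma computable_has (S T : countType) (l : S -> seq T) (h : S -> T -> bool) :
  computable l -> computable2 h -> computable (fun x => has (h x) (l x)).
Proof.
move=> cl ch.
apply: (@computable_ext _ _ (fun x => ~~ all (fun a => ~~ h x a) (l x))).
  by move=> x; rewrite -has_predC; apply: eq_has => a /=; rewrite negbK.
apply: computable_not; apply: computable_all => //; exact: computable_not.
Qed.

Lemma computable_mem (S T : countType) (f : S -> T) (l : S -> seq T) :
  computable f -> computable l -> computable (fun x => f x \in l x).
Proof.
move=> cf cl; apply: (@computable_ext _ _ (fun x => has (fun a => a == f x) (l x))).
  by move=> x; rewrite has_pred1.
apply: computable_has => //; apply: computable_eq_of; first exact: computable_snd.
by apply: computable_comp cf _; exact: computable_fst.
Qed.

Lemma computable_size (S T : countType) (l : S -> seq T) :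
  computable l -> computable (fun x => size (l x)).
Proof.
move=> cl; apply: (@computable_foldr _ _ _ _ _ (fun _ _ n => n.+1)) => //.
  exact: computable_const.
by apply: computable_succ; exact: computable_22.
Qed.

Lemma computable_uniq (S T : countType) (l : S -> seq T) :
  computable l -> computable (fun x => uniq (l x)).
Proof.
move=> cl.
apply: (@computable_ext _ _ (fun x => (foldr (fun a (r : seq T * bool) =>
    (a :: r.1, (a \notin r.1) && r.2)) ([::], true) (l x)).2)).
  move=> x; set F := (X in foldr X).
  suff -> : foldr F ([::], true) (l x) = (l x, uniq (l x)) by [].
  by elim: (l x) => //= a s ->.
apply: computable_snd_of; apply: computable_foldr => //; first exact: computable_const.
apply: computable_pair.
  by apply: computable_cons; [exact: computable_12 |
    apply: computable_fst_of; exact: computable_22].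
apply: computable_and; last by apply: computable_snd_of; exact: computable_22.
apply: computable_not; apply: computable_mem; first exact: computable_12.
by apply: computable_fst_of; exact: computable_22.
Qed.

Lemma computable_iota (S : countType) (m n : S -> nat) :
  computable m -> computable n -> computable (fun x => iota (m x) (n x)).
Proof.
move=> cm cn.
apply: (@computable_ext _ _ (fun x =>
    rev (iteri (n x) (fun i r => (m x + i) :: r) [::]))).
  move=> x; elim: (n x) => //= k IH.
  by rewrite rev_cons IH -cats1 -[[:: m x + k]]/(iota (m x + k) 1) -iotaD addn1.
apply: (computable_comp (@computable_rev _)); apply: computable_iteri => //.
  exact: computable_const.
apply: computable_cons; last exact: computable_22.
apply: computable_add; last exact: computable_12.
by apply: computable_comp cm _; exact: computable_fst.
Qed.

Lemma computable_nth (S T : countType) (x0 : T) (l : S -> seq T) (n : S -> nat) :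
  computable l -> computable n -> computable (fun x => nth x0 (l x) (n x)).
Proof.
move=> cl cn.
apply: (@computable_ext _ _ (fun x => if drop (n x) (l x) is a :: _ then a else x0)).
  by move=> x; rewrite -[n x in RHS]addn0 -nth_drop; case: drop.
apply: computable_seq_case.
- apply: (@computable_ext _ _ (fun x => iter (n x) behead (l x))).
    by move=> x; elim: (n x) => [|k IH]; rewrite ?drop0 //= IH -drop1 drop_drop.
  apply: computable_iter => //; apply: computable_seq_case.
  + exact: computable_snd.
  + exact: computable_const.
  + exact: computable_22.
- exact: computable_const.
exact: computable_12.
Qed.

(** ** Sums, integers, options and tuples *)

Lemma computable_sum_case (S T T' U : countType) (s : S -> (T + T')%type)
    (f : S -> T -> U) (g : S -> T' -> U) :
  computable s -> computable2 f -> computable2 g ->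
  computable (fun x => match s x with inl a => f x a | inr b => g x b end).
Proof.
move=> /computableE[F rF EF] /computableE[G rG EG] /computableE[H rH EH].
(* The code of [inl a] is that of the pair of options (Some a, None). *)
pose L n := code_head (F n).
pose R n := code_head (code_tail (F n)).
pose arg n a := code_cons n (code_cons (code_head a) 0).
apply/computableE; exists (fun n => if L n is 0 then H (arg n (R n)) else G (arg n (L n))).
  have r0 := recursive1_code_head; have r1 := recursive1_code_tail.
  have rc := recursive2_code_cons; have rz := recursive1_const 0.
  have rL : recursive1 L by apply: recursive1_comp.
  have rR : recursive1 R by apply: recursive1_comp r0 _; apply: recursive1_comp.
  have rarg a : recursive1 a -> recursive1 (fun n => arg n (a n)).
    move=> ra; apply: (recursive1_app2 rc recursive1_id).
    by apply: (recursive1_app2 rc) => //; apply: recursive1_comp.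
  apply: recursive1_if => //; first exact: recursive1_comp rH (rarg _ rR).
  exact: recursive1_comp rG (rarg _ rL).
move=> x; rewrite /L /R /arg EF.
have Es : pickle (s x) = pickle
    (match s x with inl a => (Some a, None) | inr b => (None, Some b) end).
  by case: (s x).
rewrite Es pickle_pair code_tailK !code_headK {Es}; case: (s x) => [a|b] /=.
  have -> : pickle (Some a) = code_cons (pickle a) 0 by [].
  case E: (code_cons (pickle a) 0) (code_cons_gt0 (pickle a) 0) => [//|k] _.
  by rewrite -E code_headK -(EG (x, a)) pickle_pair.
have -> : pickle (Some b) = code_cons (pickle b) 0 by [].
by rewrite code_headK -(EH (x, b)) pickle_pair.
Qed.

Lemma computable_Some (T : countType) : computable (@Some T).
Proof.
have [F [rF EF]] : computable (fun a : T => [:: a]).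
  by apply: computable_cons; [exact: computable_id | exact: computable_const].
by exists F; split => // x; rewrite EF.
Qed.

Lemma computable_option_case (S T U : countType) (o : S -> option T) (b : S -> U)
    (h : S -> T -> U) :
  computable o -> computable b -> computable2 h ->
  computable (fun x => if o x is Some a then h x a else b x).
Proof.
move=> co cb ch.
apply: (@computable_ext _ _ (fun x =>
   if seq_of_opt (o x) is a :: _ then h x a else b x)).
  by move=> x; case: (o x).
by apply: computable_seq_case => //; exact: computable_drop_last.
Qed.

Lemma computable_inl (T U : countType) : computable (@inl T U).
Proof.
have [F [rF EF]] : computable (fun a : T => (Some a, @None U)).
  by apply: computable_pair; [exact: computable_Some | exact: computable_const].
by exists F; split => // x; rewrite EF.
Qed.

Lemma computable_inr (T U : countType) : computable (@inr T U).
Proof.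
have [F [rF EF]] : computable (fun b : U => (@None T, Some b)).
  by apply: computable_pair; [exact: computable_const | exact: computable_Some].
by exists F; split => // x; rewrite EF.
Qed.

Lemma computable_Posz : computable Posz.
Proof.
by have [F [rF EF]] := computable_inl nat nat; exists F; split => // x; rewrite EF.
Qed.

Lemma computable_Negz : computable Negz.
Proof.
by have [F [rF EF]] := computable_inr nat nat; exists F; split => // x; rewrite EF.
Qed.

Lemma computable_int_case (S U : countType) (z : S -> int) (f g : S -> nat -> U) :
  computable z -> computable2 f -> computable2 g ->
  computable (fun x => match z x with Posz n => f x n | Negz n => g x n end).
Proof.
move=> cz cf cg.
apply: (@computable_ext _ _ (fun x =>
   match natsum_of_int (z x) with inl a => f x a | inr b => g x b end)).
  by move=> x; case: (z x).
exact: computable_sum_case.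
Qed.

Lemma computable_tuple (S T : countType) n (f : S -> n.-tuple T) :
  computable (fun x => tval (f x)) -> computable f.
Proof. by move=> [F [rF EF]]; exists F; split => // x; rewrite EF. Qed.

Lemma computable_tval (T : countType) n : computable (@tval n T).
Proof. exact: computable_same_code. Qed.

(** ** Unbounded search *)

(** Minimization requires a search that ends on every number, whether or not it
    is the code of a value; types whose codes can be recognized and decoded
    allow one to stop at once on the other numbers. *)
Definition decodable (T : countType) : Prop :=
  exists2 d : nat -> option T, computable d & forall x, d (pickle x) = Some x.

Lemma decodable_nat : decodable nat.
Proof. by exists Some => [|n //]; exact: computable_Some. Qed.

Lemma decodable_image (T U : countType) (f : T -> option U) (g : U -> T) :
  computable f -> (forall y, pickle (g y) = pickle y) ->
  (forall y, f (g y) = Some y) -> decodable T -> decodable U.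
Proof.
move=> cf gE fg [d cd dP].
exists (fun n => if d n is Some x then f x else None).
  apply: computable_option_case => //; first exact: computable_const.
  by apply: (computable_comp cf); exact: computable_snd.
by move=> y; rewrite -gE dP fg.
Qed.

Lemma decodable_pair (T U : countType) :
  decodable T -> decodable U -> decodable (T * U)%type.
Proof.
move=> [d cd dP] [e ce eP].
exists (fun n => if d (code_head n) is Some x then
    if e (code_head (code_tail n)) is Some y then Some (x, y) else None else None).
  have c0 := computable_nat1 recursive1_code_head.
  have c1 := computable_nat1 recursive1_code_tail.
  apply: computable_option_case; [exact: computable_comp cd c0 |
    exact: computable_const |].
  apply: computable_option_case; last 2 first.
  - exact: computable_const.
  - apply: (computable_comp (@computable_Some _)); apply: computable_pair.
      by apply: computable_snd_of; exact: computable_fst.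
    exact: computable_snd.
  apply: (computable_comp ce); apply: (computable_comp c0).
  by apply: (computable_comp c1); exact: computable_fst.
by move=> [x y]; rewrite pickle_pair code_tailK !code_headK dP eP.
Qed.

Lemma decodable_seq (T : countType) : decodable T -> decodable (seq T).
Proof.
move=> [d cd dP].
exists (fun n => Some (pmap d (CodeSeq.decode n))).
  apply: (computable_comp (@computable_Some _)).
  apply: (@computable_ext _ _ (fun n => foldr (fun a r =>
     if d a is Some x then x :: r else r) [::] (CodeSeq.decode n))).
    by move=> n; elim: (CodeSeq.decode n) => //= a s ->; case: (d a).
  apply: computable_foldr; last 2 first.
  - exact: computable_const.
  - apply: computable_option_case.
    + by apply: (computable_comp cd); exact: computable_12.
    + exact: computable_22.
    + apply: computable_cons; first exact: computable_snd.
      by apply: computable_snd_of; apply: computable_snd_of; exact: computable_fst.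
  apply: computable_same_code => n.
  by rewrite -[RHS]CodeSeq.decodeK /pickle /= /pickle_seq map_id.
move=> s; rewrite [pickle _]/(CodeSeq.code _) CodeSeq.codeK.
by congr Some; elim: s => //= x s ->; rewrite dP.
Qed.

Lemma decodable_fin (T : finType) : decodable T.
Proof.
exists (fun n => ohead [seq x <- enum T | pickle x == n]).
  apply: (@computable_ext _ _ (fun n =>
    if [seq x <- enum T | pickle x == n] is x :: _ then Some x else None)) => //.
  apply: computable_seq_case; last 2 first.
  - exact: computable_const.
  - by apply: (computable_comp (@computable_Some _)); exact: computable_12.
  apply: computable_filter; first exact: computable_const.
  apply: computable_eq_of; last exact: computable_fst.
  apply: (@computable_comp _ _ _ (@pickle T)); last exact: computable_snd.
  exact: computable_same_code.
move=> x; have -> : [seq y <- enum T | pickle y == pickle x] = [seq y <- enum T | y == x].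
  by apply: eq_filter => y; rewrite (inj_eq (pcan_inj pickleK)).
by rewrite filter_pred1_uniq ?enum_uniq ?mem_enum.
Qed.

Lemma decodable_option (T : countType) : decodable T -> decodable (option T).
Proof.
move=> dT; apply: (@decodable_image _ _ (fun s => Some (ohead s)) (@seq_of_opt T)) => //.
- apply: (computable_comp (@computable_Some _)).
  apply: (@computable_ext _ _ (fun s : seq T => if s is x :: _ then Some x else None)) => //.
  apply: computable_seq_case; [exact: computable_id | exact: computable_const |].
  by apply: (computable_comp (@computable_Some _)); exact: computable_12.
- by case.
- exact: decodable_seq.
Qed.

Lemma decodable_sum (T U : countType) :
  decodable T -> decodable U -> decodable (T + U)%type.
Proof.
move=> dT dU; apply: (@decodable_image _ _ (fun p : option T * option U =>
    if p.1 is Some x then Some (inl x) else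
    if p.2 is Some y then Some (inr y) else None)
  (fun z => match z with inl x => (Some x, None) | inr y => (None, Some y) end)).
- apply: computable_option_case; first exact: computable_fst.
    apply: computable_option_case; first exact: computable_snd.
      exact: computable_const.
    apply: (computable_comp (@computable_Some _)).
    by apply: (computable_comp (@computable_inr _ _)); exact: computable_snd.
  apply: (computable_comp (@computable_Some _)).
  by apply: (computable_comp (@computable_inl _ _)); exact: computable_snd.
- by case.
- by case.
- by apply: decodable_pair; exact: decodable_option.
Qed.

Lemma decodable_int : decodable int.
Proof.
apply: (@decodable_image _ _ (fun s : (nat + nat)%type => Some (int_of_natsum s))
   natsum_of_int).
- apply: (computable_comp (@computable_Some _)).
  apply: computable_sum_case; first exact: computable_id.
    by apply: (computable_comp computable_Posz); exact: computable_snd.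
  by apply: (computable_comp computable_Negz); exact: computable_snd.
- by [].
- by move=> z; rewrite natsum_of_intK.
- by apply: decodable_sum; exact: decodable_nat.
Qed.

Lemma decodable_tuple (T : countType) n : decodable T -> decodable (n.-tuple T).
Proof.
move=> dT; apply: (@decodable_image _ _ insub val _ _ _ (decodable_seq dT)) => //.
- have [F [rF EF]] : computable
      (fun s : seq T => if size s == n then Some s else None).
    apply: computable_if; last exact: computable_const.
      apply: computable_eq_of; last exact: computable_const.
      by apply: computable_size; exact: computable_id.
    exact: computable_Some.
  exists F; split => // s; rewrite EF; case: insubP => [t -> Et|/negPf-> //].
  by rewrite -Et.
- exact: valK.
Qed.

Lemma computable_least (P : nat -> nat -> bool) (g : nat -> nat) :
  computable2 P -> (forall n, P n (g n)) -> (forall n m, P n m -> g n <= m) ->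
  computable g.
Proof.
move=> /computableE[F rF EF] Pg gmin; apply: computable_nat1.
pose f n := 1 - F (code_cons (code_head n) (code_cons (code_tail n) 0)).
have fE n m : f (code_cons n m) = 1 - P n m.
  by rewrite /f code_headK code_tailK; have := EF (n, m); rewrite pickle_pair /= => ->.
apply: (@recursive1_min f).
  have r0 := recursive1_code_head; have r1 := recursive1_code_tail.
  have rc := recursive2_code_cons.
  apply: (recursive1_app2 recursive2_sub (recursive1_const 1)).
  apply: (recursive1_comp rF); apply: (recursive1_app2 rc r0).
  by apply: (recursive1_app2 rc r1); exact: recursive1_const.
move=> n; split; first by rewrite fE Pg.
move=> m; rewrite fE ltnNge; case E: (P n m) => //.
by rewrite (gmin _ _ E).
Qed.

(** Decoding the arguments turns the relation into one between numbers, which is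
    made true wherever the first number codes nothing; minimization then applies. *)
Lemma computable_search (T U : countType) (P : T -> U -> bool) :
  decodable T -> decodable U -> computable2 P -> (forall x, exists y, P x y) ->
  exists2 f : T -> U, computable f & forall x, P x (f x).
Proof.
move=> [d cd dP] [e ce eP] cP exP.
pose Q m n := if d m is Some x then if e n is Some y then P x y else false else true.
have exQ m : exists n, Q m n.
  rewrite /Q; case: (d m) => [x|]; last by exists 0.
  by have [y Py] := exP x; exists (pickle y); rewrite eP.
pose g m := ex_minn (exQ m).
have gP m : Q m (g m) by rewrite /g; case: ex_minnP.
have gmin m n : Q m n -> g m <= n.
  by rewrite /g; case: ex_minnP => k _ /[apply].
have cQ : computable2 Q.
  apply: computable_option_case.
  - by apply: (computable_comp cd); exact: computable_fst.
  - exact: computable_const.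
  apply: computable_option_case.
  - apply: (computable_comp ce); apply: computable_snd_of; exact: computable_fst.
  - exact: computable_const.
  apply: (computable_app2 cP); last exact: computable_snd.
  by apply: computable_snd_of; exact: computable_fst.
have cg := computable_least cQ gP gmin.
have fP x : exists y, e (g (pickle x)) = Some y /\ P x y.
  have := gP (pickle x); rewrite /Q dP; case: (e _) => // y Py; by exists y.
have [f fE] := choice fP.
exists f; last by move=> x; have [] := fE x.
have /computableE[F rF EF] : computable (fun x => Some (f x)).
  apply: (@computable_ext _ _ (fun x => e (g (pickle x)))).
    by move=> x; have [->] := fE x.
  apply: (computable_comp ce); apply: (computable_comp cg).
  exact: computable_same_code.
apply/computableE; exists (code_head \o F).
  exact: recursive1_comp recursive1_code_head rF.
by move=> x /=; rewrite EF [pickle (Some _)]/(code_cons _ 0) code_headK.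
Qed.

(** * Words and walks *)

Import GRing.Theory.

Section Words.
Context (X : choiceType).
Implicit Types u v w : seq (X + X).

Lemma fg_of_word_eqP u v :
  fg_of_word u = fg_of_word v <-> free_reduction u = free_reduction v.
Proof. by split=> [/(congr1 val)|E] //; exact: val_inj. Qed.

Lemma fg_of_word_cat u v : fg_of_word (u ++ v) = (fg_of_word u * fg_of_word v)%g.
Proof.
by apply: val_inj; rewrite /= free_reduction_catl free_reduction_catr.
Qed.

Lemma fg_of_word_cons a u : fg_of_word (a :: u) = (fg_of_word [:: a] * fg_of_word u)%g.
Proof. exact: (fg_of_word_cat [:: a]). Qed.

Lemma fg_of_word_inv u : fg_of_word (word_inv u) = ((fg_of_word u)^-1)%g.
Proof.
apply: (mulgI (fg_of_word u)); rewrite mulgV -fg_of_word_cat.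
by apply: val_inj; exact: free_reduction_catV.
Qed.

Lemma fg_wordK (g : free_group X) : fg_of_word (fg_word g) = g.
Proof. by apply: val_inj; rewrite /= free_reduction_id ?fg_wordP. Qed.

Lemma freely_reduced_cat_cons u a v : freely_reduced (u ++ a :: v) =
  freely_reduced (rcons u a) && freely_reduced (a :: v).
Proof.
case: u => [|b u] //=.
by rewrite /freely_reduced /= -cat_rcons cat_path last_rcons.
Qed.

Lemma freely_reduced_catl u v : freely_reduced (u ++ v) -> freely_reduced u.
Proof. by case: u => //= b u; rewrite /freely_reduced /= cat_path => /andP[]. Qed.

Lemma freely_reduced_rev u : freely_reduced (word_inv u) = freely_reduced u.
Proof.
rewrite /freely_reduced /word_inv rev_sorted.
case: u => //= a u; elim: u a => //= b u IH a; rewrite IH linvK; congr (_ && _).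
by rewrite eq_sym -(inj_eq (can_inj (@linvK X))) linvK eq_sym.
Qed.

End Words.

Section Walks.
Context (X : Type) (G : automaton X).
Implicit Types (es : seq (arcT G)) (p q : vertex G).

Lemma walk_cat p es1 es2 q :
  walk p (es1 ++ es2) q <-> exists m, walk p es1 m /\ walk m es2 q.
Proof.
elim: es1 p => [|e es IH] p /=; first by split=> [?|[m [->]]] //; exists p.
split=> [[-> /IH[m []]]|[m [[-> h1] h2]]]; first by exists m.
by split=> //; apply/IH; exists m.
Qed.

Lemma walk_catI p m q es1 es2 : walk p es1 m -> walk m es2 q -> walk p (es1 ++ es2) q.
Proof. by move=> h1 h2; apply/walk_cat; exists m. Qed.

Lemma walk_end p es q q' : walk p es q -> walk p es q' -> q = q'.
Proof. by elim: es p => /= [p -> //|e es IH p [_ /IH h] [_]]; exact: h. Qed.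

Definition walk_inv es : seq (arcT G) := rev (map (@ainv X G) es).

Lemma walk_invP p es q : walk p es q -> walk q (walk_inv es) p.
Proof.
elim: es p => [|e es IH] p /=; first by move->.
move=> [<- /IH h]; rewrite /walk_inv /= rev_cons -cats1.
by apply: (walk_catI h); rewrite /= src_ainv tgt_ainv.
Qed.

Lemma lab_walk_inv es : map (@lab X G) (walk_inv es) = word_inv (map (@lab X G) es).
Proof.
rewrite /walk_inv /word_inv map_rev -!map_comp; congr rev.
by apply: eq_map => e /=; rewrite lab_ainv.
Qed.

Lemma deterministic_walk p es es' q q' : deterministic G ->
  walk p es q -> walk p es' q' -> map (@lab X G) es = map (@lab X G) es' -> es = es'.
Proof.
move=> dG; elim: es es' p => [|e es IH] [|e' es'] p //= [ep wes] [e'p wes'] [El Els].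
have Ee : e = e' by apply: dG => //; left; rewrite ep.
by subst e'; congr cons; apply: IH wes wes' Els.
Qed.

End Walks.

Lemma In_mem (T : eqType) (x : T) s : List.In x s <-> x \in s.
Proof.
elim: s => //= a s IH; rewrite inE; split.
  by case=> [->|/IH ->]; rewrite ?eqxx ?orbT.
by case/orP=> [/eqP ->|/IH]; [left | right].
Qed.

Lemma In_map (T U : Type) (f : T -> U) y s :
  List.In y (map f s) <-> exists2 x, List.In x s & f x = y.
Proof.
elim: s => [|a s IH] /=; first by split=> // -[].
split=> [[<-|/IH[x sx Ex]]|[x [->|sx] Ex]].
- by exists a; [left|].
- by exists x; [right|].
- by left.
by right; apply/IH; exists x.
Qed.

Lemma In_cat (T : Type) (x : T) s t :
  List.In x (s ++ t) <-> List.In x s \/ List.In x t.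
Proof. exact: List.in_app_iff. Qed.

Lemma In_rcons (T : Type) (x : T) s y :
  List.In x (rcons s y) <-> List.In x s \/ x = y.
Proof. by rewrite -cats1 In_cat /=; split=> -[]; auto; case; auto. Qed.

Lemma In_rev (T : Type) (x : T) s : List.In x (rev s) <-> List.In x s.
Proof.
elim: s => //= a s IH; rewrite rev_cons In_rcons IH.
by split=> -[]; auto.
Qed.

Section DeterministicWalks.
Context (X : choiceType) (G : automaton X).
Hypothesis dG : deterministic G.
Implicit Types (es : seq (arcT G)) (p q : vertex G).
Local Notation word := (map (@lab X G)).

(** In a deterministic automaton consecutive arcs with inverse labels are mutually
    inverse. So the free reduction of the label can be carried out on the walk, and
    each deletion leaves unchanged the sum of a quantity that is opposite on inverse
    arcs. *)
Lemma reduce_walk (A : zmodType) (f : arcT G -> A) p es q :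
  (forall e, f (ainv e) = (- f e)%R) -> walk p es q ->
  exists es', [/\ walk p es' q, word es' = free_reduction (word es),
    (forall e, List.In e es' -> List.In e es)
    & (\sum_(e <- es') f e = \sum_(e <- es) f e)%R].
Proof.
move=> fV; elim: es p => [|e es IH] p /=; first by move=> ->; exists [::]; split.
move=> [ep /IH[[|e' es'] [w' E' sub' S']]].
  exists [:: e]; split => //=; first by rewrite -E'.
  - by move=> x [->|//]; left.
  - by rewrite !big_cons -S' big_nil.
move: E'; case: w' => e'e w' E'.
case: (boolP (lab e' == linv (lab e))) => [/eqP El|nEl].
  have Ee : e' = ainv e.
    by apply: dG; [rewrite El lab_ainv | left; rewrite e'e src_ainv].
  exists es'; split.
  - by move: w'; rewrite Ee tgt_ainv ep.
  - by rewrite -E' /= El eqxx.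
  - by move=> x xes'; right; apply: sub'; right.
  - by rewrite [RHS]big_cons -S' big_cons Ee fV addrA addrN add0r.
exists [:: e, e' & es']; split => //.
- by rewrite -E' /= (negPf nEl).
- by move=> x [->|/sub']; [left | right].
- by rewrite big_cons S' big_cons.
Qed.

(** The two walks reduce to walks with the same reduced label, which are equal. *)
Lemma walk_determined (A : zmodType) (f : arcT G -> A) p es es' q q' :
  (forall e, f (ainv e) = (- f e)%R) -> walk p es q -> walk p es' q' ->
  fg_of_word (word es) = fg_of_word (word es') ->
  q = q' /\ (\sum_(e <- es) f e = \sum_(e <- es') f e)%R.
Proof.
move=> fV w w' /fg_of_word_eqP E.
have [es1 [w1 E1 _ <-]] := reduce_walk fV w.
have [es2 [w2 E2 _ <-]] := reduce_walk fV w'.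
have E12 : es1 = es2 by apply: (deterministic_walk dG w1 w2); rewrite E1 E2.
by subst es2; split=> //; exact: walk_end w1 w2.
Qed.

Lemma walk_end_determined p es es' q q' : walk p es q -> walk p es' q' ->
  fg_of_word (word es) = fg_of_word (word es') -> q = q'.
Proof.
move=> w w' E.
by have [] := @walk_determined int (fun=> 0%R) _ _ _ _ _ (fun=> esym (oppr0 _)) w w' E.
Qed.

Lemma freely_reduced_walk p es q :
  walk p es q -> reduced_walk es -> freely_reduced (word es).
Proof.
elim: es p => // e [|e' es] IH p //= [ep [e'e w]] red.
rewrite /freely_reduced /=; apply/andP; split.
  apply/negP => /eqP El; apply: red; exists [::], e, es; congr [:: _, _ & _].
  by apply: dG; [rewrite El lab_ainv | left; rewrite e'e src_ainv].
apply: (IH (tgt e)) => //; move=> [es1 [x [es2 Ex]]]; apply: red.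
by exists (e :: es1), x, es2; rewrite Ex.
Qed.

End DeterministicWalks.

Lemma reduced_walk_word (X : choiceType) (G : automaton X) (es : seq (arcT G)) :
  freely_reduced (map (@lab X G) es) -> reduced_walk es.
Proof.
move=> h [es1 [e [es2 E]]]; move: h; rewrite E map_cat /= freely_reduced_cat_cons.
by move=> /andP[_]; rewrite /freely_reduced /= lab_ainv eqxx.
Qed.

(** Join reduced walks from the basepoint to the source and from the target to the
    basepoint. When this creates a cancellation, the inverse arc lies on one of the
    reduced basepoint-walks at hand, and the inverse of that walk will do. *)
Lemma core_arc (X : choiceType) (G : automaton X) (e : arcT G) : reduced G ->
  exists es1 es2, [/\ walk (basepoint G) es1 (src e), walk (tgt e) es2 (basepoint G)
    & freely_reduced (map (@lab X G) (es1 ++ e :: es2))].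
Proof.
move=> [dG cG]; pose good e := exists es1 es2, [/\ walk (basepoint G) es1 (src e),
  walk (tgt e) es2 (basepoint G) & freely_reduced (map (@lab X G) (es1 ++ e :: es2))].
have goodV : good (ainv e) -> good e.
  move=> [es1 [es2 []]]; rewrite src_ainv tgt_ainv => w1 w2 r.
  exists (walk_inv es2), (walk_inv es1); split; try exact: walk_invP.
  rewrite -freely_reduced_rev -lab_walk_inv /walk_inv map_cat rev_cat /=.
  by rewrite rev_cons cat_rcons -!map_rev !revK -!map_comp !(eq_map (@ainvK _ _)) !map_id.
have [u1 [u2 [wu1 wu2 ru]]] := cG (src e).
have [v1 [v2 [wv1 wv2 rv]]] := cG (tgt e).
have {}ru := freely_reduced_walk dG (walk_catI wu1 wu2) ru.
have {}rv := freely_reduced_walk dG (walk_catI wv1 wv2) rv.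
have [[u [f [Eu Ef]]]|hu] : (exists u f, u1 = rcons u f /\ lab f = linv (lab e)) \/
    freely_reduced (rcons (map (@lab X G) u1) (lab e)).
  case/lastP: u1 wu1 ru => [|u f] wu1 ru; first by right.
  case: (eqVneq (lab f) (linv (lab e))) => El; first by left; exists u, f.
  right; move: ru; rewrite map_cat => /freely_reduced_catl; rewrite map_rcons => ru.
  rewrite -!cats1 -catA /= freely_reduced_cat_cons ru.
  by rewrite /freely_reduced /= andbT; apply: contraNN El => /eqP ->; rewrite linvK.
  have Ee : f = ainv e.
    apply: dG; first by rewrite Ef lab_ainv.
    right; rewrite tgt_ainv; move: wu1; rewrite Eu -cats1.
    by move=> /walk_cat[m [_ /= [_ ->]]].
  apply: goodV; exists u, u2; rewrite src_ainv tgt_ainv; subst u1; subst f.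
  move: wu1; rewrite -cats1 => /walk_cat[m [wu /= [Em _]]].
  rewrite src_ainv in Em; subst m; split=> //.
  by move: ru; rewrite cat_rcons.
have [[f [v [Ev Ef]]]|hv] : (exists f v, v2 = f :: v /\ lab f = linv (lab e)) \/
    freely_reduced (lab e :: map (@lab X G) v2).
  case: v2 wv2 rv => [|f v] wv2 rv; first by right.
  case: (eqVneq (lab f) (linv (lab e))) => El; first by left; exists f, v.
  right; move: rv; rewrite map_cat /= freely_reduced_cat_cons => /andP[_ r].
  by rewrite /freely_reduced /= El.
  have Ee : f = ainv e.
    apply: dG; first by rewrite Ef lab_ainv.
    by left; rewrite src_ainv; move: wv2; rewrite Ev => -[].
  apply: goodV; exists v1, v; rewrite src_ainv tgt_ainv; subst v2; subst f.
  by move: wv2 => /= [_]; rewrite tgt_ainv; split.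
by exists u1, v2; split=> //; rewrite map_cat /= freely_reduced_cat_cons hu.
Qed.

Lemma fta_pairM (X : choiceType) (A : zmodType) (u v : free_group X) (a b : A) :
  (((u, a) : free_times_ab X A) * ((v, b) : free_times_ab X A))%g =
  ((u * v)%g, (a + b)%R).
Proof. by []. Qed.

Section Reading.
Context (X : choiceType) (A : zmodType) (G : enriched X A).
Implicit Types (es : seq (arcT G)) (p q : vertex G).
Local Notation word := (map (@lab X G)).

Definition arc_shift (e : arcT G) : A := (lab2 e - lab1 e)%R.

Definition walk_shift es : A := (\sum_(e <- es) arc_shift e)%R.

Lemma arc_shiftV e : arc_shift (ainv e) = (- arc_shift e)%R.
Proof. by rewrite /arc_shift lab1_ainv lab2_ainv opprB. Qed.

Lemma walk_shift_cat es1 es2 :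
  walk_shift (es1 ++ es2) = (walk_shift es1 + walk_shift es2)%R.
Proof. exact: big_cat. Qed.

Lemma walk_shift_inv es : walk_shift (walk_inv es) = (- walk_shift es)%R.
Proof.
rewrite /walk_shift /walk_inv; elim: es => [|e es IH]; first by rewrite !big_nil oppr0.
by rewrite /= rev_cons -cats1 big_cat /= IH big_seq1 big_cons arc_shiftV
  [RHS]opprD addrC.
Qed.

Lemma walk_readingE es : walk_reading es = (fg_of_word (word es), walk_shift es).
Proof.
rewrite /walk_reading /walk_shift; elim: es => [|e es IH]; first by rewrite !big_nil.
rewrite !big_cons IH /= fg_of_word_cons /arc_reading /arc_shift /tpow /letter_elt.
by rewrite !fta_pairM mul1g mulg1 addr0 [(- _ + _)%R]addrC.
Qed.

Lemma recognizedE h : recognized G h <-> exists es l,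
  [/\ walk (basepoint G) es (basepoint G), base_subgroup G l
    & h = (fg_of_word (word es), walk_shift es + l)%R].
Proof.
split=> -[es [l [w Ll ->]]]; exists es, l; split=> //; rewrite walk_readingE.
  by rewrite /tpow fta_pairM mulg1.
by rewrite /tpow fta_pairM mulg1.
Qed.

Lemma recognized_subgroup : is_subgroup (recognized G).
Proof.
have [L0 LD LN] := base_subgroupP G; split.
- by apply/recognizedE; exists [::], 0%R; rewrite /walk_shift big_nil addr0.
- move=> _ _ /recognizedE[es [l [w Ll ->]]] /recognizedE[es' [l' [w' Ll' ->]]].
  apply/recognizedE; exists (es ++ es'), (l + l')%R; split.
  + exact: walk_catI w w'.
  + exact: LD.
  + by rewrite map_cat fg_of_word_cat walk_shift_cat addrACA.
move=> _ /recognizedE[es [l [w Ll ->]]].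
apply/recognizedE; exists (walk_inv es), (- l)%R; split.
- exact: walk_invP.
- exact: LN.
by rewrite lab_walk_inv fg_of_word_inv walk_shift_inv -opprD.
Qed.

Lemma recognized_base l : deterministic G ->
  recognized G (1%g, l) <-> base_subgroup G l.
Proof.
move=> dG; split=> [/recognizedE[es [l' [w Ll' E]]]|Ll].
  have [E1 /= ->] := (congr1 fst E, congr1 snd E).
  have w0 : walk (basepoint G) [::] (basepoint G) by [].
  have [_ ES] := walk_determined dG (@arc_shiftV) w w0 (esym E1).
  by rewrite /= /walk_shift ES big_nil add0r.
by apply/recognizedE; exists [::], l; split=> //; rewrite /walk_shift big_nil add0r.
Qed.

Lemma recognized_walk es : walk (basepoint G) es (basepoint G) ->
  recognized G (fg_of_word (word es), walk_shift es).
Proof.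
move=> w; apply/recognizedE; exists es, 0%R; rewrite addr0; split=> //.
by have [] := base_subgroupP G.
Qed.

Lemma recognized_detour p q u v es :
  walk (basepoint G) u p -> walk (basepoint G) v q -> walk p es q ->
  recognized G ((fg_of_word (word u) * fg_of_word (word es) * (fg_of_word (word v))^-1)%g,
    (walk_shift u + walk_shift es - walk_shift v)%R).
Proof.
move=> wu wv w.
have := recognized_walk (walk_catI (walk_catI wu w) (walk_invP wv)).
by rewrite !map_cat !fg_of_word_cat !walk_shift_cat lab_walk_inv fg_of_word_inv walk_shift_inv.
Qed.

End Reading.

(** * The ordered spanning tree *)

Section OrderedTree.
Context (X : finType) (le : rel (X + X)) (G : automaton X).
Hypothesis dG : deterministic G.
Hypothesis le_total : total_order le.
Implicit Types (vs : seq (vertex G)) (T : set (arcT G)) (es : seq (arcT G)).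
Local Notation stage := (@tree_stage X le G).
Local Notation word := (map (@lab X G)).

Lemma next_tree_arc_unique vs e e' :
  next_tree_arc le vs e -> next_tree_arc le vs e' -> e = e'.
Proof.
move=> [vs1 [vs2 [Evs ne old min]]] [ws1 [ws2 [Ews ne' old' min']]].
have [_ anti _ _] := le_total.
have split_cases (a b : vertex G) s1 s2 t1 t2 : s1 ++ a :: s2 = t1 ++ b :: t2 ->
    [\/ List.In a t1, List.In b s1 | a = b].
  elim: s1 t1 => [|x s1 IH] [|y t1] /= [].
  - by move=> -> _; apply: Or33.
  - by move=> -> _; apply: Or31; left.
  - by move=> <- _; apply: Or32; left.
  - by move=> -> /IH[h|h|h]; [apply: Or31; right | apply: Or32; right | apply: Or33].
case: (split_cases (src e) (src e') vs1 vs2 ws1 ws2); first by rewrite -Evs.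
- by move/old'.
- by move/old.
move=> Es; apply: dG; last by left.
by apply: anti; rewrite min // min'.
Qed.

Lemma tree_stage_size vs T : stage vs T -> 0 < size vs.
Proof. by case=> // {}vs {}T e _ _; rewrite size_rcons. Qed.

Lemma tree_stage_base vs T : stage vs T -> List.In (basepoint G) vs.
Proof.
elim=> [|{}vs {}T e _ IH _]; first by left.
by apply/In_rcons; left.
Qed.

Lemma tree_stage_unique vs T vs' T' : stage vs T -> stage vs' T' ->
  size vs = size vs' -> vs = vs' /\ T = T'.
Proof.
move=> h; elim: h vs' T' => [|{}vs {}T e h IH ne] vs' T'.
  by case=> // {}vs' {}T' e /tree_stage_size; rewrite size_rcons; case: vs'.
case=> [|{}vs' {}T' e' h' ne']; rewrite !size_rcons.
  by have := tree_stage_size h; case: (vs).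
case=> Es; have [E1 E2] := IH _ _ h' Es; subst vs' T'.
by have E := next_tree_arc_unique ne ne'; subst e'.
Qed.

Lemma tree_stage_prefix vs T n : stage vs T -> 0 < n <= size vs ->
  exists vs' T', [/\ stage vs' T', size vs' = n, (T' `<=` T)%classic
    & exists ws, vs = vs' ++ ws].
Proof.
elim=> [|{}vs {}T e h IH ne].
  case: n => [|[|]] // _; exists [:: basepoint G], set0; split=> //.
    exact: tree_stage0.
  by exists [::]; rewrite cats0.
case: (eqVneq n (size (rcons vs (tgt e)))) => [-> _|nn].
  exists (rcons vs (tgt e)), (T `|` [set e] `|` [set ainv e])%classic; split=> //.
    exact: tree_stageS.
  by exists [::]; rewrite cats0.
move=> /andP[n0]; rewrite leq_eqVlt (negPf nn) size_rcons ltnS /= => len.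
have [|vs' [T' [h' s' sub [ws E]]]] := IH; first by rewrite n0.
exists vs', T'; split=> //; first by move=> x /sub; left; left.
by exists (rcons ws (tgt e)); rewrite E rcons_cat.
Qed.

(** The construction is deterministic, so that its stages form a chain. *)
Lemma tree_stage_chain vs T vs' T' : stage vs T -> stage vs' T' ->
  size vs <= size vs' -> (T `<=` T')%classic /\ exists ws, vs' = vs ++ ws.
Proof.
move=> h h' sz; have [|us [U [hU sU sub E]]] := tree_stage_prefix (n := size vs) h'.
  by rewrite sz (tree_stage_size h).
by have [Ev ET] := tree_stage_unique h hU (esym sU); subst us U.
Qed.

Lemma tree_stage_join vs T vs' T' : stage vs T -> stage vs' T' ->
  exists ws U, [/\ stage ws U, (T `<=` U)%classic, (T' `<=` U)%classic,
    (forall v, List.In v vs -> List.In v ws) & (forall v, List.In v vs' -> List.In v ws)].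
Proof.
move=> h h'; case: (leqP (size vs) (size vs')) => [|/ltnW] sz.
  have [sub [ws E]] := tree_stage_chain h h' sz; exists vs', T'; split=> //.
  by move=> v hv; rewrite E; apply/In_cat; left.
have [sub [ws E]] := tree_stage_chain h' h sz; exists vs, T; split=> //.
by move=> v hv; rewrite E; apply/In_cat; left.
Qed.

Lemma tree_stage_ends vs T e : stage vs T -> T e ->
  List.In (src e) vs /\ List.In (tgt e) vs.
Proof.
move=> h; elim: h e => // {}vs {}T f h IH [vs1 [vs2 [E _ _ _]]] e.
have sf : List.In (src f) vs by rewrite E; apply/In_cat; right; left.
move=> [[/IH[h1 h2]|->]|->]; rewrite ?src_ainv ?tgt_ainv; split; apply/In_rcons; auto.
Qed.

Lemma tree_stage_ainv vs T e : stage vs T -> T e -> T (ainv e).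
Proof.
move=> h; elim: h e => // {}vs {}T f h IH _ e.
by move=> [[/IH|->]|->]; rewrite ?ainvK; [left; left | right | left; right].
Qed.

Lemma ordered_tree_ainv (e : arcT G) : ordered_tree le e -> ordered_tree le (ainv e).
Proof.
by move=> [vs [T [h Te]]]; exists vs, T; split=> //; exact: tree_stage_ainv h Te.
Qed.

(** A stage is a tree, each new arc of which leads to a new vertex, where it defines
    the potential: the element spelled by the tree walk from the basepoint. *)
Lemma tree_stage_potential vs T : stage vs T ->
  exists tau : vertex G -> free_group X, tau (basepoint G) = 1%g /\
    forall e, T e -> tau (tgt e) = (tau (src e) * fg_of_word [:: lab e])%g.
Proof.
elim=> [|{}vs {}T f h [tau [t1 tT]] nf]; first by exists (fun=> 1%g).
have [vs1 [vs2 [E nvs _ _]]] := nf.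
have sf : List.In (src f) vs by rewrite E; apply/In_cat; right; left.
pose tau' v := if `[< v = tgt f >] then (tau (src f) * fg_of_word [:: lab f])%g else tau v.
have tauE v : List.In v vs -> tau' v = tau v.
  by rewrite /tau'; case: asboolP => // ->.
have tauf : tau' (tgt f) = (tau (src f) * fg_of_word [:: lab f])%g.
  by rewrite /tau'; case: asboolP.
exists tau'; split; first by rewrite tauE //; exact: tree_stage_base h.
move=> e [[Te|->]|->].
- by have [h1 h2] := tree_stage_ends h Te; rewrite !tauE // tT.
- by rewrite tauf tauE.
rewrite src_ainv tgt_ainv tauf tauE // lab_ainv -mulgA.
by rewrite -[[:: linv _]]/(word_inv [:: lab f]) fg_of_word_inv mulgV mulg1.
Qed.

Definition tree_walk T p es q := walk p es q /\ forall e, List.In e es -> T e.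

Lemma tree_walk_stage p es q : tree_walk (ordered_tree le (G := G)) p es q ->
  exists vs T, stage vs T /\ tree_walk T p es q.
Proof.
elim: es p => [|e es IH] p [/= w hT].
  by exists [:: basepoint G], set0; split; [exact: tree_stage0 | split].
case: w => ep w; have [|vs [T [h [_ hw]]]] := IH (tgt e).
  by split=> // x hx; apply: hT; right.
have [ws [U [hU Ue]]] : ordered_tree le e by apply: hT; left.
have [us [V [hV TV UV _ _]]] := tree_stage_join h hU.
exists us, V; split=> //; split=> // x [<-|hx]; first exact: UV.
by apply: TV; exact: hw.
Qed.

(** Both walks lie in some common stage and spell the value at v of its potential. *)
Lemma tree_walk_unique es es' v :
  tree_walk (ordered_tree le (G := G)) (basepoint G) es v ->
  tree_walk (ordered_tree le (G := G)) (basepoint G) es' v ->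
  fg_of_word (word es) = fg_of_word (word es').
Proof.
move=> /tree_walk_stage[vs [T [h [w hw]]]] /tree_walk_stage[vs' [T' [h' [w' hw']]]].
have [us [U [hU TU TU' _ _]]] := tree_stage_join h h'.
have [tau [t1 tU]] := tree_stage_potential hU.
have tauE fs p q : walk p fs q -> (forall e, List.In e fs -> U e) ->
    tau q = (tau p * fg_of_word (word fs))%g.
  elim: fs p => [|e fs IH] p /=; first by move=> -> _; rewrite mulg1.
  move=> [<- wfs] hfs; rewrite (IH (tgt e)) //; last by move=> x hx; apply: hfs; right.
  rewrite tU; last by apply: hfs; left.
  by rewrite [in RHS]fg_of_word_cons mulgA.
have := tauE _ _ _ w (fun e he => TU _ (hw _ he)).
by rewrite (tauE _ _ _ w' (fun e he => TU' _ (hw' _ he))) t1 !mul1g.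
Qed.

Lemma tree_stage_walk vs T v : stage vs T -> List.In v vs ->
  exists es, tree_walk T (basepoint G) es v.
Proof.
move=> h; elim: h v => [|{}vs {}T f h IH [vs1 [vs2 [E _ _ _]]]] v.
  by move=> [<-|//]; exists [::].
have lift u es : tree_walk T (basepoint G) es u ->
    tree_walk (T `|` [set f] `|` [set ainv f])%classic (basepoint G) es u.
  by move=> [w hw]; split=> // e /hw; left; left.
move=> /In_rcons[/IH[es /lift w]|->]; first by exists es.
have [|es [w hw]] := IH (src f); first by rewrite E; apply/In_cat; right; left.
exists (rcons es f); split; first by rewrite -cats1; apply: walk_catI w _.
by move=> e /In_rcons[/hw|->]; [left; left | left; right].
Qed.

Lemma exists_first (V : Type) (P : V -> Prop) s : (exists2 x, List.In x s & P x) ->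
  exists s1 x s2, [/\ s = s1 ++ x :: s2, P x & forall y, List.In y s1 -> ~ P y].
Proof.
elim: s => [[x []]|a s IH [x sx Px]].
case: (pselect (P a)) => [Pa|nPa]; first by exists [::], a, s.
have [|s1 [y [s2 [-> Py first]]]] := IH.
  by case: sx => [Ea|sx]; [case: nPa; rewrite Ea | exists x].
by exists (a :: s1), y, s2; split=> // z [<-|/first].
Qed.

Lemma exists_least (P : pred (X + X)) a : P a ->
  exists b, P b /\ forall c, P c -> le b c.
Proof.
have [le_refl _ le_trans le_tot] := le_total.
move=> Pa; have : a \in enum {: X + X} by rewrite mem_enum.
move: (enum _) (fun c : X + X => mem_enum predT c) => s sP sa.
suff [b [_ Pb min]] : exists b, [/\ b \in s, P b & forall c, c \in s -> P c -> le b c].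
  by exists b; split=> // c; apply: min; rewrite sP.
elim: s a Pa sa {sP} => // x s IH a Pa; rewrite inE => xs.
case: (boolP (has P s)) => [/hasP[y ys Py]|/hasPn nP].
  have [b [bs Pb min]] := IH y Py ys.
  case: (boolP (P x && le x b)) => [/andP[Px lexb]|nx].
    exists x; split; rewrite ?mem_head // => c; rewrite inE => /orP[/eqP -> //|cs Pc].
    by apply: le_trans lexb _; exact: min.
  exists b; split; rewrite ?inE ?bs ?orbT // => c /orP[/eqP -> Px|]; last exact: min.
  by move: nx; rewrite Px /= => nx; have := le_tot b x; rewrite (negPf nx) orbF.
case/orP: xs => [/eqP Ea|/nP]; last by rewrite Pa.
exists x; split; rewrite ?mem_head -?Ea // => c; rewrite inE => /orP[/eqP -> //|/nP].
by move/negPf ->.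
Qed.

(** As X is finite and the automaton deterministic, only finitely many arcs leave a
    given finite set of vertices; so the construction cannot go on forever adding arcs that leave the oldest
    vertices while some other arc out of them still leads outside of the tree. *)
Lemma tree_stage_extend vs T e : stage vs T -> List.In (src e) vs ->
  exists vs' T', stage vs' T' /\ List.In (tgt e) vs'.
Proof.
move=> h /(@List.in_split _ _ _)[vs1 [vs2 Evs]].
pose S := rcons vs1 (src e).
have {Evs} : exists rest, vs = S ++ rest by exists vs2; rewrite /S cat_rcons.
pose exits us (p : 'I_(size S) * (X + X)) :=
  `[< exists f, [/\ src f = nth (src e) S p.1, lab f = p.2 & ~ List.In (tgt f) us] >].
have [n] := ubnP #|[set p | exits vs p]|.
elim: n vs T h => // n IH vs T h ltn [rest Evs].
case: (pselect (List.In (tgt e) vs)) => [te|nte]; first by exists vs, T.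
pose leaves u := exists2 f, src f = u & ~ List.In (tgt f) vs.
have [|S1 [u [S2 [ES [f fu nf] old]]]] := @exists_first _ leaves S.
  by exists (src e); [apply/In_rcons; right | exists e].
pose out a := `[< exists f, [/\ src f = u, lab f = a & ~ List.In (tgt f) vs] >].
have [|a [/asboolP[g [gu ga ng]] min]] := @exists_least out (lab f).
  by apply/asboolP; exists f.
have next : next_tree_arc le vs g.
  exists S1, (S2 ++ rest); split=> //.
  - by rewrite Evs ES gu -catA.
  - move=> x xS1; apply: contrapT => nx; apply: (old _ xS1); by exists x.
  - by rewrite ga => x xu nx; apply: min; apply/asboolP; exists x; rewrite xu.
apply: (IH _ _ (tree_stageS h next)); last first.
  by exists (rcons rest (tgt g)); rewrite Evs rcons_cat.
rewrite ltnS in ltn; apply: leq_trans ltn; apply: proper_card.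
have iP : size S1 < size S by rewrite ES size_cat /= addnS ltnS leq_addr.
apply/properP; split.
  apply/fintype.subsetP => p; rewrite !inE => -[x [h1 h2 h3]].
  by exists x; split=> // h4; apply: h3; apply/In_rcons; left.
have Eu : nth (src e) S (Ordinal iP) = u.
  by rewrite -[nat_of_ord _]/(size S1) ES nth_cat /= ltnn subnn.
exists (Ordinal iP, a); rewrite finset.in_set.
  by apply/asboolP; exists g; rewrite Eu.
apply/asboolP => -[x []]; rewrite Eu => xu xa; apply.
have -> : x = g by apply: dG; [rewrite xa ga | left; rewrite xu gu].
by apply/In_rcons; right.
Qed.

Lemma tree_stage_reach es v : walk (basepoint G) es v ->
  exists vs T, stage vs T /\ List.In v vs.
Proof.
have : exists vs T, stage vs T /\ List.In (basepoint G) vs.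
  by exists [:: basepoint G], set0; split; [exact: tree_stage0 | left].
elim: es (basepoint G) => [|e es IH] p [vs [T [h pvs]]] /=.
  by move=> <-; exists vs, T.
move=> [ep w]; apply: IH w; apply: tree_stage_extend h _; by rewrite ep.
Qed.

Lemma ordered_tree_spans v : core G ->
  exists es, tree_walk (ordered_tree le (G := G)) (basepoint G) es v.
Proof.
move=> /(_ v)[es1 [es2 [w _ _]]].
have [vs [T [h vvs]]] := tree_stage_reach w.
have [es [we he]] := tree_stage_walk h vvs.
by exists es; split=> // e /he Te; exists vs, T.
Qed.

End OrderedTree.

Lemma ordered_tree_iso (X : finType) (le : rel (X + X)) (G G' : automaton X)
    (fv : vertex G -> vertex G') (fe : arcT G -> arcT G') e :
  injective fv -> (forall e', exists f, fe f = e') ->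
  fv (basepoint G) = basepoint G' ->
  (forall f, src (fe f) = fv (src f) /\ tgt (fe f) = fv (tgt f)) ->
  (forall f, lab (fe f) = lab f /\ fe (ainv f) = ainv (fe f)) ->
  ordered_tree le e -> ordered_tree le (fe e).
Proof.
move=> fv_inj fe_surj fb fst flab [vs [T [h Te]]].
have InE v us : List.In (fv v) (map fv us) <-> List.In v us.
  by split=> [/In_map[x hx /fv_inj <-] //|hv]; apply/In_map; exists v.
exists (map fv vs), (fe @` T)%classic; split; last by exists e.
elim: h => {vs T e Te} [|vs T e h IH [vs1 [vs2 [E nt old min]]]].
  by rewrite image_set0 /= fb; exact: tree_stage0.
have [se te] := fst e; have [le_ ae] := flab e.
rewrite map_rcons !image_setU !image_set1 -te ae; apply: tree_stageS IH _.
exists (map fv vs1), (map fv vs2); rewrite se te le_; split.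
- by rewrite E map_cat.
- by move/InE.
- move=> e'; have [f <-] := fe_surj e'; have [-> ->] := fst f.
  by move=> /InE/old ?; apply/InE.
- move=> e'; have [f <-] := fe_surj e'; have [-> ->] := fst f; have [-> _] := flab f.
  by move=> /fv_inj sf nf; apply: min => // tf; apply: nf; apply/InE.
Qed.

(** * Normalized automata are determined by the subgroups that they recognize *)

Section Isomorphisms.
Context (X : choiceType) (A : zmodType).
Implicit Types (G : enriched X A).

Lemma iso_mod_base_sym G G' : iso_mod_base G G' -> iso_mod_base G' G.
Proof.
move=> [EL [fv [fe [[[gv fvK gvK] [ge feK geK]] fb fst flab fL]]]].
split=> //; exists gv, ge; split.
- by split; [exists fv | exists fe].
- by rewrite -fb fvK.
- by move=> e; have [] := fst (ge e); rewrite geK => -> ->; rewrite !fvK.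
- move=> e; have [] := flab (ge e); rewrite geK => -> _; split=> //.
  by apply: (can_inj feK); rewrite geK (flab (ge e)).2 geK.
have [_ _ LN] := base_subgroupP G.
by move=> e; have [/LN + /LN] := fL (ge e); rewrite geK !opprB -EL.
Qed.

Lemma zsubgroup_sum (L : set A) (T : Type) (f : T -> A) s : is_zsubgroup L ->
  (forall x, L (f x)) -> L (\sum_(x <- s) f x)%R.
Proof.
move=> [L0 LD _] fL; elim: s => [|x s IH]; first by rewrite big_nil.
by rewrite big_cons; exact: LD.
Qed.

Lemma iso_mod_base_recognized_sub G G' :
  iso_mod_base G G' -> (recognized G `<=` recognized G')%classic.
Proof.
move=> [EL [fv [fe [_ fb fst flab fL]]]] h /recognizedE[es [l [w Ll ->]]].
have LP := base_subgroupP G; have [L0 LD LN] := LP.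
have fw p q : walk p es q -> walk (fv p) (map fe es) (fv q).
  elim: es p {w} => [|e es IH] p /=; first by move->.
  by have [-> ->] := fst e; move=> [-> /IH].
apply/recognizedE; exists (map fe es), (walk_shift es + l - walk_shift (map fe es))%R.
split; first by rewrite -fb; exact: fw.
  rewrite -EL addrAC; apply: (LD) => //.
  rewrite /walk_shift big_map -sumrB; apply: zsubgroup_sum => // e.
  have [h1 h2] := fL e; have := LD _ _ h1 (LN _ h2); congr (base_subgroup G _).
  by rewrite /arc_shift !opprB addrACA [RHS]addrACA [(lab1 (fe e) + _)%R]addrC.
congr pair; last by rewrite [RHS]addrC subrK.
by congr fg_of_word; rewrite -map_comp; apply: eq_map => e /=; rewrite (flab e).1.
Qed.

Lemma iso_mod_base_recognized G G' :
  iso_mod_base G G' -> recognized G = recognized G'.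
Proof.
move=> h; apply/seteqP; split; apply: iso_mod_base_recognized_sub => //.
exact: iso_mod_base_sym.
Qed.

End Isomorphisms.

Section Transfer.
Context (X : choiceType) (G G' : automaton X).
Hypotheses (rG : reduced G) (dG' : deterministic G').
Local Notation word es := (map (@lab X _) es).

Definition spells (H : automaton X) (g : free_group X) : Prop :=
  exists2 es, walk (basepoint H) es (basepoint H) & fg_of_word (word es) = g.

Hypothesis sub : forall g, spells G g -> spells G' g.

(** Between reduced automata that spell the same elements, this relation is the
    graph of the isomorphism of the skeletons. *)
Definition same_access (H H' : automaton X) (v : vertex H) (v' : vertex H') : Prop :=
  exists es es', [/\ walk (basepoint H) es v, walk (basepoint H') es' v'
    & fg_of_word (word es) = fg_of_word (word es')].

Lemma transfer_walk es :
  walk (basepoint G) es (basepoint G) -> freely_reduced (word es) ->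
  exists2 es', walk (basepoint G') es' (basepoint G') & word es' = word es.
Proof.
move=> w red; have [|es0 w0 E0] := sub (g := fg_of_word (word es)); first by exists es.
have [es1 [w1 E1 _ _]] := reduce_walk dG' (f := fun=> 0%R : int) (fun=> esym (oppr0 _)) w0.
exists es1 => //; rewrite E1; move/fg_of_word_eqP: E0 => ->.
exact: free_reduction_id.
Qed.

Lemma cat_walk_split (H : automaton X) p q es u v :
  walk p es q -> map (@lab X H) es = u ++ v ->
  exists es1 es2 m, [/\ word es1 = u, word es2 = v, walk p es1 m & walk m es2 q].
Proof.
move=> w E; exists (take (size u) es), (drop (size u) es).
move: w; rewrite -{1}(cat_take_drop (size u) es) => /walk_cat[m [w1 w2]].
by exists m; split=> //; rewrite ?map_take ?map_drop E ?take_size_cat ?drop_size_cat.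
Qed.

Lemma same_access_vertex (v : vertex G) : exists v' : vertex G', same_access v v'.
Proof.
have [dG cG] := rG; have [es1 [es2 [w1 w2 red]]] := cG v.
have [|es' w' E'] := transfer_walk (walk_catI w1 w2).
  exact: freely_reduced_walk (walk_catI w1 w2) red.
move: E'; rewrite map_cat => E'.
have [u1 [u2 [m [E1 _ wu1 _]]]] := cat_walk_split w' E'.
by exists m, es1, u1; split=> //; rewrite E1.
Qed.

Lemma same_access_arc (e : arcT G) : exists e' : arcT G', lab e' = lab e /\
  same_access (src e) (src e').
Proof.
have [es1 [es2 [w1 w2 red]]] := core_arc e rG.
have w : walk (basepoint G) (es1 ++ e :: es2) (basepoint G).
  by apply: (walk_catI w1) => /=; split.
have [es' w' E'] := transfer_walk w red.
move: E'; rewrite map_cat /= => E'.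
have [u1 [u2 [m [E1 E2 wu1 wu2]]]] := cat_walk_split w' E'.
case: u2 E2 wu2 => //= e' u2 [Ee' _] [e'm _].
by exists e'; split=> //; exists es1, u1; split=> //; rewrite ?E1 // e'm.
Qed.

Lemma same_access_unique (v : vertex G) (v1 v2 : vertex G') :
  same_access v v1 -> same_access v v2 -> v1 = v2.
Proof.
move=> [p [p' [wp wp' Ep]]] [q [q' [wq wq' Eq]]].
have [|c wc Ec] := sub (g := fg_of_word (word (p ++ walk_inv q))).
  by exists (p ++ walk_inv q) => //; apply: walk_catI wp (walk_invP wq).
apply: (walk_end_determined dG' wp' (walk_catI wc wq')).
rewrite map_cat fg_of_word_cat Ec map_cat fg_of_word_cat lab_walk_inv.
by rewrite fg_of_word_inv -mulgA -Eq mulVg mulg1.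
Qed.

End Transfer.

Lemma same_access_sym (X : choiceType) (G G' : automaton X) (v : vertex G) (v' : vertex G') :
  same_access v v' -> same_access v' v.
Proof. by move=> [es [es' [w w' E]]]; exists es', es; split. Qed.

Lemma same_access_step (X : choiceType) (G G' : automaton X) (e : arcT G) (e' : arcT G') :
  lab e' = lab e -> same_access (src e) (src e') -> same_access (tgt e) (tgt e').
Proof.
move=> El [es [es' [w w' E]]]; exists (rcons es e), (rcons es' e'); split.
- by rewrite -cats1; apply: walk_catI w _.
- by rewrite -cats1; apply: walk_catI w' _.
by rewrite -!cats1 !map_cat !fg_of_word_cat E /= El.
Qed.

Lemma recognized_spells (X : choiceType) (A : zmodType) (G : enriched X A) g :
  spells G g <-> exists a, recognized G (g, a).
Proof.
split=> [[es w <-]|[a /recognizedE[es [l [w _ E]]]]].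
  by exists (walk_shift es); exact: recognized_walk.
by exists es; rewrite // -[g]/(g, a).1 E.
Qed.

(** The walks from the basepoint put the vertices and the arcs of the two automata
    in correspondence. This correspondence carries one ordered tree onto the
    other, so a positive arc and its image close up, through tree walks that read
    no abelian part, to elements of the common subgroup with the same free part;
    their abelian parts differ by an element of the basepoint subgroup. *)
Theorem recognized_iso (X : finType) (A : zmodType) (le : rel (X + X))
    (G G' : enriched X A) :
  total_order le -> normalized le G -> normalized le G' ->
  recognized G = recognized G' -> iso_mod_base G G'.
Proof.
move=> leT [rG pos1 tree2] [rG' pos1' tree2'] EH.
have [[dG cG] [dG' cG']] := (rG, rG').
have EL : base_subgroup G = base_subgroup G'.
  apply/seteqP; split=> l Ll.
    by apply/(@recognized_base _ _ G' l dG'); rewrite -EH; apply/recognized_base.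
  by apply/(@recognized_base _ _ G l dG); rewrite EH; apply/recognized_base.
have sub g : spells G g -> spells G' g.
  by move/recognized_spells; rewrite EH => /recognized_spells.
have sub' g : spells G' g -> spells G g.
  by move/recognized_spells; rewrite -EH => /recognized_spells.
have [fv fvP] := choice (same_access_vertex rG dG' sub).
have [gv gvP] := choice (same_access_vertex rG' dG sub').
have [fe feP] := choice (same_access_arc rG dG' sub).
have [ge geP] := choice (same_access_arc rG' dG sub').
have fvU v v' : same_access v v' -> v' = fv v.
  move=> h; exact (same_access_unique dG' sub h (fvP v)).
have gvU v v' : same_access v' v -> v' = gv v.
  by move=> /same_access_sym h; exact (same_access_unique dG sub' h (gvP v)).
have fvK : cancel fv gv by move=> v; apply/esym/gvU.
have gvK : cancel gv fv by move=> v; apply/esym/fvU/same_access_sym.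
have fst e : src (fe e) = fv (src e) /\ tgt (fe e) = fv (tgt e).
  have [El hs] := feP e; split; first exact: fvU.
  by apply: fvU; exact: same_access_step.
have gst e : src (ge e) = gv (src e) /\ tgt (ge e) = gv (tgt e).
  have [El /same_access_sym hs] := geP e; split; first exact: gvU.
  by apply: gvU; apply: same_access_step.
have feK : cancel fe ge.
  move=> e; apply: dG; first by rewrite (geP _).1 (feP _).1.
  by left; rewrite (gst _).1 (fst _).1 fvK.
have geK : cancel ge fe.
  move=> e; apply: dG'; first by rewrite (feP _).1 (geP _).1.
  by left; rewrite (fst _).1 (gst _).1 gvK.
have flab e : lab (fe e) = lab e /\ fe (ainv e) = ainv (fe e).
  have El f := (feP f).1; split=> //; apply: dG'.
    by rewrite El lab_ainv lab_ainv El.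
  by left; rewrite (fst _).1 !src_ainv (fst _).2.
have fb : fv (basepoint G) = basepoint G'.
  by apply/esym/fvU; exists [::], [::]; split.
have fT e : ordered_tree le e -> ordered_tree le (fe e).
  by apply: ordered_tree_iso fst flab => //; [exact: can_inj fvK | move=> e'; exists (ge e')].
split=> //; exists fv, fe; split=> //; first by split; [exists gv | exists ge].
have shift0 (H : enriched X A) : (forall e : arcT H, positive (lab e) -> lab1 e = 0%R) ->
    (forall e : arcT H, positive (lab e) -> ordered_tree le e -> lab2 e = 0%R) ->
    forall es, (forall e : arcT H, List.In e es -> ordered_tree le e) -> walk_shift es = 0%R.
  move=> h1 h2 es; rewrite /walk_shift; elim: es => [|e es IH] hes; first by rewrite big_nil.
  rewrite big_cons IH ?addr0; last by move=> f hf; apply: hes; right.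
  have Te : ordered_tree le e by apply: hes; left.
  case Ep : (positive (lab e)); first by rewrite /arc_shift h1 // h2 // subr0.
  have Ep' : positive (lab (ainv e)) by rewrite lab_ainv; move: Ep; case: (lab e).
  rewrite -[e]ainvK arc_shiftV /arc_shift h1 // h2 ?subr0 ?oppr0 //.
  exact: ordered_tree_ainv.
have fw p q es : walk p es q -> walk (fv p) (map fe es) (fv q).
  elim: es p => [|e es IH] p /=; first by move->.
  by have [-> ->] := fst e; move=> [-> /IH].
have fwd es : map (@lab X _) (map fe es) = map (@lab X _) es.
  by rewrite -map_comp; apply: eq_map => e /=; rewrite (flab e).1.
have key e : positive (lab e) ->
    base_subgroup G (lab1 (fe e) - lab1 e)%R /\ base_subgroup G (lab2 (fe e) - lab2 e)%R.
  move=> pe; have pe' : positive (lab (fe e)) by rewrite (flab e).1.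
  have [L0 LD LN] := base_subgroupP G.
  rewrite pos1 // pos1' // subr0; split=> //.
  have [u [wu uT]] := ordered_tree_spans dG leT (src e) cG.
  have [v [wv vT]] := ordered_tree_spans dG leT (tgt e) cG.
  have we : walk (src e) [:: e] (tgt e) by [].
  have we' : walk (src (fe e)) [:: fe e] (tgt (fe e)) by [].
  have [wu' wv'] := (fw _ _ _ wu, fw _ _ _ wv).
  rewrite fb -(fst e).1 in wu'; rewrite fb -(fst e).2 in wv'.
  have := recognized_detour wu wv we; have := recognized_detour wu' wv' we'.
  have fmapT es : (forall e, List.In e es -> ordered_tree le e) ->
      forall e, List.In e (map fe es) -> ordered_tree le e.
    by move=> hes e' /In_map[x /hes/fT Tx <-].
  rewrite !fwd /= (flab e).1 (shift0 _ pos1 tree2 _ uT) (shift0 _ pos1 tree2 _ vT).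
  rewrite (shift0 _ pos1' tree2' _ (fmapT _ uT)) (shift0 _ pos1' tree2' _ (fmapT _ vT)).
  rewrite /walk_shift !big_seq1 !add0r !subr0 /arc_shift pos1 // pos1' // !subr0 -EH.
  set g := (X in recognized G (X, _)) => h' h.
  have [_ HM HV] := recognized_subgroup G.
  have := HM _ _ h' (HV _ h); rewrite fta_pairM mulgV => /recognized_base; exact.
move=> e; case Ep : (positive (lab e)); first exact: key.
have Ep' : positive (lab (ainv e)) by rewrite lab_ainv; move: Ep; case: (lab e).
have [] := key _ Ep'; rewrite (flab e).2 !lab1_ainv !lab2_ainv; by split.
Qed.

Lemma fta_pairV (X : choiceType) (A : zmodType) (u : free_group X) (a : A) :
  (((u, a) : free_times_ab X A)^-1)%g = ((u^-1)%g, (- a)%R).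
Proof. by []. Qed.

(** * The automaton of a subgroup *)

Section SubgroupAutomaton.
Context (X : finType) (A : zmodType) (le : rel (X + X)).
Context (H : set (free_times_ab X A)).
Hypotheses (leT : total_order le) (HP : is_subgroup H).
Local Notation F := (free_group X).
Local Notation word es := (map (@lab X _) es).

Definition free_part (g : F) : Prop := exists a, H (g, a).

Lemma free_part1 : free_part 1%g.
Proof. by have [H1 _ _] := HP; exists 0%R. Qed.

Lemma free_partM g h : free_part g -> free_part h -> free_part (g * h)%g.
Proof. by have [_ HM _] := HP; move=> [a Ha] [b Hb]; exists (a + b)%R; exact: HM Ha Hb. Qed.

Lemma free_partV g : free_part g -> free_part (g^-1)%g.
Proof. by have [_ _ HV] := HP; move=> [a Ha]; exists (- a)%R; exact: HV Ha. Qed.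

Definition coset (g : F) : set F := [set h | free_part (h * g^-1)%g].

Lemma coset_eq g h : coset g = coset h <-> free_part (g * h^-1)%g.
Proof.
split=> [E|K].
  have : coset g g by rewrite /coset /= mulgV; exact: free_part1.
  by rewrite E.
apply/seteqP; split=> x; rewrite /coset /= => Kx.
  by have := free_partM Kx K; rewrite mulgA mulgVK.
by have := free_partM Kx (free_partV K); rewrite invgM invgK mulgA mulgVK.
Qed.

Definition extendable (w : seq (X + X)) : Prop :=
  exists w', freely_reduced (w ++ w') /\ free_part (fg_of_word (w ++ w')).

Lemma extendable_catl u v : extendable (u ++ v) -> extendable u.
Proof. by move=> [w []]; rewrite -catA => *; exists (v ++ w). Qed.

Lemma extendable_rcons w a : extendable (rcons w a) -> extendable w.
Proof. by rewrite -cats1; exact: extendable_catl. Qed.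

Definition coset_shift (S : set F) (a : X + X) : set F :=
  [set h | S (h * (fg_of_word [:: a])^-1)%g].

Lemma fg_of_letterV (a : X + X) : fg_of_word [:: linv a] = ((fg_of_word [:: a])^-1)%g.
Proof. exact: (fg_of_word_inv [:: a]). Qed.

Lemma coset_shiftE g a : coset_shift (coset g) a = coset (g * fg_of_word [:: a])%g.
Proof.
by apply/seteqP; split=> h; rewrite /coset_shift /coset /= invgM mulgA.
Qed.

Lemma coset_shiftK S a : coset_shift (coset_shift S a) (linv a) = S.
Proof.
apply/seteqP; split=> h; rewrite /coset_shift /= fg_of_letterV invgK.
  by rewrite mulgK.
by rewrite mulgK.
Qed.

(** The vertices are the cosets of the prefixes of the reduced words of the free
    part: they span the core of the Schreier graph of the free part. *)
Definition coset_vertex : Type :=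
  {S : set F | exists w, extendable w /\ S = coset (fg_of_word w)}.

(** In a Schreier graph the source and the label determine an arc. *)
Definition coset_arc : Type :=
  {p : set F * (X + X) |
    exists w, extendable (rcons w p.2) /\ p.1 = coset (fg_of_word w)}.

Lemma sig_eq (T : Type) (P : T -> Prop) (x y : {z | P z}) :
  sval x = sval y -> x = y.
Proof. by case: x y => x Px [y Py] /= E; exact: eq_exist. Qed.

Lemma arc_src_subproof (e : coset_arc) :
  exists w, extendable w /\ (sval e).1 = coset (fg_of_word w).
Proof. by case: e => p /= [w [/extendable_rcons Pw E]]; exists w. Qed.

Definition arc_src (e : coset_arc) : coset_vertex :=
  exist _ (sval e).1 (arc_src_subproof e).

Lemma arc_inv_subproof (e : coset_arc) :
  exists w, extendable (rcons w (linv (sval e).2)) /\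
    coset_shift (sval e).1 (sval e).2 = coset (fg_of_word w).
Proof.
case: e => -[S a] /= [w [[w' [red K]] ->]].
have E : word_inv (rcons w a ++ w') = rcons (word_inv w') (linv a) ++ word_inv w.
  by rewrite /word_inv map_cat rev_cat map_rcons rev_rcons cat_rcons.
exists (word_inv w'); split.
  exists (word_inv w); rewrite -E freely_reduced_rev; split=> //.
  by rewrite fg_of_word_inv; exact: free_partV.
rewrite coset_shiftE; apply/coset_eq; rewrite fg_of_word_inv invgK.
by rewrite -!fg_of_word_cat cats1.
Qed.

Definition arc_inv (e : coset_arc) : coset_arc :=
  exist _ (coset_shift (sval e).1 (sval e).2, linv (sval e).2) (arc_inv_subproof e).

Lemma arc_invK : involutive arc_inv.
Proof.
by move=> e; apply: sig_eq; rewrite /= coset_shiftK linvK; case: (sval e).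
Qed.

Lemma basepoint_subproof : exists w, extendable w /\ coset 1%g = coset (fg_of_word w).
Proof. by exists [::]; split=> //; exists [::]; split=> //; exact: free_part1. Qed.

Definition coset_automaton : automaton X :=
  @Automaton X coset_vertex coset_arc arc_src (fun e => arc_src (arc_inv e))
    (fun e => (sval e).2) arc_inv (exist _ (coset 1%g) basepoint_subproof) arc_invK
    (fun=> erefl) (fun e => congr1 arc_src (arc_invK e)) (fun=> erefl).

Local Notation Gam := coset_automaton.

Lemma coset_automaton_deterministic : deterministic Gam.
Proof.
move=> e e' /= El; case=> /(congr1 sval) /= Es; apply: sig_eq.
  by rewrite [LHS]surjective_pairing [RHS]surjective_pairing Es El.
rewrite [LHS]surjective_pairing [RHS]surjective_pairing El; congr pair.
by rewrite -[LHS](coset_shiftK _ (sval e).2) Es El coset_shiftK.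
Qed.

Lemma coset_walk (p q : vertex Gam) es g :
  walk p es q -> sval p = coset g -> sval q = coset (g * fg_of_word (word es))%g.
Proof.
elim: es p g => [|e es IH] p g /=; first by move=> -> ->; rewrite mulg1.
move=> [ep w] Ep; have /IH : walk (tgt e : vertex Gam) es q by [].
move=> /(_ (g * fg_of_word [:: lab e])%g) ->.
  by rewrite -mulgA -fg_of_word_cons.
by rewrite /= -coset_shiftE -Ep -ep.
Qed.

Lemma coset_read u w (p q : vertex Gam) : extendable (w ++ u) ->
  sval p = coset (fg_of_word w) -> sval q = coset (fg_of_word (w ++ u)) ->
  exists es, walk p es q /\ word es = u.
Proof.
elim: u w p => [|a u IH] w p Pw Ep Eq.
  by exists [::]; split=> //=; apply: sig_eq; rewrite Ep Eq cats0.
rewrite -cat_rcons in Pw Eq.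
have Pe : exists w', extendable (rcons w' (coset (fg_of_word w), a).2) /\
    (coset (fg_of_word w), a).1 = coset (fg_of_word w').
  by exists w; split=> //; exact: extendable_catl Pw.
pose e : arcT Gam := exist _ (coset (fg_of_word w), a) Pe.
have [|es [wes Ees]] := IH (rcons w a) (tgt e) Pw _ Eq.
  by rewrite /= coset_shiftE -fg_of_word_cat cats1.
by exists (e :: es); rewrite /= Ees; split=> //; split=> //; apply: sig_eq.
Qed.

Lemma coset_automaton_spells g :
  free_part g <-> spells Gam g.
Proof.
split=> [K|[es w <-]].
  have Ew : sval (basepoint Gam) = coset (fg_of_word ([::] ++ fg_word g)).
    by apply/coset_eq; rewrite fg_wordK mul1g; exact: free_partV.
  have [|es [w E]] := coset_read (w := [::]) (p := basepoint Gam) _ erefl Ew.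
    by exists [::]; rewrite cats0 fg_wordK fg_wordP.
  by exists es; rewrite // E fg_wordK.
have /esym/coset_eq := coset_walk w (erefl (coset 1%g)).
by rewrite mul1g invg1 mulg1.
Qed.

Lemma coset_automaton_core : core Gam.
Proof.
move=> v; have [w [[w' [red K]] Ev]] := svalP v.
have [|es1 [w1 E1]] := coset_read (w := [::]) (p := basepoint Gam) (q := v) _ erefl Ev.
  by exists w'.
have [||es2 [w2 E2]] := coset_read (u := w') (p := v) (q := basepoint Gam) _ Ev _.
- by exists [::]; rewrite cats0.
- by apply/coset_eq; rewrite mul1g; exact: free_partV.
exists es1, es2; split=> //; apply: reduced_walk_word.
by rewrite map_cat E1 E2.
Qed.

(** Each vertex v is given the element tau v of the free group spelled by the tree
    walk to v. For every arc, the element tau p x tau q^-1 is in the free part,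
    and completing it to an element of the subgroup tells which abelian label to
    put on the arc; tree arcs give the trivial element, which can be completed by
    zero. *)
Lemma subgroup_automaton :
  exists2 G : enriched X A, normalized le G & recognized G = H.
Proof.
have [H1 HM HV] := HP; have dG := coset_automaton_deterministic.
have cG := coset_automaton_core.
have [es_ es_T] := choice (fun v => ordered_tree_spans dG leT v cG).
pose tau v := fg_of_word (word (es_ v)).
have tau1 : tau (basepoint Gam) = 1%g.
  by apply: (tree_walk_unique dG leT (es_T _) (es' := [::])); split.
have tauT (e : arcT Gam) : ordered_tree le e ->
    tau (tgt e) = (tau (src e) * fg_of_word [:: lab e])%g.
  move=> Te; rewrite -fg_of_word_cat; have [w hw] := es_T (src e).
  rewrite -[[:: lab e]]/(word [:: e]) -map_cat.
  apply: (tree_walk_unique dG leT (es_T _)); split; first exact: walk_catI w _.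
  by move=> f /In_cat[/hw|[<-|]].
have tauE v : sval v = coset (tau v).
  by rewrite -[tau v]mul1g; apply: coset_walk (es_T v).1 _.
pose g (e : arcT Gam) := (tau (src e) * fg_of_word [:: lab e] * (tau (tgt e))^-1)%g.
have aP e : exists a, H (g e, a) /\ (g e = 1%g -> a = 0%R).
  case: (pselect (g e = 1%g)) => [-> |ne]; first by exists 0%R.
  suff [a Ha] : free_part (g e) by exists a.
  apply/coset_eq; rewrite -tauE.
  by rewrite (coset_walk (_ : walk (src e) [:: e] (tgt e)) (tauE _)).
have [a_ a_P] := choice aP.
pose l1 (e : arcT Gam) : A := if positive (lab e) then 0%R else a_ (ainv e).
pose l2 (e : arcT Gam) : A := if positive (lab e) then a_ e else 0%R.
have l1V e : l1 (ainv e) = l2 e.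
  by rewrite /l1 /l2 lab_ainv ainvK; case: (lab e).
have l2V e : l2 (ainv e) = l1 e.
  by rewrite /l1 /l2 lab_ainv; case: (lab e).
have LP : is_zsubgroup [set a : A | H (1%g, a)].
  split=> [|a b Ha Hb|a Ha] //=.
  - by have := HM _ _ Ha Hb; rewrite fta_pairM mulg1.
  - by have := HV _ Ha; rewrite fta_pairV invg1.
pose G := @Enriched X A Gam l1 l2 _ l1V l2V LP.
have gV e : g (ainv e) = ((g e)^-1)%g.
  by rewrite /g src_ainv tgt_ainv lab_ainv fg_of_letterV !invgM invgK mulgA.
have He (e : arcT G) : H (g e, arc_shift e).
  rewrite /arc_shift /= /l1 /l2; case Ep: (positive (lab e)).
    by rewrite subr0; have [] := a_P e.
  have [/HV + _] := a_P (ainv e); rewrite gV fta_pairV.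
  by rewrite invgK sub0r.
have Hw (p q : vertex G) es : walk p es q ->
    H ((tau p * fg_of_word (word es) * (tau q)^-1)%g, walk_shift es).
  elim: es p => [|e es IH] p.
    by move=> ->; rewrite mulg1 mulgV /walk_shift big_nil.
  move=> [<- /IH Hes]; have := HM _ _ (He e) Hes; rewrite fta_pairM.
  have -> : word (e :: es) = [:: lab e] ++ word es by [].
  by rewrite fg_of_word_cat /walk_shift big_cons /g !mulgA mulgVK.
exists G.
  split; first by split.
    by move=> e pe; rewrite /= /l1 pe.
  move=> e pe Te; rewrite /= /l2 pe; apply: (a_P e).2.
  by rewrite /g tauT // mulgV.
apply/seteqP; split=> [h /recognizedE[es [l [w Ll ->]]]|[h a] Ha].
  have := HM _ _ (Hw _ _ _ w) Ll; rewrite fta_pairM.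
  by rewrite -[basepoint G]/(basepoint Gam) tau1 invg1 mul1g !mulg1.
have /coset_automaton_spells[es w E] : free_part h by exists a.
apply/recognizedE; exists es, (a - walk_shift (G := G) es)%R; split=> //.
  have := Hw _ _ _ w; rewrite -[basepoint G]/(basepoint Gam) tau1 invg1 mul1g mulg1 E.
  move=> /HV; rewrite fta_pairV => /(HM _ _ Ha).
  by rewrite fta_pairM mulgV.
by rewrite E addrC subrK.
Qed.

End SubgroupAutomaton.

(** * Finiteness *)

Lemma finite_typeP (T : Type) :
  finite_set [set: T] <-> exists s : seq T, forall x, List.In x s.
Proof.
have := @finite_seqP {classic T} setT; move=> fP; split.
  move/fP => [s E]; exists s => x; apply/(@In_mem {classic T}).
  by have : [set` s]%classic x by rewrite -E.
move=> [s hs]; apply/fP; exists s; apply/seteqP; split=> // x _ /=.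
by apply/(@In_mem {classic T}).
Qed.

Section Zsubgroups.
Context (A : zmodType).
Implicit Types (L : set A) (s : seq A).
Local Notation span s := (generated_zsubgroup [set` s]).

Lemma zsubgroupB L a b : is_zsubgroup L -> L a -> L b -> L (a - b)%R.
Proof. by move=> [_ LD LN] La Lb; apply: LD => //; exact: LN. Qed.

Lemma zsubgroup_mulz L a (z : int) : is_zsubgroup L -> L a -> L (a *~ z)%R.
Proof.
move=> [L0 LD LN] La; have Ln n : L (a *+ n)%R.
  by elim: n => [|n IH]; rewrite ?mulr0n // mulrS; exact: LD.
by case: z => n; [exact: Ln | apply: LN; exact: Ln].
Qed.

Lemma span_mem s a : a \in s -> span s a.
Proof. by move=> sa L [_ sub]; exact: sub. Qed.

Lemma span_sub s L : is_zsubgroup L -> (forall a, a \in s -> L a) ->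
  (span s `<=` L)%classic.
Proof. by move=> LP sub a; apply; split. Qed.

Lemma span_cons t s a : span (t :: s) a ->
  exists z v, span s v /\ a = (t *~ z + v)%R.
Proof.
have [S0 SD SN] := generated_zsubgroupP [set` s].
apply: (@span_sub (t :: s) [set a | exists z v, span s v /\ a = (t *~ z + v)%R]).
  split=> [|_ _ [z [v [Sv ->]]] [z' [v' [Sv' ->]]]|_ [z [v [Sv ->]]]].
  - by exists 0%R, 0%R; rewrite mulr0z addr0.
  - exists (z + z')%R, (v + v')%R; split; first exact: SD.
    by rewrite mulrzDr addrACA.
  - exists (- z)%R, (- v)%R; split; first exact: SN.
    by rewrite mulrNz opprD.
move=> b; rewrite inE => /orP[/eqP ->|sb].
  by exists 1%R, 0%R; rewrite mulr1z addr0.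
by exists 0%R, b; rewrite mulr0z add0r; split=> //; exact: span_mem.
Qed.

(** The Noetherian property of finitely generated abelian groups. In a subgroup of
    the span of t and s, take an element whose coefficient on t is positive and least: division
    with remainder by this coefficient brings every element of the subgroup into
    the span of s. *)
Lemma zsubgroup_of_span s L : is_zsubgroup L -> (L `<=` span s)%classic ->
  exists s', L = span s'.
Proof.
elim: s L => [|t s IH] L LP sub.
  exists [::]; apply/seteqP; split=> //; exact: span_sub.
have [L0 LD LN] := LP; have SP := generated_zsubgroupP [set` s].
have [S0 SD SN] := SP.
pose coef z := exists v, span s v /\ L (t *~ z + v)%R.
case: (pselect (exists n, 0 < n /\ coef (Posz n))) => [exn|nex]; last first.
  apply: IH => // a La; have [z [v [Sv Ea]]] := span_cons (sub a La).
  have coefz : coef z by exists v; rewrite -Ea.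
  case: z coefz Ea => [[|n]|n] cz ->.
  - by rewrite mulr0z add0r.
  - by case: nex; exists n.+1.
  - case: nex; exists n.+1; split=> //; case: cz => w [Sw Lw].
    exists (- w)%R; split; first exact: SN.
    by have := LN _ Lw; rewrite NegzE mulrNz opprD opprK.
have exn' : exists n, `[< 0 < n /\ coef (Posz n) >].
  by case: exn => n hn; exists n; apply/asboolP.
have [n /asboolP[n0 [v0 [Sv0 Lv0]]] min] := ex_minnP exn'.
pose l0 := (t *~ Posz n + v0)%R.
have [|s' Es'] := IH [set a | L a /\ span s a]%classic _ (fun a h => h.2).
  split=> [|a b [? ?] [? ?]|a [? ?]] //; split.
  - exact: LD. - exact: SD. - exact: LN. - exact: SN.
exists (l0 :: s'); apply/seteqP; split; last first.
  apply: span_sub => // a; rewrite inE => /orP[/eqP -> //|/span_mem].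
  by rewrite -Es' => -[].
move=> a La; have [z [v [Sv Ea]]] := span_cons (sub a La).
pose q := (z %/ Posz n)%Z; pose r := (z %% Posz n)%Z.
have Ez : z = (q * Posz n + r)%R by exact: divz_eq.
have r0 : (0 <= r)%R by apply: modz_ge0; rewrite -lt0n.
have rn : (r < Posz n)%R by apply: ltz_pmod.
have Eb : (a - l0 *~ q)%R = (t *~ r + (v - v0 *~ q))%R.
  rewrite Ea /l0 Ez mulrzDr mulrzDl -mulrzA [(Posz n * q)%R]mulrC opprD.
  by rewrite addrACA [(t *~ (q * Posz n) + _)%R]addrC addrK.
have Lb : L (a - l0 *~ q)%R by apply: zsubgroupB => //; exact: zsubgroup_mulz.
have Sb : span s (v - v0 *~ q)%R := zsubgroupB SP Sv (zsubgroup_mulz q SP Sv0).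
have Er : r = 0%R.
  case E: r r0 rn Eb => [[|k]|k] // _ rn Eb.
  have /min : `[< 0 < k.+1 /\ coef (Posz k.+1) >].
    by apply/asboolP; split=> //; exists (v - v0 *~ q)%R; rewrite -Eb.
  by rewrite leqNgt => /negP[].
have : span s' (a - l0 *~ q)%R by rewrite -Es' /=; split=> //; rewrite Eb Er mulr0z add0r.
move=> Sa' L' [LP' sub']; have [_ LD' _] := LP'.
rewrite -[a](subrK (l0 *~ q)%R); apply: LD'.
  by apply: Sa'; split=> // b sb; apply: sub'; rewrite /= inE sb orbT.
by apply: zsubgroup_mulz => //; apply: sub'; rewrite /= mem_head.
Qed.

Lemma zsubgroup_fg L : fg_abelian A -> is_zsubgroup L -> exists s, L = span s.
Proof. by move=> [s Es] LP; apply: (zsubgroup_of_span (s := s)) => //; rewrite Es. Qed.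

End Zsubgroups.

Section Generation.
Context (X : choiceType) (A : zmodType) (G : enriched X A).
Local Notation word es := (map (@lab X _) es).

Lemma generated_sub (S : groupType) (B C : set S) : is_subgroup C ->
  (B `<=` C)%classic -> (generated_subgroup B `<=` C)%classic.
Proof. by move=> CP BC g; apply; split. Qed.

(** Given a walk from the basepoint to each vertex, a basepoint-walk reads the
    product of the loops that follow, for each of its arcs in turn, the chosen
    walk to the source, the arc, and the chosen walk back from the target. *)
Lemma recognized_sub_loops (pw : vertex G -> seq (arcT G)) (H : set (free_times_ab X A)) :
  (forall v, walk (basepoint G) (pw v) v) -> pw (basepoint G) = [::] ->
  is_subgroup H ->
  (forall e, H (walk_reading (pw (src e) ++ e :: walk_inv (pw (tgt e))))) ->
  (forall l, base_subgroup G l -> H (1%g, l)) ->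
  (recognized G `<=` H)%classic.
Proof.
move=> wpw pw0 [H1 HM HV] Hloop HL h /recognizedE[es [l [w Ll ->]]].
have readM es1 es2 : walk_reading (G := G) (es1 ++ es2) =
    (walk_reading es1 * walk_reading es2)%g by rewrite /walk_reading big_cat.
have readV fs : walk_reading (G := G) (walk_inv fs) = ((walk_reading fs)^-1)%g.
  by rewrite !walk_readingE lab_walk_inv fg_of_word_inv walk_shift_inv.
suff Hw p q : walk p es q -> H (walk_reading (pw p) * walk_reading es * (walk_reading (pw q))^-1)%g.
  have := HM _ _ (Hw _ _ w) (HL _ Ll).
  rewrite pw0 {1 3}/walk_reading !big_nil mul1g invg1 mulg1 walk_readingE.
  by rewrite fta_pairM mulg1.
elim: es p {w} => [|e es IH] p /=.
  by move=> ->; rewrite {2}/walk_reading big_nil mulg1 mulgV.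
move=> [<- /IH Hes]; have := HM _ _ (Hloop e) Hes.
rewrite -cat_rcons readM readV -cats1 readM -[e :: es]/([:: e] ++ es) readM.
by rewrite !mulgA mulgVK.
Qed.

Lemma finite_automaton_fg : fg_abelian A -> core G -> finite_automaton G ->
  exists s : seq (free_times_ab X A), recognized G = generated_subgroup [set` s].
Proof.
move=> fgA cG [_ /finite_typeP[E hE]].
have pwP v : exists es, walk (basepoint G) es v /\ (v = basepoint G -> es = [::]).
  case: (pselect (v = basepoint G)) => [->|nv]; first by exists [::].
  by have [es [_ [w _ _]]] := cG v; exists es.
have [pw pwH] := choice pwP.
have wpw v : walk (basepoint G) (pw v) v by have [] := pwH v.
have [ls Els] := zsubgroup_fg fgA (base_subgroupP G).
pose loop e := walk_reading (pw (src e) ++ e :: walk_inv (pw (tgt e))).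
pose s := map loop E ++ [seq (1%g, l) : free_times_ab X A | l <- ls].
have SP := generated_subgroupP [set` s]; have [S1 SM SV] := SP.
have sS x : x \in s -> generated_subgroup [set` s] x by move=> sx B [_]; apply.
exists s; apply/seteqP; split.
  apply: (recognized_sub_loops wpw) => //; first by apply: (pwH _).2.
    by move=> e; apply: sS; rewrite mem_cat; apply/orP; left; apply/In_mem/In_map; exists e.
  rewrite Els => l; apply: (span_sub (L := [set l | generated_subgroup [set` s] (1%g, l)])).
    split=> [|a b Ha Hb|a Ha] //=.
    - by have := SM _ _ Ha Hb; rewrite fta_pairM mulg1.
    - by have := SV _ Ha; rewrite fta_pairV invg1.
  by move=> a sa; apply: sS; rewrite mem_cat map_f ?orbT.
apply: generated_sub; first exact: recognized_subgroup.
move=> x /=; rewrite mem_cat => /orP[/In_mem/In_map[e _ <-]|/mapP[l sl ->]].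
  rewrite /loop walk_readingE; apply: recognized_walk; apply: (walk_catI (wpw _)).
  by split=> //; exact: walk_invP.
apply/recognizedE; exists [::], l; split=> //; last by rewrite /walk_shift big_nil add0r.
by rewrite Els; exact: span_mem.
Qed.

(** Conversely the arcs of walks that read the generators, together with their
    inverses, are all the arcs: every reduced basepoint-walk is the reduction of
    a product of these walks. *)
Lemma fg_finite_automaton (s : seq (free_times_ab X A)) : reduced G ->
  recognized G = generated_subgroup [set` s] -> finite_automaton G.
Proof.
move=> rG EH; have [dG cG] := rG.
have [E0 hE0] : exists E, forall h, h \in s -> exists es,
    [/\ walk (basepoint G) es (basepoint G), h.1 = fg_of_word (word es)
      & forall e, List.In e es -> List.In e E].
  have : forall h, h \in s -> recognized G h by move=> h sh; rewrite EH => B [_]; apply.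
  elim: s {EH} => [|h s IH] hs; first by exists [::].
  have [|E hE] := IH; first by move=> x sx; apply: hs; rewrite inE sx orbT.
  have /recognizedE[es [l [w _ Eh]]] := hs h (mem_head _ _).
  exists (es ++ E) => x; rewrite inE => /orP[/eqP ->|/hE[fs [wfs Ex fsE]]].
    by exists es; rewrite Eh; split=> // e he; apply/In_cat; left.
  by exists fs; split=> // e /fsE he; apply/In_cat; right.
pose E := E0 ++ map (@ainv X G) E0.
have EV e : List.In e E -> List.In (ainv e) E.
  move=> /In_cat[he|/In_map[x hx <-]]; apply/In_cat; [right | left].
    by apply/In_map; exists e.
  by rewrite ainvK.
pose H := [set h : free_times_ab X A | exists es,
    [/\ walk (basepoint G) es (basepoint G), h.1 = fg_of_word (word es)
      & forall e, List.In e es -> List.In e E]]%classic.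
have HP : is_subgroup H.
  split=> [|g h [es [w Eg hE]] [fs [w' Eh hE']]|g [es [w Eg hE]]].
  - by exists [::].
  - exists (es ++ fs); split; first exact: walk_catI w w'.
      by rewrite map_cat fg_of_word_cat -Eg -Eh.
    by move=> e /In_cat[/hE|/hE'].
  - exists (walk_inv es); split; first exact: walk_invP.
      by rewrite lab_walk_inv fg_of_word_inv -Eg.
    by move=> e /In_rev/In_map[x /hE/EV hx <-].
have HH h : recognized G h -> H h.
  rewrite EH; apply: (generated_sub HP) => x /hE0[es [w Ex he]].
  by exists es; split=> // e /he h1; apply/In_cat; left.
have allE e : List.In e E.
  have [es1 [es2 [w1 w2 red]]] := core_arc e rG.
  have w : walk (basepoint G) (es1 ++ e :: es2) (basepoint G) by apply: (walk_catI w1).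
  have /HH[fs [wfs Efs fsE]] := recognized_walk w.
  have [fs' [wfs' Efs' sub _]] := reduce_walk dG (fun e => arc_shiftV e) wfs.
  apply: fsE; apply: sub.
  have -> : fs' = es1 ++ e :: es2.
    apply: (deterministic_walk dG wfs' w); rewrite Efs'.
    by move/fg_of_word_eqP: Efs => /= <-; exact: free_reduction_id.
  by apply/In_cat; right; left.
split; apply/finite_typeP; last by exists E.
exists (basepoint G :: map (@src X G) E) => v.
have [es1 [_ [w1 _ _]]] := cG v; case/lastP: es1 w1 => [->|es e]; first by left.
rewrite -cats1 => /walk_cat[m [_ /= [_ <-]]]; right; apply/In_map.
by exists (ainv e); rewrite ?src_ainv.
Qed.

End Generation.

(** * Programs on codes *)

Section Vectors.
Context (r : nat).
Local Notation vec := (r.-tuple int).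

Definition vec_zero : vec := [tuple 0%R | i < r].
Definition vec_add (u v : vec) : vec := [tuple (tnth u i + tnth v i)%R | i < r].
Definition vec_opp (u : vec) : vec := [tuple (- tnth u i)%R | i < r].
Definition vec_sub (u v : vec) : vec := vec_add u (vec_opp v).

Context (A : zmodType) (t : r.-tuple A).

Lemma zcomb0 : zcomb t vec_zero = 0%R.
Proof. by rewrite /zcomb big1 // => i _; rewrite tnth_mktuple mulr0z. Qed.

Lemma zcombD u v : zcomb t (vec_add u v) = (zcomb t u + zcomb t v)%R.
Proof.
by rewrite /zcomb -big_split; apply: eq_bigr => i _; rewrite tnth_mktuple mulrzDr.
Qed.

Lemma zcombN u : zcomb t (vec_opp u) = (- zcomb t u)%R.
Proof.
by rewrite /zcomb -sumrN; apply: eq_bigr => i _; rewrite tnth_mktuple mulrNz.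
Qed.

Lemma zcombB u v : zcomb t (vec_sub u v) = (zcomb t u - zcomb t v)%R.
Proof. by rewrite zcombD zcombN. Qed.

End Vectors.

Section Programs.
Context (X : finType) (r : nat).
Local Notation vec := (r.-tuple int).
Local Notation entry := (nat * vec * X * vec * nat)%type.

(** The arcs of a code, of both orientations: source, label, difference of the
    abelian labels, target. *)
Definition arc_data : Type := (nat * (X + X) * vec * nat)%type.

Definition clip (n p : nat) : nat := if p <= n then p else 0.

Definition entry_arcs (n : nat) (e : entry) : seq arc_data :=
  [:: (clip n e.1.1.1.1, inl e.1.1.2, vec_sub e.1.2 e.1.1.1.2, clip n e.2);
      (clip n e.2, inr e.1.1.2, vec_sub e.1.1.1.2 e.1.2, clip n e.1.1.1.1)].

Definition code_arcs (c : automaton_code X r) : seq arc_data :=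
  flatten [seq entry_arcs c.1.1 e | e <- c.1.2].

(** What is kept of a walk from the basepoint: its end, its label, and the vector
    that it reads. *)
Definition walk_data : Type := (nat * seq (X + X) * vec)%type.

Definition extend_walk (arcs : seq arc_data) (u : walk_data) : seq walk_data :=
  [seq (a.2, rcons u.1.2 a.1.1.2, vec_add u.2 a.1.2) | a <- arcs & a.1.1.1 == u.1.1].

Definition walks_upto (c : automaton_code X r) (k : nat) : seq walk_data :=
  iter k (fun ws => ws ++ flatten [seq extend_walk (code_arcs c) u | u <- ws])
    [:: (0, [::], vec_zero r)].

(** Every vertex of a connected automaton on n+1 vertices is the end of a walk of
    length at most n from the basepoint, so that the loops which generate the
    recognized subgroup have length at most 2n+1. *)
Definition code_generators (c : automaton_code X r) : seq (elt_code X r) :=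
  [seq (u.1.2, u.2) | u <- walks_upto c (c.1.1 + c.1.1).+1 & u.1.1 == 0] ++
  [seq ([::], l) | l <- c.2].

End Programs.

Section CodedAutomaton.
Context (X : finType) (r : nat) (c : automaton_code X r).
Local Notation vec := (r.-tuple int).
Local Notation n := c.1.1.
Local Notation G := (decode_skeleton c).
Local Notation word es := (map (@lab X _) es).

Definition arc_entry (e : arcT G) := tnth (in_tuple c.1.2) e.1.

Definition arc_vec (e : arcT G) : vec :=
  if e.2 then vec_sub (arc_entry e).1.2 (arc_entry e).1.1.1.2
  else vec_sub (arc_entry e).1.1.1.2 (arc_entry e).1.2.

Definition arc_record (e : arcT G) : arc_data X r :=
  (nat_of_ord (src e), lab e, arc_vec e, nat_of_ord (tgt e)).

Lemma clipE p : nat_of_ord (inord p : 'I_n.+1) = clip n p.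
Proof.
rewrite /inord /insubd /clip; case: insubP => [u|]; rewrite ltnS; first by move=> -> ->.
by move/negPf ->.
Qed.

Lemma code_arcsP a : a \in code_arcs c <-> exists e, a = arc_record e.
Proof.
rewrite /code_arcs; split.
  move=> /flattenP[s /mapP[e /(nthP e)[i ltis Ee] ->]].
  have E (b : bool) : arc_entry (Ordinal ltis, b) = e.
    by rewrite /arc_entry (tnth_nth e).
  rewrite !inE => /orP[] /eqP ->; [exists (Ordinal ltis, true) | exists (Ordinal ltis, false)];
    by rewrite /arc_record /arc_vec /= E !clipE -/(arc_entry (Ordinal ltis, true)) E.
move=> [e ->]; apply/flattenP; exists (entry_arcs n (arc_entry e)).
  by apply: map_f; exact: mem_tnth.
case: e => i [].
  by rewrite /arc_record /arc_vec /= !clipE !inE eqxx.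
by rewrite /arc_record /arc_vec /= !clipE !inE eqxx orbT.
Qed.

Definition walk_vec (es : seq (arcT G)) : vec :=
  foldl (fun v e => vec_add v (arc_vec e)) (vec_zero r) es.

Lemma walk_vec_rcons es e : walk_vec (rcons es e) = vec_add (walk_vec es) (arc_vec e).
Proof. by rewrite /walk_vec foldl_rcons. Qed.

Lemma walks_uptoP k u : u \in walks_upto c k <-> exists es q,
  [/\ walk (basepoint G) es q, size es <= k & u = (nat_of_ord q, word es, walk_vec es)].
Proof.
elim: k u => [|k IH] u.
  rewrite inE; split=> [/eqP ->|[es [q [w]]]]; first by exists [::], ord0.
  by rewrite leqn0 => /nilP E ->; rewrite E /= in w *; rewrite -w.
rewrite /walks_upto iterS -/(walks_upto c k) mem_cat; split.
  case/orP=> [/IH[es [q [w sz ->]]]|]; first by exists es, q; split=> //; exact: leqW.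
  move=> /flattenP[s /mapP[u0 /IH[es [q [w sz ->]]] ->]] /mapP[a].
  rewrite mem_filter => /andP[/eqP /= sa /code_arcsP[e Ea]] ->; subst a.
  exists (rcons es e), (tgt e); rewrite size_rcons; split=> //.
    by rewrite -cats1; apply: (walk_catI w); split=> //; apply: val_inj.
  by rewrite map_rcons walk_vec_rcons.
move=> [es [q [w sz ->]]]; apply/orP.
case/lastP: es w sz => [|es e] w sz; first by left; apply/IH; exists [::], q.
rewrite size_rcons ltnS in sz; right; apply/flattenP.
move: w; rewrite -cats1 => /walk_cat[m [w /= [em <-]]].
exists (extend_walk (code_arcs c) (nat_of_ord m, word es, walk_vec es)).
  by apply: map_f; apply/IH; exists es, m.
apply/mapP; exists (arc_record e).
  by rewrite mem_filter /= em eqxx; apply/code_arcsP; exists e.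
by rewrite cats1 map_rcons walk_vec_rcons.
Qed.

Lemma path_walk (e0 : rel 'I_n.+1) (p : vertex G) s :
  (forall p q, e0 p q -> exists2 e : arcT G, src e = p & tgt e = q) ->
  path e0 p s -> exists2 es, walk p es (last p s) & size es = size s.
Proof.
move=> e0P; elim: s p => [|q s IH] p /=; first by exists [::].
move=> /andP[/e0P[e ep eq] /IH[es w sz]]; exists (e :: es); last by rewrite /= sz.
by split=> //; rewrite eq.
Qed.

Lemma short_walk (v : vertex G) es : walk (basepoint G) es v ->
  exists2 es', walk (basepoint G) es' v & size es' <= n.
Proof.
move=> w; pose e0 (p q : 'I_n.+1) := [exists e : arcT G, (src e == p) && (tgt e == q)].
have [s ps Es] : exists2 s, path e0 (basepoint G) s & v = last (basepoint G) s.
  elim: es (basepoint G) w => [p ->|e es IH p [ep /IH[s ps ->]]]; first by exists [::].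
  have pe : e0 p (tgt e) by apply/existsP; exists e; rewrite ep !eqxx.
  by exists (tgt e :: s) => //; apply/andP; split.
move: Es; case/shortenP: ps => s' ps' us' _ ->.
have [|es' w' sz] := path_walk _ ps'.
  by move=> p q /existsP[e /andP[/eqP ep /eqP eq]]; exists e.
exists es' => //; rewrite sz -ltnS -[(size s').+1]/(size (basepoint G :: s')).
by rewrite -(card_uniqP us') (leq_trans (max_card _)) ?card_ord.
Qed.

Context (A : zmodType) (t : r.-tuple A).

Lemma decode_shift (e : arcT (decode t c)) : arc_shift e = zcomb t (arc_vec e).
Proof. by rewrite /arc_shift /arc_vec; case: e => i [] /=; rewrite zcombB. Qed.

Lemma decode_walk_shift es : walk_shift (G := decode t c) es = zcomb t (walk_vec es).
Proof.
rewrite /walk_shift; elim/last_ind: es => [|es e IH]; first by rewrite big_nil zcomb0.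
by rewrite -cats1 big_cat big_seq1 /= IH cats1 walk_vec_rcons zcombD decode_shift.
Qed.

Lemma code_generators_correct : core G ->
  generated_subgroup [set` [seq elt_of_code t x | x <- code_generators c]]%classic =
  recognized (decode t c).
Proof.
move=> cG; set S := [seq _ | _ <- _].
have SP := generated_subgroupP [set` S]%classic; have [S1 SM SV] := SP.
have sS x : x \in S -> generated_subgroup [set` S]%classic x by move=> sx B [_]; apply.
apply/seteqP; split.
  apply: generated_sub; first exact: recognized_subgroup.
  move=> x /= /mapP[y + ->]; rewrite mem_cat => /orP[/mapP[u]|/mapP[l lc ->]].
    rewrite mem_filter => /andP[/eqP u0 /walks_uptoP[es [q [w _ Eu]]]] ->.
    rewrite {}Eu in u0 *; have Eq : q = ord0 by apply: val_inj.
    rewrite /elt_of_code /= -decode_walk_shift; apply: recognized_walk.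
    by rewrite Eq in w.
  apply/recognizedE; exists [::], (zcomb t l); split=> //.
    by apply: span_mem; exact: map_f.
  by rewrite /walk_shift big_nil add0r.
have pwP (v : vertex (decode t c)) : exists es, [/\ walk (basepoint G) es v, size es <= n
    & (v = basepoint G -> es = [::])].
  case: (pselect (v = basepoint G)) => [->|nv]; first by exists [::].
  have [es [_ [w _ _]]] := cG v.
  by have [es' w' sz] := short_walk w; exists es'.
have [pw pwH] := choice pwP.
apply: (@recognized_sub_loops _ _ (decode t c) pw) => //.
- by move=> v; have [] := pwH v.
- by have [_ _] := pwH (basepoint G); apply.
- move=> e; apply: sS; rewrite walk_readingE decode_walk_shift.
  set es := _ ++ _; apply/mapP; exists (word es, walk_vec es) => //.
  rewrite mem_cat; apply/orP; left; apply/mapP.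
  exists (nat_of_ord (basepoint G), word es, walk_vec es) => //.
  have [w1 s1 _] := pwH (src e); have [w2 s2 _] := pwH (tgt e).
  rewrite mem_filter; apply/andP; split=> //.
  apply/walks_uptoP; exists es, (basepoint G); split=> //.
    by apply: (walk_catI w1); split=> //; apply: walk_invP.
  by rewrite size_cat /= size_rev size_map addnS ltnS leq_add.
move=> l; apply: (span_sub (L := [set l | generated_subgroup [set` S] (1%g, l)]%classic)).
  split=> [|a b Ha Hb|a Ha] //=.
  - by have := SM _ _ Ha Hb; rewrite fta_pairM mulg1.
  - by have := SV _ Ha; rewrite fta_pairV invg1.
move=> a /mapP[v vc ->]; apply: sS; apply/mapP; exists ([::], v) => //.
by rewrite mem_cat map_f ?orbT.
Qed.

End CodedAutomaton.

(** ** Products of generators *)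

Section Products.
Context (X : finType) (r : nat).
Local Notation elt := (elt_code X r).

Definition elt_reduce (x : elt) : elt := (free_reduction x.1, x.2).
Definition elt_mul (x y : elt) : elt := (free_reduction (x.1 ++ y.1), vec_add x.2 y.2).
Definition elt_inv (x : elt) : elt := (word_inv x.1, vec_opp x.2).

Definition products (s : seq elt) (k : nat) : seq elt :=
  iter k (fun l => l ++ flatten [seq [seq elt_mul x y | y <- s ++ map elt_inv s] | x <- l])
    [:: ([::], vec_zero r)].

Definition included (s s' : seq elt) (k : nat) : bool :=
  all (fun x => elt_reduce x \in products s' k) s.

Lemma productsS s k x : x \in products s k -> x \in products s k.+1.
Proof. by rewrite /products iterS mem_cat => ->. Qed.

Lemma products_mono s k k' x : k <= k' -> x \in products s k -> x \in products s k'.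
Proof.
move=> /subnK <- h; elim: (k' - k) => //= d IH; exact: productsS.
Qed.

Context (A : zmodType) (t : r.-tuple A).
Local Notation elt_of := (@elt_of_code X A r t).
Local Notation gen s := (generated_subgroup [set` map elt_of s]%classic).

Lemma elt_of_reduce x : elt_of (elt_reduce x) = elt_of x.
Proof.
congr pair; apply/fg_of_word_eqP.
by rewrite /= free_reduction_id // free_reduction_reduced.
Qed.

Lemma elt_of_mul x y : elt_of (elt_mul x y) = (elt_of x * elt_of y)%g.
Proof.
rewrite fta_pairM -fg_of_word_cat -zcombD; congr pair; apply/fg_of_word_eqP.
by rewrite /= free_reduction_id // free_reduction_reduced.
Qed.

Lemma elt_of_inv x : elt_of (elt_inv x) = ((elt_of x)^-1)%g.
Proof. by rewrite fta_pairV -fg_of_word_inv -zcombN. Qed.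

Lemma elt_of_one : elt_of ([::], vec_zero r) = 1%g.
Proof. by rewrite /elt_of_code zcomb0. Qed.

Lemma products_generated s k x : x \in products s k -> gen s (elt_of x).
Proof.
have [S1 SM SV] := generated_subgroupP [set` map elt_of s]%classic.
elim: k x => [|k IH] x; first by rewrite inE => /eqP ->; rewrite elt_of_one.
rewrite /products iterS -/(products s k) mem_cat => /orP[/IH //|].
move=> /flattenP[_ /mapP[y /IH Hy ->] /mapP[z + ->]]; rewrite elt_of_mul.
rewrite mem_cat => /orP[sz|/mapP[z' sz ->]]; apply: SM => //.
  by move=> B [_]; apply; exact: map_f.
by rewrite elt_of_inv; apply: SV => B [_]; apply; exact: map_f.
Qed.

(** The injectivity turns an equality of elements into an equality of codes. *)
Lemma generated_products s x : injective (zcomb t) -> freely_reduced x.1 ->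
  gen s (elt_of x) -> exists k, x \in products s k.
Proof.
move=> t_inj red; pose letters := s ++ map elt_inv s.
pose P := [set h : free_times_ab X A | exists2 l, all (mem letters) l
   & h = (\prod_(y <- l) elt_of y)%g]%classic.
have PP : is_subgroup P.
  split=> [|g h [l hl ->] [l' hl' ->]|g [l hl ->]].
  - by exists [::]; rewrite // big_nil.
  - by exists (l ++ l'); rewrite ?all_cat ?hl // big_cat.
  - exists (rev (map elt_inv l)).
      rewrite all_rev all_map; apply: sub_all hl => y; rewrite /letters /= !mem_cat.
      case/orP=> [sy|/mapP[z sz ->]]; first by rewrite map_f ?orbT.
      by rewrite /elt_inv /= word_invK; apply/orP; left; case: z sz => w v sz /=;
        rewrite (_ : vec_opp (vec_opp v) = v) //; apply: eq_from_tnth => i;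
        rewrite !tnth_mktuple opprK.
    elim: l {hl} => [|y l IH]; first by rewrite !big_nil invg1.
    by rewrite big_cons invgM rev_cons -cats1 big_cat IH big_seq1 elt_of_inv.
move=> /(generated_sub (C := P) PP)[|l hl E].
  move=> _ /= /mapP[y sy ->]; exists [:: y]; last by rewrite big_seq1.
  by rewrite /= mem_cat sy.
suff [y [yP Ey redy]] : exists y, [/\ y \in products s (size l),
    elt_of y = (\prod_(y <- l) elt_of y)%g & freely_reduced y.1].
  exists (size l); suff -> : x = y by [].
  have Exy : elt_of x = elt_of y by rewrite Ey E.
  have E1 := congr1 (fun z : free_times_ab X A => fg_word z.1) Exy.
  have E2 := t_inj _ _ (congr1 snd Exy).
  case: x y red redy E1 E2 {E Ey yP Exy} => [w v] [w' v'] /= red red' E1 ->.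
  by move: E1; rewrite !free_reduction_id // => ->.
elim/last_ind: l hl {E} => [_|l z IH].
  by exists ([::], vec_zero r); rewrite big_nil mem_seq1 elt_of_one.
rewrite -cats1 all_cat => /andP[/IH[y [yP Ey _]]]; rewrite all_seq1 => hz.
exists (elt_mul y z); rewrite cats1 size_rcons; split.
- rewrite /products iterS -/(products s _) mem_cat; apply/orP; right.
  by apply/flattenP; exists [seq elt_mul y z' | z' <- letters]; rewrite ?map_f //;
    apply/mapP; exists y.
- by rewrite elt_of_mul -cats1 big_cat big_seq1 Ey.
- exact: free_reduction_reduced.
Qed.

Lemma included_sub s s' k : included s s' k -> (gen s `<=` gen s')%classic.
Proof.
move=> /allP h; apply: generated_sub; first exact: generated_subgroupP.
by move=> _ /= /mapP[x sx ->]; rewrite -elt_of_reduce; apply: products_generated (h _ sx).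
Qed.

Lemma included_mono s s' k k' : k <= k' -> included s s' k -> included s s' k'.
Proof. by move=> lek; apply: sub_all => x; exact: products_mono. Qed.

Lemma included_exists s s' : injective (zcomb t) -> (gen s `<=` gen s')%classic ->
  exists k, included s s' k.
Proof.
move=> t_inj sub.
have : forall x, x \in s -> exists k, elt_reduce x \in products s' k.
  move=> x sx; apply: generated_products => //=; first exact: free_reduction_reduced.
  by rewrite elt_of_reduce; apply: sub => B [_]; apply; exact: map_f.
rewrite /included; elim: s {sub} => [|x s IH] h; first by exists 0.
have [|k hk] := IH; first by move=> y sy; apply: h; rewrite inE sy orbT.
have [k' hk'] := h x (mem_head _ _); exists (maxn k k') => /=.
rewrite (products_mono _ hk') ?leq_maxr //=.
by apply: included_mono hk; rewrite leq_maxl.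
Qed.

End Products.

(** ** Recognizing normalized codes *)

Section NormalCodes.
Context (X : finType) (le : rel (X + X)) (r : nat).
Local Notation vec := (r.-tuple int).

(** A tree certificate lists the arcs of the ordered tree as triples (source,
    label, target), in the order in which they are found; the vertices are assumed
    to be numbered in that same order. *)
Definition tree_certificate : Type := seq (nat * (X + X) * nat).

Definition arc_triple (a : arc_data X r) : nat * (X + X) * nat :=
  (a.1.1.1, a.1.1.2, a.2).

Definition tree_step (arcs : seq (arc_data X r)) (s : nat * (X + X) * nat) : bool :=
  [&& s.1.1 < s.2, has (fun a => arc_triple a == s) arcs,
      all (fun a => (a.1.1.1 < s.1.1) ==> (a.2 < s.2)) arcs
    & all (fun a => (a.1.1.1 == s.1.1) && (s.2 <= a.2) ==> le s.1.2 a.1.1.2) arcs].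

Definition core_check (ws : seq (walk_data X r)) (v : nat) : bool :=
  has (fun u1 => has (fun u2 => [&& u1.1.1 == v, u2.1.1 == v
    & free_reduction (u1.1.2 ++ word_inv u2.1.2) == u1.1.2 ++ word_inv u2.1.2]) ws) ws.

Definition normal_code (c : automaton_code X r) (tr : tree_certificate) (k : nat) : bool :=
  [&& all (fun e => [&& e.1.1.1.1 <= c.1.1, e.2 <= c.1.1 & e.1.1.1.2 == vec_zero r]) c.1.2,
      uniq [seq (e.1.1.1.1, e.1.1.2) | e <- c.1.2],
      uniq [seq (e.2, e.1.1.2) | e <- c.1.2],
      [seq s.2 | s <- tr] == iota 1 c.1.1,
      all (tree_step (code_arcs c)) tr,
      all (fun a => (arc_triple a \in tr) ==> (a.1.2 == vec_zero r)) (code_arcs c)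
    & all (core_check (walks_upto c k)) (iota 0 c.1.1.+1)].

Lemma free_reduction_eq (w : seq (X + X)) : (free_reduction w == w) = freely_reduced w.
Proof.
apply/eqP/idP => [<-|]; [exact: free_reduction_reduced | exact: free_reduction_id].
Qed.

Lemma tree_stage_NoDup (G : automaton X) vs T : tree_stage le (G := G) vs T -> List.NoDup vs.
Proof.
elim=> [|{}vs {}T e _ IH [vs1 [vs2 [_ nt _ _]]]].
  by constructor; [move=> [] | constructor].
rewrite -cats1; apply: List.NoDup_app => //; first by constructor; [move=> [] | constructor].
by move=> x hx [Ex|//]; apply: nt; rewrite Ex.
Qed.

Lemma NoDup_uniq (T : eqType) (s : seq T) : List.NoDup s <-> uniq s.
Proof.
elim: s => [|x s IH] /=; first by split=> // _; constructor.
split=> [h|/andP[xs us]].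
  inversion h as [|y l xs us]; subst; apply/andP; split; last by apply/IH.
  by apply/negP => /In_mem.
by constructor; [move/In_mem; apply/negP | apply/IH].
Qed.

Lemma walks_upto_mono (c : automaton_code X r) k k' u :
  k <= k' -> u \in walks_upto c k -> u \in walks_upto c k'.
Proof.
move=> lek /walks_uptoP[es [q [w sz ->]]]; apply/walks_uptoP.
by exists es, q; split=> //; exact: leq_trans sz lek.
Qed.

Lemma core_check_mono (c : automaton_code X r) k k' v : k <= k' ->
  core_check (walks_upto c k) v -> core_check (walks_upto c k') v.
Proof.
move=> lek /hasP[u1 h1 /hasP[u2 h2 h]].
apply/hasP; exists u1; first exact: walks_upto_mono h1.
by apply/hasP; exists u2; first exact: walks_upto_mono h2.
Qed.

Lemma normal_code_mono (c : automaton_code X r) tr k k' :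
  k <= k' -> normal_code c tr k -> normal_code c tr k'.
Proof.
move=> lek /and5P[h1 h2 h3 h4 /and3P[h5 h6 h7]].
apply/and5P; split=> //; apply/and3P; split=> //.
by apply: sub_all h7 => v; exact: core_check_mono.
Qed.

Section Soundness.
Context (c : automaton_code X r) (tr : tree_certificate) (k : nat).
Local Notation n := c.1.1.
Local Notation G := (decode_skeleton c).
Hypothesis leT : total_order le.
Hypothesis ok : normal_code c tr k.

Lemma normal_code_deterministic : deterministic G.
Proof.
have /and4P[/allP bnd u1 u2 _] := ok.
have bndE (e : arcT G) : [&& (arc_entry e).1.1.1.1 <= n, (arc_entry e).2 <= n
   & (arc_entry e).1.1.1.2 == vec_zero r] by apply: bnd; exact: mem_tnth.
have inj p q : p <= n -> q <= n -> inord p = inord q :> 'I_n.+1 -> p = q.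
  by move=> hp hq /(congr1 val); rewrite /= !inordK.
have uq (T : eqType) (f : nat * vec * X * vec * nat -> T) i j : uniq [seq f e | e <- c.1.2] ->
    f (tnth (in_tuple c.1.2) i) = f (tnth (in_tuple c.1.2) j) -> i = j.
  move=> uf; set e0 := tnth _ i => Ef; apply: val_inj => /=; apply/eqP.
  have szi : nat_of_ord i < size [seq f e | e <- c.1.2] by rewrite size_map.
  have szj : nat_of_ord j < size [seq f e | e <- c.1.2] by rewrite size_map.
  rewrite -(nth_uniq (f e0) szi szj uf) !(nth_map e0) ?ltn_ord //.
  have Etn (l : 'I_(size c.1.2)) : nth e0 c.1.2 l = tnth (in_tuple c.1.2) l.
    by rewrite (tnth_nth e0).
  by rewrite !Etn -/e0 Ef.
move=> [i b] [i' b'] El Es.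
have /andP[p1 /andP[q1 _]] := bndE (i, b); have /andP[p2 /andP[q2 _]] := bndE (i', b').
have Eb : b = b' by move: El; case: (b) (b') => [] [].
subst b'; congr pair.
have Ex : (arc_entry (i, b)).1.1.2 = (arc_entry (i', b)).1.1.2.
  by move: El; rewrite /=; case: (b) => -[].
suff [Ep|Eq] : (arc_entry (i, b)).1.1.1.1 = (arc_entry (i', b)).1.1.1.1 \/
    (arc_entry (i, b)).2 = (arc_entry (i', b)).2.
- apply: (uq _ (fun e => (e.1.1.1.1, e.1.1.2)) i i' u1).
  by rewrite -/(arc_entry (i, b)) -/(arc_entry (i', b)) Ep Ex.
- apply: (uq _ (fun e => (e.2, e.1.1.2)) i i' u2).
  by rewrite -/(arc_entry (i, b)) -/(arc_entry (i', b)) Eq Ex.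
by case: (b) Es p1 q1 p2 q2 => -[] /= /inj h p1 q1 p2 q2; [left|right|right|left]; apply: h.
Qed.

Lemma normal_code_core : core G.
Proof.
have /and4P[_ _ _ /and4P[_ _ _ /allP chk]] := ok.
move=> v; have /chk/hasP[u1 /walks_uptoP[es1 [q1 [w1 _ ->]]]] : nat_of_ord v \in iota 0 n.+1.
  by rewrite mem_iota add0n ltn_ord.
move=> /hasP[u2 /walks_uptoP[es2 [q2 [w2 _ ->]]]] /and3P[/eqP /= /val_inj E1 /eqP /val_inj E2].
rewrite free_reduction_eq => red; subst q1 q2.
exists es1, (walk_inv es2); split=> //; first exact: walk_invP.
by apply: reduced_walk_word; rewrite map_cat lab_walk_inv.
Qed.

Lemma arc_data_record a : a \in code_arcs c -> exists e : arcT G,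
  [/\ nat_of_ord (src e) = a.1.1.1, lab e = a.1.1.2, arc_vec e = a.1.2 & nat_of_ord (tgt e) = a.2].
Proof. by move=> /code_arcsP[e ->]; exists e. Qed.

Lemma In_inord (v : 'I_n.+1) m : m <= n.+1 ->
  List.In v [seq inord i | i <- iota 0 m] <-> v < m.
Proof.
move=> lem; rewrite In_map; split=> [[i /In_mem]|ltv].
  rewrite mem_iota add0n /= => lti <-; rewrite inordK //; exact: leq_trans lti lem.
by exists (nat_of_ord v); [apply/In_mem; rewrite mem_iota | rewrite inord_val].
Qed.

(** As the vertices are numbered in the order in which the tree reaches them, the
    stage reached after m steps consists of the vertices 0, ..., m, and the test of
    the triple with target m+1 is that of the next tree arc. *)
Lemma normal_code_stage m : m <= n -> exists T,
  tree_stage le [seq (inord i : vertex G) | i <- iota 0 m.+1] T /\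
  forall e, T e -> arc_triple (arc_record e) \in tr \/ arc_triple (arc_record (ainv e)) \in tr.
Proof.
have /and4P[_ _ _ /and4P[/eqP Etr /allP stp _ _]] := ok.
elim: m => [|m IH] lem.
  exists set0; split=> //.
  have -> : [seq (inord i : vertex G) | i <- iota 0 1] = [:: basepoint G].
    by congr cons; apply: val_inj; rewrite /= inordK.
  exact: tree_stage0.
have [T [h hT]] := IH (ltnW lem).
have : m.+1 \in [seq s.2 | s <- tr] by rewrite Etr mem_iota add1n.
move=> /mapP[s str Es]; have := stp _ str.
move=> /and4P[lt_s /hasP[a /arc_data_record[e [se le_ de te]] /eqP Ea] /allP old /allP min].
rewrite -Ea in str lt_s Es old min; rewrite /= in lt_s Es old min.
have {Ea}Ea : arc_triple (arc_record e) = arc_triple a 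
  by rewrite -[LHS]/(nat_of_ord (src e), lab e, nat_of_ord (tgt e)) se le_ te.
rewrite -Es in te lt_s old min.
have te' : tgt e = inord m.+1 by apply: ord_inj; rewrite te inordK.
exists (T `|` [set e] `|` [set ainv e])%classic; split; last first.
  by move=> f [[/hT //|->]|->]; [left | right; rewrite ainvK]; rewrite Ea.
rewrite -addn1 iotaD map_cat cats1 add0n -te'; apply: tree_stageS => //.
have InE (v : vertex G) : List.In v [seq inord i | i <- iota 0 m.+1] <-> v < m.+1.
  by apply: In_inord; rewrite ltnS ltnW.
rewrite -se in lt_s old min.
exists [seq inord i | i <- iota 0 (src e)], [seq inord i | i <- iota (src e).+1 (m - src e)].
split.
- have -> : iota 0 m.+1 =
      iota 0 (src e) ++ nat_of_ord (src e) :: iota (src e).+1 (m - src e).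
    by rewrite -[_ :: _]/(iota (src e) (m - src e).+1) -subSn // -iotaD subnKC // ltnW.
  by rewrite map_cat /= inord_val.
- by move/InE; rewrite te ltnn.
- move=> f /(In_inord (src f) (ltnW (ltn_ord (src e)))) ltf; apply/InE.
  have /old : arc_record f \in code_arcs c by apply/code_arcsP; exists f.
  by rewrite -[(arc_record f).1.1.1]/(nat_of_ord (src f)) ltf.
move=> f Ef nf.
have /min : arc_record f \in code_arcs c by apply/code_arcsP; exists f.
rewrite -[(arc_record f).1.1.1]/(nat_of_ord (src f)) -[(arc_record f).2]/(nat_of_ord (tgt f)).
rewrite Ef eqxx le_; have -> // : m < tgt f.
by rewrite ltnNge; apply/negP => ltf; apply: nf; apply/InE.
Qed.

Lemma normal_code_normalized (A : zmodType) (t : r.-tuple A) : normalized le (decode t c).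
Proof.
have dG := normal_code_deterministic; have cG := normal_code_core.
have /and4P[/allP bnd _ _ /and4P[_ _ /allP dz _]] := ok.
have [T [h hT]] := normal_code_stage (leqnn n).
have zero1 (e : arcT (decode t c)) : positive (lab e) -> lab1 e = 0%R.
  case: e => i [] // _; rewrite /=.
  have /bnd/and3P[_ _ /eqP ->] := mem_tnth i (in_tuple c.1.2).
  exact: zcomb0.
split=> // e pe [vs [U [hU Ue]]].
have {Ue} /hT Te : T e.
  have [|sub _] := tree_stage_chain dG leT hU h; last exact: sub.
  rewrite size_map size_iota -[n.+1]card_ord.
  by rewrite -(card_uniqP (proj1 (NoDup_uniq _) (tree_stage_NoDup hU))); exact: max_card.
have shift0 (f : arcT (decode t c)) : arc_triple (arc_record f) \in tr -> arc_shift f = 0%R.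
  move=> ftr; have /dz : arc_record f \in code_arcs c by apply/code_arcsP; exists f.
  by rewrite ftr => /eqP /= E; rewrite decode_shift E zcomb0.
have : arc_shift e = 0%R.
  case: Te => [/shift0 //|/shift0]; rewrite arc_shiftV => /eqP.
  by rewrite oppr_eq0 => /eqP.
by rewrite /arc_shift zero1 // subr0.
Qed.

End Soundness.

(** The last parameter bounds the walks and the products that are tried. *)
Definition stallings_check (s : seq (elt_code X r))
    (y : automaton_code X r * tree_certificate * nat) : bool :=
  [&& normal_code y.1.1 y.1.2 y.2, included s (code_generators y.1.1) y.2
    & included (code_generators y.1.1) s y.2].

Lemma stallings_check_sound s y (A : zmodType) (t : r.-tuple A) : total_order le ->
  stallings_check s y -> normalized le (decode t y.1.1) /\
  recognized (decode t y.1.1) = sval (generated_by_codes t s).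
Proof.
move=> leT /and3P[ok i1 i2]; split; first exact: (normal_code_normalized leT ok).
rewrite -code_generators_correct; last exact: (normal_code_core ok).
by apply/seteqP; split; [exact: included_sub i2 | exact: included_sub i1].
Qed.

End NormalCodes.

(** ** Every finitely generated subgroup passes the check *)

Section FreeAbelian.
Context (r : nat).
Local Notation vec := (r.-tuple int).

Definition row_basis : r.-tuple 'rV[int]_r := [tuple delta_mx ord0 i | i < r].

Definition row_vec (v : 'rV[int]_r) : vec := [tuple v ord0 i | i < r].

Lemma zcomb_row_basis (z : vec) : zcomb row_basis z = (\row_i tnth z i)%R.
Proof.
apply/rowP => j; rewrite /zcomb summxE (bigD1 j) //= big1 ?addr0.
  by rewrite tnth_mktuple -scaler_int !mxE !eqxx mulr1 intz.
move=> i nij; rewrite tnth_mktuple -scaler_int !mxE eqxx /=.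
by rewrite eq_sym (negPf nij) mulr0.
Qed.

Lemma row_vecK v : zcomb row_basis (row_vec v) = v.
Proof. by rewrite zcomb_row_basis; apply/rowP => j; rewrite mxE tnth_mktuple. Qed.

Lemma zcomb_row_basis_inj : injective (zcomb row_basis).
Proof.
move=> z z'; rewrite !zcomb_row_basis => /rowP E.
by apply: eq_from_tnth => i; have := E i; rewrite !mxE.
Qed.

Lemma row_vec0 : row_vec 0%R = vec_zero r.
Proof. by apply: zcomb_row_basis_inj; rewrite row_vecK zcomb0. Qed.

Lemma row_fg_abelian : fg_abelian 'rV[int]_r.
Proof.
exists (tval row_basis); apply/seteqP; split=> // v _; rewrite -(row_vecK v).
have SP := generated_zsubgroupP [set` tval row_basis]%classic.
apply: (zsubgroup_sum _ SP) => i; apply: (zsubgroup_mulz _ SP).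
by apply: span_mem; exact: mem_tnth.
Qed.

End FreeAbelian.

Section Trace.
Context (X : finType) (le : rel (X + X)) (G : automaton X).
Hypotheses (dG : deterministic G) (cG : core G) (leT : total_order le).

Lemma tree_stage_trace vs T : tree_stage le (G := G) vs T ->
  exists tr : seq (arcT G), [/\ vs = basepoint G :: map (@tgt X G) tr,
    forall e, List.In e tr -> T e
    & forall tr1 e tr2, tr = tr1 ++ e :: tr2 ->
        next_tree_arc le (basepoint G :: map (@tgt X G) tr1) e].
Proof.
elim=> [|{}vs {}T e _ [tr [E trT nx]] ne]; first by exists [::]; split=> // -[].
exists (rcons tr e); split.
- by rewrite E map_rcons.
- by move=> f /In_rcons[/trT h|->]; [left; left | left; right].
move=> tr1 f tr2; case/lastP: tr2 => [|tr2 y].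
  by rewrite cats1 => /rcons_inj[<- <-]; rewrite -E.
by rewrite -rcons_cons -rcons_cat => /rcons_inj[/nx].
Qed.

Lemma full_tree_stage : finite_automaton G ->
  exists vs T, tree_stage le (G := G) vs T /\ forall v, List.In v vs.
Proof.
move=> [/finite_typeP[l hl] _].
suff [vs [T [h hvs]]] : exists vs T, tree_stage le (G := G) vs T /\
    forall v, List.In v l -> List.In v vs.
  by exists vs, T; split=> // v; exact: hvs.
elim: l {hl} => [|v l [vs [T [h hvs]]]].
  by exists [:: basepoint G], set0; split; first exact: tree_stage0.
have [es1 [_ [w _ _]]] := cG v.
have [us [U [hU vus]]] := tree_stage_reach dG leT w.
have [ws [W [hW _ _ sub sub']]] := tree_stage_join dG leT h hU.
by exists ws, W; split=> // u [<-|/hvs /sub //]; exact: sub'.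
Qed.

End Trace.

Lemma index_cat_lt (T : eqType) (v : T) ws rest :
  (v \in ws) = (index v (ws ++ rest) < size ws).
Proof.
rewrite index_cat; case: ifP => vws; first by rewrite index_mem vws.
by rewrite ltnNge leq_addr.
Qed.

Section Encoding.
Context (X : finType) (le : rel (X + X)) (r : nat).
Context (G : enriched X 'rV[int]_r).
Hypotheses (leT : total_order le) (nG : normalized le G) (finG : finite_automaton G).
Local Notation vec := (r.-tuple int).
Local Notation V := {classic vertex G}.
Local Notation word es := (map (@lab X _) es).

Definition letter (a : X + X) : X := match a with inl x => x | inr x => x end.

(** A stage of the ordered tree that contains all the vertices lists them in the
    order in which they are to be numbered, and the tree arcs met on the way form
    the certificate. The arcs of the code are then the records of the arcs of G
    ([codeP] below), so that walks on either side can be followed on the other. *)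
Lemma encode_automaton : exists (c : automaton_code X r) tr k,
  normal_code le c tr k /\ recognized (decode (row_basis r) c) = recognized G.
Proof.
have [[dG cG] pos1 tree2] := nG.
have [vs [T [hT allvs]]] := full_tree_stage dG cG leT finG.
have [tr [Evs trT nx]] := tree_stage_trace hT.
have trO e : List.In e tr -> ordered_tree le e by move=> /trT Te; exists vs, T.
have /finite_typeP[E allE] := finG.2.
have [ls Els] := zsubgroup_fg (row_fg_abelian r) (base_subgroupP G).
pose vsV : seq V := vs.
have uvs : uniq vsV by apply/NoDup_uniq; exact: tree_stage_NoDup hT.
have memvs v : v \in vsV by apply/In_mem; exact: allvs.
pose idx (v : V) : nat := index v vsV.
have idx_inj v w : idx v = idx w -> v = w.
  by move=> h; rewrite -(nth_index v (memvs v)) -(nth_index v (memvs w)) -/(idx v) h.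
pose n := size tr.
have szvs : size vsV = n.+1 by rewrite /vsV Evs /= size_map.
have idx_le v : idx v <= n by rewrite -ltnS -szvs index_mem.
have idx0 : idx (basepoint G) = 0 by rewrite /idx /vsV Evs /= eqxx.
pose E2 : seq {classic arcT G} := [seq e : {classic arcT G} <-
  undup (E : seq {classic arcT G}) | positive (lab (e : arcT G))].
have E2P (e : arcT G) : ((e : {classic arcT G}) \in E2) = positive (lab e).
  rewrite mem_filter mem_undup; have -> : (e : {classic arcT G}) \in (E : seq {classic arcT G}).
    by apply/In_mem; exact: allE.
  by rewrite andbT.
have uE2 : uniq E2 by rewrite filter_uniq // undup_uniq.
pose ent (e : {classic arcT G}) := (idx (src (e : arcT G)), vec_zero r, letter (lab (e : arcT G)),
  row_vec (lab2 (e : arcT G)), idx (tgt (e : arcT G))).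
pose c : automaton_code X r := (n, [seq ent e | e <- E2], map (@row_vec r) ls).
pose rec (e : arcT G) : arc_data X r := (idx (src e), lab e,
  (if positive (lab e) then vec_sub (row_vec (lab2 e)) (vec_zero r)
   else vec_sub (vec_zero r) (row_vec (lab1 e))), idx (tgt e)).
have clip_idx v : clip n (idx v) = idx v by rewrite /clip idx_le.
have pos_inl (e : arcT G) : positive (lab e) -> lab e = inl (letter (lab e)) by case: (lab e).
have entE e : positive (lab e) -> entry_arcs n (ent e) = [:: rec e; rec (ainv e)].
  move=> pe; rewrite /entry_arcs /rec /= !clip_idx src_ainv tgt_ainv lab_ainv lab1_ainv.
  by rewrite (pos_inl _ pe).
have codeP a : a \in code_arcs c <-> exists e, a = rec e.
  rewrite /code_arcs -map_comp; split.
    move=> /flattenP[_ /mapP[e + ->]]; rewrite E2P => pe.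
    by rewrite /= entE // !inE => /orP[] /eqP ->; [exists e | exists (ainv e)].
  move=> [e ->]; apply/flattenP; case pe: (positive (lab e)).
    exists (entry_arcs n (ent e)); last by rewrite entE // mem_head.
    by apply/mapP; exists e; rewrite ?E2P.
  have pe' : positive (lab (ainv e)) by rewrite lab_ainv; move: pe; case: (lab e).
  exists (entry_arcs n (ent (ainv e))); first by apply/mapP; exists (ainv e); rewrite ?E2P.
  by rewrite entE // ainvK !inE eqxx orbT.
pose D := decode (row_basis r) c.
have fwd e : exists e' : arcT D, arc_record (c := c) e' = rec e.
  have /code_arcsP[e' ->] : rec e \in code_arcs c by apply/codeP; exists e.
  by exists e'.
have bwd (e' : arcT D) : exists e, arc_record (c := c) e' = rec e.
  by apply/codeP/code_arcsP; exists e'.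
have recP (e' : arcT D) e : arc_record (c := c) e' = rec e ->
    [/\ nat_of_ord (src e') = idx (src e), lab e' = lab e,
      arc_shift e' = arc_shift e & nat_of_ord (tgt e') = idx (tgt e)].
  move=> h; have h1 := congr1 (fun a => a.1.1.1) h; have h2 := congr1 (fun a => a.1.1.2) h.
  have h3 := congr1 (fun a => a.1.2) h; have h4 := congr1 snd h.
  split=> //; rewrite decode_shift [arc_vec _]h3 /=; case: ifP => pe.
    by rewrite zcombB row_vecK zcomb0 /arc_shift pos1.
  have pe' : positive (lab (ainv e)) by rewrite lab_ainv; move: pe; case: (lab e).
  by rewrite zcombB row_vecK zcomb0 /arc_shift -[lab2 e]lab1_ainv (pos1 _ pe').
have wfwd p es q (p' : vertex D) : walk p es q -> nat_of_ord p' = idx p ->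
    exists es' (q' : vertex D), [/\ walk p' es' q', nat_of_ord q' = idx q,
      word es' = word es & walk_shift es' = walk_shift es].
  elim: es p p' => [|e es IH] p p'.
    by move=> /= -> Ep; exists [::], p'; rewrite /walk_shift !big_nil.
  move=> [<- w] Ep; have [e' /recP[Es El Eh Et]] := fwd e.
  have [es' [q' [w' Eq Ew Eh']]] := IH _ _ w Et.
  exists (e' :: es'), q'; split=> //.
  - by split=> //; apply: ord_inj; rewrite Es Ep.
  - exact: (congr2 cons El Ew).
  - by rewrite /walk_shift !big_cons Eh; congr (_ + _)%R; exact: Eh'.
have wbwd (p' : vertex D) es' (q' : vertex D) p : walk p' es' q' -> nat_of_ord p' = idx p ->
    exists es q, [/\ walk p es q, nat_of_ord q' = idx q,
      word es' = word es & walk_shift es' = walk_shift es].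
  elim: es' p p' => [|e' es' IH] p p'.
    by move=> /= <- Ep; exists [::], p; rewrite /walk_shift !big_nil.
  move=> [<- w] Ep; have [e /recP[Es El Eh Et]] := bwd e'.
  have [es [q [w' Eq Ew Eh']]] := IH _ _ w Et.
  exists (e :: es), q; split=> //.
  - by split=> //; apply: idx_inj; rewrite -Es Ep.
  - exact: (congr2 cons El Ew).
  - by rewrite /walk_shift !big_cons Eh; congr (_ + _)%R; exact: Eh'.
have EL : base_subgroup D = base_subgroup G.
  have Ez : [seq zcomb (row_basis r) l | l <- c.2] = ls.
    by rewrite -map_comp -[RHS]map_id; apply: eq_map => v /=; exact: row_vecK.
  rewrite Els -[X in _ = generated_zsubgroup [set` X]%classic]Ez; reflexivity.
have ED : recognized D = recognized G.
  apply/seteqP; split=> h /recognizedE[es [l [w Ll ->]]]; apply/recognizedE.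
    have [es' [q [w' Eq -> ->]]] := wbwd _ _ _ _ w (esym idx0).
    exists es', l; split=> //; last by rewrite -EL.
    have Eb : q = basepoint G by apply: idx_inj; rewrite -Eq idx0.
    by subst q.
  have [es' [q [w' Eq <- <-]]] := wfwd _ _ _ (basepoint D) w (esym idx0).
  exists es', l; split=> //; last by rewrite EL.
  have Eb : q = basepoint D by apply: ord_inj; rewrite Eq idx0.
  by subst q.
pose trc : tree_certificate X := [seq (idx (src e), lab e, idx (tgt e)) | e <- tr].
(* The bound on the lengths has to serve all the vertices. *)
have [k hk] : exists k, all (core_check (walks_upto c k)) (iota 0 n.+1).
  have : forall v, v \in iota 0 n.+1 -> exists k, core_check (walks_upto c k) v.
    move=> v; rewrite mem_iota add0n /= => ltv.
    pose u := nth (basepoint G : V) vsV v.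
    have Eu : idx u = v by rewrite /idx index_uniq ?szvs.
    have [es1 [es2 [w1 w2 red]]] := cG u.
    have [f1 [q1 [wf1 Eq1 Ew1 _]]] := wfwd _ _ _ (basepoint D) w1 (esym idx0).
    have [f2 [q2 [wf2 Eq2 Ew2 _]]] := wfwd _ _ _ (basepoint D) (walk_invP w2) (esym idx0).
    exists (maxn (size f1) (size f2)); apply/hasP.
    exists (nat_of_ord q1, word f1, walk_vec (c := c) f1).
      by apply/walks_uptoP; exists f1, q1; rewrite leq_maxl.
    apply/hasP; exists (nat_of_ord q2, word f2, walk_vec (c := c) f2).
      by apply/walks_uptoP; exists f2, q2; rewrite leq_maxr.
    apply/and3P; split; try by rewrite /= ?Eq1 ?Eq2 Eu.
    rewrite free_reduction_eq -[X in word_inv X]/(word f2) -[X in X ++ _]/(word f1).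
    rewrite Ew1 Ew2 lab_walk_inv word_invK -map_cat.
    exact (freely_reduced_walk dG (walk_catI w1 w2) red).
  elim: (iota 0 n.+1) => [|v s IH] h; first by exists 0.
  have [|k hk] := IH; first by move=> w sw; apply: h; rewrite inE sw orbT.
  have [k' hk'] := h v (mem_head _ _); exists (maxn k k') => /=.
  rewrite (core_check_mono _ hk') ?leq_maxr //=.
  by apply: sub_all hk => w; apply: core_check_mono; rewrite leq_maxl.
exists c, trc, k; split=> //.
have memtr e : List.In e tr -> exists tr1 tr2, tr = tr1 ++ e :: tr2 by exact: List.in_split.
apply/and5P; split; last (apply/and3P; split=> //).
- apply/allP => _ /mapP[e _ ->]; by rewrite /= !idx_le eqxx.
- rewrite -map_comp map_inj_in_uniq // => e e'; rewrite !E2P => pe pe' [/idx_inj Es El].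
  apply: dG; last by left.
  by rewrite (pos_inl _ pe) (pos_inl _ pe') El.
- rewrite -map_comp map_inj_in_uniq // => e e'; rewrite !E2P => pe pe' [/idx_inj Es El].
  apply: dG; last by right.
  by rewrite (pos_inl _ pe) (pos_inl _ pe') El.
- rewrite -map_comp; apply/eqP.
  have Ei : map idx vsV = iota 0 n.+1.
    apply: (@eq_from_nth _ 0); rewrite ?size_map ?size_iota // => i lti.
    by rewrite (nth_map (basepoint G : V)) // /idx index_uniq // nth_iota // -szvs.
  have := congr1 behead Ei; rewrite /vsV Evs /= -map_comp => <-.
  by apply: eq_map.
- apply/allP => _ /In_mem/In_map[e /memtr[tr1 [tr2 Etr]] <-].
  pose ws : seq V := basepoint G :: map (@tgt X G) tr1.
  have Ews : vsV = ws ++ (tgt e :: map (@tgt X G) tr2 : seq V).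
    by rewrite /vsV Evs Etr map_cat.
  have inws v : List.In v ws <-> idx v < size ws.
    by rewrite (@In_mem {classic vertex G}) /idx Ews -index_cat_lt.
  have idxt : idx (tgt e) = size ws.
    rewrite /idx Ews index_cat; case: ifP => [/In_mem tws|_]; last by rewrite /= eqxx addn0.
    by have [? [? [_ nt _ _]]] := nx _ _ _ Etr; case: nt.
  have [vs1 [vs2 [E1 nt old min]]] := nx _ _ _ Etr.
  have Ews1 : vsV = (vs1 : seq V) ++ (src e :: vs2 : seq V) ++
      (tgt e :: map (@tgt X G) tr2 : seq V).
    by rewrite Ews /ws E1 -catA.
  have in1 v : List.In v vs1 <-> idx v < size vs1.
    by rewrite (@In_mem {classic vertex G}) /idx Ews1 -index_cat_lt.
  have idxs : idx (src e) = size vs1.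
    rewrite /idx Ews1 index_cat; case: ifP => [/In_mem|_]; last by rewrite /= eqxx addn0.
    by move=> /old.
  have sws : size ws = (size vs1 + (size vs2).+1)%N by rewrite /ws E1 size_cat.
  apply/and4P; rewrite /= idxs idxt; split.
  + by rewrite sws addnS ltnS leq_addr.
  + apply/hasP; exists (rec e); first by apply/codeP; exists e.
    by rewrite /arc_triple /= idxs idxt.
  + apply/allP => _ /codeP[f ->]; apply/implyP => /= /in1/old.
    by move/inws.
  + apply/allP => _ /codeP[f ->]; apply/implyP => /= /andP[/eqP Es].
    rewrite leqNgt => nlt; apply: min; first by apply: idx_inj; rewrite Es idxs.
    by move/inws; apply/negP.
- apply/allP => _ /codeP[f ->]; apply/implyP => /In_mem/In_map[e etr].
  rewrite /arc_triple /= => -[/idx_inj Es El _].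
  have {e Es El} etr : List.In f tr by have -> : f = e by apply: dG; [|left].
  have fT := trO _ etr; case: ifP => pf.
    rewrite (tree2 _ pf fT) row_vec0; apply/eqP/zcomb_row_basis_inj.
    by rewrite zcombB zcomb0 subr0.
  have pf' : positive (lab (ainv f)) by rewrite lab_ainv; move: pf; case: (lab f).
  rewrite -[lab1 f]lab2_ainv (tree2 _ pf' (ordered_tree_ainv fT)) row_vec0.
  by apply/eqP/zcomb_row_basis_inj; rewrite zcombB zcomb0 subr0.
Qed.

End Encoding.

(** Words and integer vectors can be compared, whereas equality in A may be out of
    reach; so the subgroup is first considered in the product of the free group
    with Z^r, and its normalized automaton there is encoded. *)
Lemma stallings_check_complete (X : finType) (le : rel (X + X)) r (s : seq (elt_code X r)) :
  total_order le -> exists y, stallings_check le s y.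
Proof.
move=> leT; have HP := svalP (generated_by_codes (row_basis r) s).
have [G nG EG] := subgroup_automaton leT HP.
have finG : finite_automaton G by have [rG _ _] := nG; exact: fg_finite_automaton rG EG.
have [c [tr [k [ok Ec]]]] := encode_automaton leT nG finG.
have Eg := code_generators_correct (row_basis r) (normal_code_core ok).
rewrite Ec EG in Eg.
have [||k1 h1] := @included_exists X r _ (row_basis r) s (code_generators c).
- exact: zcomb_row_basis_inj.
- by rewrite Eg.
have [||k2 h2] := @included_exists X r _ (row_basis r) (code_generators c) s.
- exact: zcomb_row_basis_inj.
- by rewrite Eg.
exists (c, tr, maxn k (maxn k1 k2)); apply/and3P; split.
- by apply: normal_code_mono ok; rewrite leq_maxl.
- by apply: included_mono h1; rewrite /= leq_max leq_maxl orbT.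
by apply: included_mono h2; rewrite /= leq_max leq_maxr orbT.
Qed.

(** ** The programs are computable *)

(** Each of these lemmas reads off the outermost operation of the function. *)
Ltac comp_step := first
  [ eassumption
  | exact: computable_const
  | exact: computable_id
  | exact: computable_fst
  | exact: computable_snd
  | apply: computable_fst_of
  | apply: computable_snd_of
  | apply: computable_pair
  | apply: computable_cons
  | apply: computable_cat
  | apply: computable_flatten
  | apply: computable_map
  | apply: computable_filter
  | apply: computable_all
  | apply: computable_has
  | apply: computable_mem
  | apply: computable_uniq
  | apply: computable_iota
  | apply: computable_foldr
  | apply: computable_iter
  | apply: computable_implb
  | apply: computable_and
  | apply: computable_leq
  | apply: computable_eq_of
  | apply: computable_succ
  | apply: computable_add
  | apply: computable_sub ].

(** Functional arguments give rise to goals about functions of several arguments,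
    which are unfolded into functions of a tuple. *)
Ltac comp := repeat (rewrite /computable2 /computable3; cbv beta; comp_step).

Lemma computable_addz : computable2 (fun m n : int => (m + n)%R).
Proof.
apply: (@computable_ext _ _ (fun p : int * int =>
  match p.1 with
  | Posz a => match p.2 with
    | Posz b => Posz (a + b)
    | Negz b => if b.+1 <= a then Posz (a - b.+1) else Negz (b - a) end
  | Negz a => match p.2 with
    | Posz b => if a.+1 <= b then Posz (b - a.+1) else Negz (a - b)
    | Negz b => Negz (a + b).+1 end
  end)).
  by case=> -[a|a] [b|b].
apply: computable_int_case; first exact: computable_fst.
  apply: computable_int_case; first by comp.
    by apply: (computable_comp computable_Posz); comp.
  apply: computable_if; first by comp.
    by apply: (computable_comp computable_Posz); comp.
  by apply: (computable_comp computable_Negz); comp.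
apply: computable_int_case; first by comp.
  apply: computable_if; first by comp.
    by apply: (computable_comp computable_Posz); comp.
  by apply: (computable_comp computable_Negz); comp.
by apply: (computable_comp computable_Negz); comp.
Qed.

Lemma computable_oppz : computable (fun m : int => (- m)%R).
Proof.
apply: (@computable_ext _ _ (fun m : int =>
  match m with
  | Posz a => if a == 0 then Posz 0 else Negz (a - 1)
  | Negz a => Posz a.+1 end)).
  by case=> [[|a]|a] //=; rewrite subn1.
apply: computable_int_case; first exact: computable_id.
  apply: computable_if; [by comp | by comp |].
  by apply: (computable_comp computable_Negz); comp.
by apply: (computable_comp computable_Posz); comp.
Qed.

Section VectorPrograms.
Context (r : nat).
Local Notation vec := (r.-tuple int).

Lemma computable_mktuple (S : countType) (f : S -> nat -> int) :
  computable2 f -> computable (fun x => [tuple f x i | i < r]).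
Proof.
move=> cf; apply: computable_tuple.
apply: (@computable_ext _ _ (fun x => [seq f x i | i <- iota 0 r])).
  by move=> x; rewrite /= -val_enum_ord -map_comp.
by comp.
Qed.

Lemma computable_vec_add : computable2 (@vec_add r).
Proof.
apply: (@computable_ext _ _ (fun p : vec * vec =>
   [tuple (nth 0%R (tval p.1) i + nth 0%R (tval p.2) i)%R | i < r])).
  move=> p; apply: eq_from_tnth => i; rewrite !tnth_mktuple.
  by rewrite !(tnth_nth 0%R).
apply: (@computable_mktuple _ (fun p i => (nth 0 (tval p.1) i + nth 0 (tval p.2) i)%R)).
apply: (computable_app2 computable_addz); apply: computable_nth; try by comp.
  by apply: (computable_comp (@computable_tval _ _)); comp.
by apply: (computable_comp (@computable_tval _ _)); comp.
Qed.

Lemma computable_vec_opp : computable (@vec_opp r).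
Proof.
apply: (@computable_ext _ _ (fun u : vec => [tuple (- nth 0%R (tval u) i)%R | i < r])).
  by move=> u; apply: eq_from_tnth => i; rewrite !tnth_mktuple !(tnth_nth 0%R).
apply: (@computable_mktuple _ (fun u i => (- nth 0 (tval u) i)%R)).
apply: (computable_comp computable_oppz).
by apply: computable_nth; [apply: (computable_comp (@computable_tval _ _)) |]; comp.
Qed.

Lemma computable_vec_sub : computable2 (@vec_sub r).
Proof.
apply: (computable_app2 computable_vec_add); first by comp.
by apply: (computable_comp computable_vec_opp); comp.
Qed.

End VectorPrograms.

Section WordPrograms.
Context (X : finType).

Lemma computable_linv (S : countType) (f : S -> (X + X)%type) :
  computable f -> computable (fun x => linv (f x)).
Proof. by apply: computable_comp; exact: computable_fin. Qed.

Lemma computable_free_reduction (S : countType) (w : S -> seq (X + X)) :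
  computable w -> computable (fun x => free_reduction (w x)).
Proof.
move=> cw; apply: computable_foldr => //; first by comp.
apply: computable_seq_case; first by comp.
  by comp.
apply: computable_if.
- by apply: computable_eq_of; [|apply: computable_linv]; comp.
- by comp.
by comp.
Qed.

Lemma computable_word_inv (S : countType) (w : S -> seq (X + X)) :
  computable w -> computable (fun x => word_inv (w x)).
Proof.
move=> cw; apply: (computable_comp (@computable_rev _)).
by apply: computable_map => //; apply: computable_linv; comp.
Qed.

Lemma computable_rcons (S T : countType) (l : S -> seq T) (a : S -> T) :
  computable l -> computable a -> computable (fun x => rcons (l x) (a x)).
Proof.
move=> cl ca; apply: (@computable_ext _ _ (fun x => l x ++ [:: a x])).
  by move=> x; rewrite cats1.
by comp.
Qed.

End WordPrograms.

Section Programs.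
Context (X : finType) (le : rel (X + X)) (r : nat).
Local Notation code := (automaton_code X r).

Lemma computable_code_arcs : computable (@code_arcs X r).
Proof.
have cclip : computable2 clip.
  by apply: computable_if; comp.
have csub := computable_vec_sub r.
apply: computable_flatten; apply: computable_map; first by comp.
apply: computable_cons; last (apply: computable_cons; last by comp).
  apply: computable_pair; last by apply: (computable_app2 cclip); comp.
  apply: computable_pair; last by apply: (computable_app2 csub); comp.
  apply: computable_pair; first by apply: (computable_app2 cclip); comp.
  by apply: (computable_comp (@computable_inl _ _)); comp.
apply: computable_pair; last by apply: (computable_app2 cclip); comp.
apply: computable_pair; last by apply: (computable_app2 csub); comp.
apply: computable_pair; first by apply: (computable_app2 cclip); comp.
by apply: (computable_comp (@computable_inr _ _)); comp.
Qed.

Lemma computable_walks_upto : computable2 (@walks_upto X r).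
Proof.
apply: computable_iter; [by comp | by comp |].
apply: computable_cat; first by comp.
apply: computable_flatten; apply: computable_map; first by comp.
apply: computable_map.
  apply: computable_filter; first by apply: (computable_comp computable_code_arcs); comp.
  by comp.
apply: computable_pair; last by apply: (computable_app2 (computable_vec_add r)); comp.
apply: computable_pair; first by comp.
by apply: computable_rcons; comp.
Qed.

Lemma computable_code_generators : computable (@code_generators X r).
Proof.
apply: computable_cat; last by comp.
apply: computable_map; last by comp.
apply: computable_filter; last by comp.
by apply: (computable_app2 computable_walks_upto); comp.
Qed.

Lemma computable_products : computable2 (@products X r).
Proof.
apply: computable_iter; [by comp | by comp |].
apply: computable_cat; first by comp.
apply: computable_flatten; apply: computable_map; first by comp.
apply: computable_map.
  apply: computable_cat; first by comp.
  apply: computable_map; first by comp.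
  apply: computable_pair; first by apply: computable_word_inv; comp.
  by apply: (computable_comp (computable_vec_opp r)); comp.
apply: computable_pair; first by apply: computable_free_reduction; comp.
by apply: (computable_app2 (computable_vec_add r)); comp.
Qed.

Lemma computable_included (S : countType) (s s' : S -> seq (elt_code X r)) k :
  computable s -> computable s' -> computable k ->
  computable (fun x => included (s x) (s' x) (k x)).
Proof.
move=> cs cs' ck; apply: computable_all => //; apply: computable_mem.
  by apply: computable_pair; [apply: computable_free_reduction|]; comp.
by apply: (computable_app2 computable_products);
  [apply: (computable_comp cs') | apply: (computable_comp ck)]; comp.
Qed.

Lemma computable_tree_step : computable2 (@tree_step X le r).
Proof.
have cle : computable2 le by exact: computable_fin.
apply: computable_and; first by comp.
apply: computable_and; first by comp.
apply: computable_and; first by comp.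
apply: computable_all; first by comp.
apply: computable_implb; first by comp.
by apply: (computable_app2 cle); comp.
Qed.

Lemma computable_core_check : computable2 (@core_check X r).
Proof.
apply: computable_has; first by comp.
apply: computable_has; first by comp.
apply: computable_and; first by comp.
apply: computable_and; first by comp.
have c : computable (fun p : seq (walk_data X r) * nat * walk_data X r * walk_data X r =>
    p.1.2.1.2 ++ word_inv p.2.1.2).
  by apply: computable_cat; [|apply: computable_word_inv]; comp.
by apply: computable_eq_of; [apply: computable_free_reduction|]; exact: c.
Qed.

Lemma computable_normal_code : computable
  (fun y : code * tree_certificate X * nat => normal_code le y.1.1 y.1.2 y.2).
Proof.
rewrite /normal_code; apply: computable_and; first by comp.
apply: computable_and; first by comp.
apply: computable_and; first by comp.
apply: computable_and; first by comp.
apply: computable_and.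
  apply: computable_all; first by comp.
  apply: (computable_app2 computable_tree_step); last by comp.
  by apply: (computable_comp computable_code_arcs); comp.
apply: computable_and.
  apply: computable_all; first by apply: (computable_comp computable_code_arcs); comp.
  by comp.
apply: computable_all; first by comp.
apply: (computable_app2 computable_core_check); last by comp.
by apply: (computable_app2 computable_walks_upto); comp.
Qed.

Lemma computable_stallings_check : computable2 (@stallings_check X le r).
Proof.
have cg := computable_code_generators.
rewrite /computable2 /stallings_check; apply: computable_and.
  by apply: (computable_comp computable_normal_code); comp.
have cgy : computable (fun p : seq (elt_code X r) * (code * tree_certificate X * nat) =>
    code_generators p.2.1.1) by apply: (computable_comp cg); comp.
by apply: computable_and; apply: computable_included; first [exact cgy | comp].
Qed.

(** The search runs over the codes together with their certificates and bounds. *)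
Lemma computable_stallings : total_order le ->
  exists2 f : seq (elt_code X r) -> code, computable f &
    forall s, exists y, y.1.1 = f s /\ stallings_check le s y.
Proof.
move=> leT.
have dv : decodable (r.-tuple int) by apply: decodable_tuple; exact: decodable_int.
have dX := decodable_fin X; have dn := decodable_nat.
have dl : decodable (X + X)%type by exact: decodable_sum.
have [||f cf fP] := computable_search _ _ computable_stallings_check
  (fun s => stallings_check_complete s leT).
- by apply: decodable_seq; apply: decodable_pair => //; exact: decodable_seq.
- apply: decodable_pair => //; apply: decodable_pair.
    apply: decodable_pair; last exact: decodable_seq.
    apply: decodable_pair => //; apply: decodable_seq.
    by do !apply: decodable_pair => //.
  by apply: decodable_seq; do !apply: decodable_pair => //.
exists (fun s => (f s).1.1); last by move=> s; exists (f s).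
by do 2!apply: computable_fst_of.
Qed.

End Programs.

(** * The bijection *)

Section Bijection.
Context (X : finType) (A : zmodType) (le : rel (X + X)).
Hypothesis leT : total_order le.

Lemma iso_classP (G G' : enriched X A) : normalized le G ->
  iso_class le G G' <-> normalized le G' /\ recognized G' = recognized G.
Proof.
move=> nG; split=> -[nG' h]; split=> //.
  by rewrite (iso_mod_base_recognized h).
exact: (recognized_iso leT nG nG' (esym h)).
Qed.

(** A union over the class, all of whose terms are equal, in place of the choice of
    a representative. *)
Definition class_recognized (C : iso_classes A le) : set (free_times_ab X A) :=
  [set h | exists2 G, sval C G & recognized G h]%classic.

Lemma class_recognizedE (C : iso_classes A le) G : sval C G ->
  class_recognized C = recognized G.
Proof.
case: C => C [G0 nG0 EC] /= CG; subst C; move/(iso_classP _ nG0): (CG) => [_ EG].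
apply/seteqP; split=> [h [G' /(iso_classP _ nG0)[_ EG'] hG']|h hG]; last by exists G.
by rewrite EG -EG'.
Qed.

Lemma class_inhabited (C : iso_classes A le) :
  exists2 G, normalized le G & sval C G.
Proof.
case: C => C [G nG EC] /=; subst C; exists G => //.
by apply/(iso_classP _ nG).
Qed.

Lemma class_recognized_subgroup C : is_subgroup (class_recognized C).
Proof.
have [G _ CG] := class_inhabited C; rewrite (class_recognizedE CG).
exact: recognized_subgroup.
Qed.

Definition subgroup_of_class (C : iso_classes A le) : subgroups (free_times_ab X A) :=
  exist _ (class_recognized C) (class_recognized_subgroup C).

Definition recognizing (H : subgroups (free_times_ab X A)) (G : enriched X A) : Prop :=
  normalized le G /\ recognized G = sval H.

Lemma recognizing_class H :
  exists2 G : enriched X A, normalized le G & recognizing H = iso_class le G.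
Proof.
have [G nG EG] := subgroup_automaton leT (svalP H).
exists G => //; apply/funext => G'; apply/propext.
by rewrite (propext (iso_classP G' nG)) EG.
Qed.

Definition class_of_subgroup (H : subgroups (free_times_ab X A)) : iso_classes A le :=
  exist _ (recognizing H) (recognizing_class H).

Lemma subgroup_of_classK : cancel subgroup_of_class class_of_subgroup.
Proof.
move=> C; have [G nG CG] := class_inhabited C; apply: sig_eq => /=.
apply/funext => G'; apply/propext; rewrite /recognizing /= (class_recognizedE CG).
case: C CG => C [G0 nG0 EC] /= CG; subst C; move/(iso_classP _ nG0): CG => [_ ->].
by rewrite (propext (iso_classP G' nG0)).
Qed.

Lemma class_of_subgroupK : cancel class_of_subgroup subgroup_of_class.
Proof.
move=> H; apply: sig_eq; have [G [nG EG]] : exists G, recognizing H G.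
  by have [G nG EG] := subgroup_automaton leT (svalP H); exists G.
by rewrite /= (@class_recognizedE (class_of_subgroup H) G).
Qed.

Lemma subgroup_of_class_ofE (G : enriched X A) (nG : normalized le G) :
  sval (subgroup_of_class (class_of nG)) = recognized G.
Proof. by apply: class_recognizedE; apply/(iso_classP _ nG). Qed.

End Bijection.

Theorem theorem3p7 (X : finType) (A : zmodType) (le : rel (X + X))
    (fgA : fg_abelian A) (le_total : total_order le) :
  exists (Phi : iso_classes A le -> subgroups (free_times_ab X A))
         (St : subgroups (free_times_ab X A) -> iso_classes A le),
    [/\ (forall (G : enriched X A) (hG : normalized le G),
           sval (Phi (class_of hG)) = recognized G),
        cancel Phi St /\ cancel St Phi,
        (forall (G : enriched X A) (hG : normalized le G),
           finitely_generated (Phi (class_of hG)) <-> finite_automaton G)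
      & (forall (r : nat) (t : r.-tuple A), generates_ab t ->
           (exists f : seq (elt_code X r) -> automaton_code X r,
              computable f /\
              forall s : seq (elt_code X r),
                sval (St (generated_by_codes t s)) (decode t (f s))) /\
           (exists g : automaton_code X r -> seq (elt_code X r),
              computable g /\
              forall (c : automaton_code X r) (hc : normalized le (decode t c)),
                generated_by_codes t (g c) = Phi (class_of hc)))].
Proof.
exists (subgroup_of_class le_total), (class_of_subgroup le_total); split.
- exact: subgroup_of_class_ofE.
- by split; [exact: subgroup_of_classK | exact: class_of_subgroupK].
- move=> G nG; have [[dG cG] _ _] := nG; split=> [[s Es]|finG].
    apply: (@fg_finite_automaton _ _ G s) => //.
    by rewrite -(subgroup_of_class_ofE le_total nG) Es.
  have [s Es] := finite_automaton_fg fgA cG finG.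
  by exists s; apply: sig_eq; rewrite subgroup_of_class_ofE Es.
move=> r t _; split.
  have [f cf fP] := computable_stallings r le_total.
  exists f; split=> // s; have [y [<- ok]] := fP s.
  exact: stallings_check_sound t le_total ok.
exists (@code_generators X r); split; first exact: computable_code_generators.
move=> c nc; apply: sig_eq; rewrite subgroup_of_class_ofE.
by have [[_ cc] _ _] := nc; exact: code_generators_correct.
Qed.
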